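(* Let $p,q\in H=\mathbb{K}\langle X\rangle\setminus\{0\}$. Then $p$ left divides $q$ in $\mathbb{K}\langle X\rangle$ (i.e. $q\in pH$) if and only if $p$ left divides $q$ in $\mathbb{F}$. Respectively, $p$ right divides $q$ in $\mathbb{K}\langle X\rangle$ (i.e. $q\in Hp$) if and only if $p$ right divides $q$ in $\mathbb{F}$.
   Context: Let $\mathbb{K}$ be a commutative field, $X=\{x_1,\dots,x_d\}$ a finite non-empty alphabet, $\mathbb{K}\langle X\rangle$ the free associative algebra and $\mathbb{F}$ its universal field of fractions (the free field). Write $\mathbb{F}^\bullet=\mathbb{F}\setminus\{0\}$. A linear representation of $f\in\mathbb{F}$ of dimension $n$ is a triple $(u,A,v)$ with $u\in\mathbb{K}^{1\times n}$, $v\in\mathbb{K}^{n\times 1}$, $A=A_0+A_1x_1+\dots+A_dx_d$ with $A_\ell\in\mathbb{K}^{n\times n}$, $A$ invertible over $\mathbb{F}$, and $f=uA^{-1}v$. It is minimal if $n$ is smallest possible among all linear representations of $f$; this smallest $n$ is $\operatorname{rank}(f)$. Left and right factors. Let $h\in\mathbb{F}^\bullet$. An element $f\in\mathbb{F}^\bullet$ is a left factor of $h$ if $\operatorname{rank}(f)+\operatorname{rank}(f^{-1}h)\le\operatorname{rank}(h)+1$ and $\operatorname{rank}(h^{-1}f)+\operatorname{rank}(f^{-1})\le\operatorname{rank}(h^{-1})+1$. An element $g\in\mathbb{F}^\bullet$ is a right factor of $h$ if $\operatorname{rank}(hg^{-1})+\operatorname{rank}(g)\le\operatorname{rank}(h)+1$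 and $\operatorname{rank}(g^{-1})+\operatorname{rank}(gh^{-1})\le\operatorname{rank}(h^{-1})+1$. (So $f$ is a left factor of $h$ iff $f^{-1}h$ is a right factor of $h$.) Derivation trees. For $m\ge2$ and a product $f=f_1f_2\cdots f_m$, let $\mathcal{T}(f;f_1,\dots,f_m)$ be the set of complete plane (ordered) binary trees rooted at $f$ with the $m$ leaves $f_1,\dots,f_m$ in this order (i.e. all full parenthesizations of the product). For $\tau_0$ in this set, a subtree $\tau$ is non-trivial if it has at least two leaves; then $\tau(\mathrm{l})$ and $\tau(\mathrm{r})$ are its left and right subtrees, and $f_\tau=f_{\tau(\mathrm{l})}f_{\tau(\mathrm{r})}$ is the product of the leaves of $\tau$. The tree $\tau_0$ itself counts as a subtree. Divisibility in $\mathbb{F}$. An element $g\in\mathbb{F}^\bullet$ left divides $f\in\mathbb{F}^\bullet$ in $\mathbb{F}$ if for some $m',m\in\{1,2,\dots\}$ with $m'<m$ there exist $f_1,\dots,f_m\in\mathbb{F}^\bullet$ and $\tau_0\in\mathcal{T}(f;f_1,\dots,f_m)$ such that $g=f_1\cdots f_{m'}$, $f=gf_{m'+1}\cdots f_m$, and $f_{\tau(\mathrm{l})}$ is a left factor of $f_\tau$ for every non-trivial subtree $\tau$ of $\tau_0$. Right division in $\mathbb{F}$ is defined symmetrically: $g=f_{m'+1}\cdots f_m$, $f=f_1\cdots f_{m'}g$, and $f_{\tau(\mathrm{r})}$ is a right factor of $f_\tau$ for every non-trivial subtree $\tau$ of $\tau_0$. *)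

(* Defs.v *)
From mathcomp Require Export all_boot all_algebra.
From mathcomp Require Export boolp.
From mathcomp.multinomials Require Export monalg.

Set Implicit Arguments.
Unset Strict Implicit.
Unset Printing Implicit Defensive.

Import GRing.Theory.
Local Open Scope ring_scope.

(* [{fmonom 'I_d}] is the free monoid on d letters (words under concatenation),
   so its monoid algebra is the free associative algebra. *)
Notation free_algebra K d := {malg K[{fmonom 'I_d}]}.

Definition letter (K : fieldType) (d : nat) (l : 'I_d) : free_algebra K d :=
  << fmu l >>.

(* Cohn's specialization from the R-field [iota : R -> F] to the R-field
   [phi : R -> L]: a ring homomorphism over R, from a subring S of F containing
   the image of R, such that every element of S outside its kernel has its
   inverse in S.  The values of [psi] outside S are irrelevant. *)
Definition is_specialization (R : nzRingType) (F L : unitRingType)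
    (iota : {rmorphism R -> F}) (phi : {rmorphism R -> L})
    (S : {pred F}) (psi : F -> L) : Prop :=
  [/\ subring_closed S,
      forall a, iota a \in S /\ psi (iota a) = phi a,
      {in S &, {morph psi : x y / x + y}},
      {in S &, {morph psi : x y / x * y}} &
      forall x, x \in S -> psi x != 0 -> x^-1 \in S].

(* Cohn's universal field of fractions.  [GRing.field_axiom] says that nonzero
   elements are units; commutativity is not implied.  The third clause says that
   F is generated by the image of R as a skew field.  Uniqueness of the
   specialization (up to agreement on a smaller domain) then is automatic. *)
Definition universal_field_of_fractions (R : nzRingType) (F : unitRingType)
    (iota : {rmorphism R -> F}) : Prop :=
  [/\ GRing.field_axiom F,
      injective iota,
      forall S : {pred F}, divring_closed S -> (forall a, iota a \in S) ->
        forall x, x \in S &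
      forall (L : unitRingType) (phi : {rmorphism R -> L}),
        GRing.field_axiom L -> exists S psi, is_specialization iota phi S psi].

Section FreeField.

Variables (K : fieldType) (d : nat) (F : unitRingType).
Variable iota : {rmorphism free_algebra K d -> F}.

Definition linear_pencil n (A0 : 'M[K]_n) (A : 'I_d -> 'M[K]_n) :
    'M[free_algebra K d]_n :=
  map_mx (fun c => c%:MP) A0
  + \sum_(l < d) map_mx (fun c => c *: letter K l) (A l).

Definition scalar_mx_in_F m n (M : 'M[K]_(m, n)) : 'M[F]_(m, n) :=
  map_mx (fun c => iota c%:MP) M.

(* [unitmx] and [invmx] need commutative coefficients, so the inverse B of the
   pencil is given explicitly. *)
Definition linear_representation (f : F) n (u : 'rV[K]_n)
    (A0 : 'M[K]_n) (A : 'I_d -> 'M[K]_n) (v : 'cV[K]_n) : Prop :=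
  let AF := map_mx iota (linear_pencil A0 A) in
  exists B : 'M[F]_n,
    [/\ AF *m B = 1%:M, B *m AF = 1%:M &
        f%:M = scalar_mx_in_F u *m B *m scalar_mx_in_F v :> 'M[F]_1].

Definition has_linear_representation (f : F) (n : nat) : Prop :=
  exists u A0 A v, @linear_representation f n u A0 A v.

(* The default 0 is never used when F is the free field: there every element
   has a linear representation. *)
Definition rank (f : F) : nat :=
  match pselect (exists n, `[< has_linear_representation f n >]) with
  | left ex => ex_minn ex
  | right _ => 0
  end.

Definition left_factor (f h : F) : Prop :=
  [/\ f != 0, h != 0,
      (rank f + rank (f^-1 * h) <= rank h + 1)%N &
      (rank (h^-1 * f) + rank f^-1 <= rank h^-1 + 1)%N].

Definition right_factor (g h : F) : Prop :=
  [/\ g != 0, h != 0,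
      (rank (h * g^-1) + rank g <= rank h + 1)%N &
      (rank g^-1 + rank (g * h^-1) <= rank h^-1 + 1)%N].

Inductive tree : Type :=
  | Leaf of F
  | Node of tree & tree.

Fixpoint leaves (t : tree) : seq F :=
  match t with
  | Leaf x => [:: x]
  | Node l r => leaves l ++ leaves r
  end.

Fixpoint tree_prod (t : tree) : F :=
  match t with
  | Leaf x => x
  | Node l r => tree_prod l * tree_prod r
  end.

Inductive subtree (s : tree) : tree -> Prop :=
  | subtree_refl : subtree s s
  | subtree_left l r : subtree s l -> subtree s (Node l r)
  | subtree_right l r : subtree s r -> subtree s (Node l r).

Definition derivation_tree (f : F) (fs : seq F) (t : tree) : Prop :=
  leaves t = fs /\ tree_prod t = f.

Definition left_divides_in_F (g f : F) : Prop :=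
  g != 0 /\ f != 0 /\
  exists (m' m : nat) (fs : m.-tuple F) (t0 : tree),
    [/\ (0 < m' < m)%N, all (fun x => x != 0) fs & derivation_tree f fs t0] /\
    [/\ g = \prod_(x <- take m' fs) x,
        f = g * \prod_(x <- drop m' fs) x &
        forall l r, subtree (Node l r) t0 ->
          left_factor (tree_prod l) (tree_prod (Node l r))].

Definition right_divides_in_F (g f : F) : Prop :=
  g != 0 /\ f != 0 /\
  exists (m' m : nat) (fs : m.-tuple F) (t0 : tree),
    [/\ (0 < m' < m)%N, all (fun x => x != 0) fs & derivation_tree f fs t0] /\
    [/\ g = \prod_(x <- drop m' fs) x,
        f = \prod_(x <- take m' fs) x * g &
        forall l r, subtree (Node l r) t0 ->
          right_factor (tree_prod r) (tree_prod (Node l r))].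

End FreeField.

Definition left_divides_in_H (R : nzRingType) (p q : R) : Prop :=
  exists2 h : R, h != 0 & q = p * h.

Definition right_divides_in_H (R : nzRingType) (p q : R) : Prop :=
  exists2 h : R, h != 0 & q = h * p.

(* Main.v *)
(* If p divides q in the free algebra, q = p h, then the two-leaf tree does: minimal automata of p and h share one line
   in the product representation, so rank p + rank h <= rank q + 1, and they show that inversion lowers the rank of a
   nonconstant polynomial, which with rank q <= rank q^-1 + 1 gives the inequality for the inverses.

   Conversely it suffices that f and g are polynomials whenever f g = h is a nonzero polynomial and
   rank f + rank g <= rank h + 1: the leaves of a derivation tree of q are then polynomials. Two representations of h are
   compared: the product of minimal ones of f and g, with vectors of solutions t and s (row and column), and the
   automaton of h, whose solutions are polynomials. The larger solution s expresses linearly over K in terms of the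
   polynomial one as soon as its entries span at most rank h dimensions, and likewise for t. The size of the product
   is at most rank h + 1, so this only fails for entries of s that are independent; if those of t are independent too,
   the product is minimal and has size rank h. Hence f or g is a polynomial, and then the automaton of this factor
   yields a linear dependency in s or t which makes the other factor a polynomial.

   The comparison rests on Cohn's theorem that a linear pencil which is singular over the free field is hollow, i.e. has
   constant base changes exhibiting too large a zero block. By universality such a pencil is singular at every point of
   every skew field L with center k containing K. Choose a point of maximal rank among all L infinite over k, perturb it
   along t in L((t)), and read off the vanishing of the first-order terms: since a sum z |-> sum_i a_i z b_i of finite
   range with independent b_i is zero, the zero block is already visible over k, and descends to K. *)

Require Import Defs.
From HB Require Import structures.
From mathcomp Require Import all_order finmap zify.

Set Implicit Arguments.
Unset Strict Implicit.
Unset Printing Implicit Defensive.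

Import Order.TTheory GRing.Theory Num.Theory.
Local Open Scope ring_scope.

(** * Linear algebra over skew fields *)

(** Universality gives only specializations into other skew fields, so hollowness has to be forced
    by the values of a pencil at many points. Maximality must survive the passage from L to L((t)):
    hence the maxima range over all admissible skew fields at once, and this class must be closed
    under Laurent series. An iterated series field with y x = q x y shows that it is not empty. The
    constant term of a pencil is never perturbed; its share of the zero block is recovered from the
    value of the pencil at the maximal point, which is the sum of the constant term and the letter
    terms. To compare two representations of one element, their difference is formed. It represents
    0, so its pencil bordered by the two vectors is singular, and the criterion for singular pencils
    applies to it. Right-handed versions pass to the opposite ring by transposition. *)

Section SkewLinearAlgebra.
Variable L : unitRingType.
Hypothesis L_field : GRing.field_axiom L.

Lemma skew_mulVr (x : L) : x != 0 -> x^-1 * x = 1.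
Proof. by move=> /L_field /mulVr. Qed.

Lemma skew_mulrV (x : L) : x != 0 -> x * x^-1 = 1.
Proof. by move=> /L_field /divrr. Qed.

Lemma skew_mul_eq0 (x y : L) : x * y = 0 -> x = 0 \/ y = 0.
Proof.
have [->|x0] := eqVneq x 0; first by left.
by move=> xy; right; rewrite -[y]mul1r -(skew_mulVr x0) -mulrA xy mulr0.
Qed.

Lemma mx_neq0P m n (A : 'M[L]_(m, n)) : A != 0 -> exists i j, A i j != 0.
Proof.
move=> A0; have [//|H] := pselect (exists i j, A i j != 0).
case/eqP: A0; apply/matrixP => i j; rewrite mxE; apply/eqP.
by apply: contra_notT H => Aij; exists i, j.
Qed.

(** Rows are added one at a time. [y] is the residue of the new row [x] modulo the rows of [X]: if
    it vanishes it is a relation, otherwise it supplies a pivot that enlarges the right inverse. *)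
Lemma left_kernel_or_right_inverse m n (X : 'M[L]_(m, n)) :
  (exists2 w : 'rV_m, w != 0 & w *m X = 0) \/ (exists X', X *m X' = 1%:M).
Proof.
elim: m X => [|m IH] X; first by right; exists 0; apply/matrixP => - [].
have -> : X = @col_mx L 1 m n (usubmx (X : 'M_(1 + m, n))) (dsubmx (X : 'M_(1 + m, n))).
  by rewrite vsubmxK.
move: (usubmx _) (dsubmx _) => x {}X.
have [[w w0 wX]|[X' XX']] := IH X.
  left; exists (row_mx (0 : 'M_1) w); last by rewrite (mul_row_col (0 : 'M_1)) mul0mx add0r.
  apply: contra_neq w0 => H.
  by have := congr1 (@rsubmx L 1 1 m) H; rewrite row_mxKr => ->; apply/matrixP => i j; rewrite !mxE.
have [y yE] : exists y, y = x - x *m X' *m X by exists (x - x *m X' *m X).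
have yX' : y *m X' = 0 by rewrite yE mulmxBl -!mulmxA XX' mulmx1 subrr.
have [y0|/mx_neq0P [i [b]]] := eqVneq y 0.
  left; exists (row_mx (1%:M : 'M_1) (- (x *m X'))).
    apply/eqP => H; have := congr1 (@lsubmx L 1 1 m) H.
    by rewrite row_mxKl => /matrixP /(_ 0 0); rewrite !mxE eqxx => /eqP; rewrite oner_eq0.
  by rewrite (mul_row_col (1%:M : 'M_1)) mul1mx mulNmx -yE.
rewrite ord1 => yb {i}.
(* The factor [1 - X' X] maps into the right kernel of [X]; the pivot normalizes [x c] to 1. *)
pose c : 'cV_n := ((1%:M - X' *m X) *m delta_mx b 0) *m (y 0 b)^-1%:M.
have xc : x *m c = 1%:M.
  rewrite !mulmxA mulmxBr mulmx1 mulmxA -yE -colE.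
  by apply/matrixP => j k; rewrite !ord1 !mxE big_ord1 !mxE !eqxx !mulr1n skew_mulrV.
have Xc : X *m c = 0.
  by rewrite !mulmxA mulmxBr mulmx1 mulmxA XX' mul1mx subrr !mul0mx.
right; exists (row_mx c (X' - c *m (x *m X'))).
change (@mulmx L (1 + m) n (1 + m) (col_mx x X) (row_mx c (X' - c *m (x *m X'))) = 1%:M).
rewrite mul_col_row.
rewrite xc Xc !mulmxBr XX' [x *m (c *m _)]mulmxA xc mul1mx subrr.
by rewrite [X *m (c *m _)]mulmxA Xc mul0mx subr0 -scalar_mx_block.
Qed.

Lemma col_kernel m n (X : 'M[L]_(m, n.+1)) (w : 'rV_m) :
  col 0 X = 0 -> w *m col' 0 X = 0 -> w *m X = 0.
Proof.
move=> X0 wX; apply/matrixP => i j; rewrite [RHS]mxE.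
have [k ->|->] := unliftP 0 j.
  have /matrixP /(_ i k) := wX; rewrite [LHS]mxE [RHS]mxE => H.
  by rewrite -[RHS]H mxE; apply: eq_bigr => l _; rewrite !mxE.
rewrite mxE big1 // => l _; have /matrixP /(_ l 0) := X0.
by rewrite !mxE => ->; rewrite mulr0.
Qed.

(** The Schur complement of the pivot [X i 0]. As an explicit rational formula it commutes with any
    specialization at which the pivot stays nonzero. *)
Definition eliminate m n (X : 'M[L]_(m.+1, n.+1)) i : 'M[L]_(m, n) :=
  \matrix_(j, k) (X (lift i j) (lift 0 k) - X (lift i j) 0 * (X i 0)^-1 * X i (lift 0 k)).

Lemma eliminate_lift m n (X : 'M[L]_(m.+1, n.+1)) i (w : 'rV_m) :
  X i 0 != 0 -> w *m eliminate X i = 0 ->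
  exists2 w' : 'rV_m.+1, w' *m X = 0 & col' i w' = w.
Proof.
move=> Xi wY; pose c j := X (lift i j) 0 * (X i 0)^-1.
pose w' : 'rV_m.+1 := \row_j (if unlift i j is Some k then w 0 k else - \sum_k w 0 k * c k).
exists w'; last by apply/rowP => j; rewrite !mxE liftK.
have w'X k : (w' *m X) 0 k = \sum_j w 0 j * (X (lift i j) k - c j * X i k).
  rewrite mxE (bigD1_ord i) //= !mxE unlift_none mulNr mulr_suml addrC.
  rewrite [in LHS](eq_bigr (fun j => w 0 j * X (lift i j) k)); last by move=> j _; rewrite mxE liftK.
  by rewrite -sumrB; apply: eq_bigr => j _; rewrite mulrBr [w 0 j * (c j * _)]mulrA.
apply/matrixP => a k; rewrite ord1 w'X [RHS]mxE.
have [k' ->|->] := unliftP 0 k.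
  have /matrixP /(_ 0 k') := wY; rewrite [LHS]mxE [RHS]mxE => H; rewrite -[RHS]H.
  by apply: eq_bigr => j _; rewrite mxE.
by apply: big1 => j _; rewrite /c -mulrA skew_mulVr // mulr1 subrr mulr0.
Qed.

Lemma eliminate_kernel m n (X : 'M[L]_(m.+1, n.+1)) i (w : 'rV_m.+1) :
  X i 0 != 0 -> w *m X = 0 -> col' i w *m eliminate X i = 0 /\ (col' i w = 0 -> w = 0).
Proof.
move=> Xi wX; have H k : w 0 i * X i k = - \sum_j w 0 (lift i j) * X (lift i j) k.
  have /matrixP /(_ 0 k) := wX; rewrite !mxE (bigD1_ord i) //= => /eqP.
  by rewrite addr_eq0 => /eqP.
have wi : w 0 i = - \sum_j w 0 (lift i j) * (X (lift i j) 0 * (X i 0)^-1).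
  rewrite -[LHS]mulr1 -(skew_mulrV Xi) mulrA H mulNr mulr_suml.
  by congr (- _); apply: eq_bigr => j _; rewrite mulrA.
split; last first.
  move=> w0; apply/rowP => l; rewrite [RHS]mxE.
  have wl j : w 0 (lift i j) = 0 by have /rowP /(_ j) := w0; rewrite !mxE.
  have [j ->|->] := unliftP i l; first exact: wl.
  by rewrite wi big1 ?oppr0 // => j _; rewrite wl mul0r.
apply/rowP => k; rewrite !mxE.
rewrite (eq_bigr (fun j => w 0 (lift i j) * X (lift i j) (lift 0 k) -
   w 0 (lift i j) * (X (lift i j) 0 * (X i 0)^-1) * X i (lift 0 k))); last first.
  by move=> j _; rewrite !mxE mulrBr !mulrA.
rewrite sumrB -mulr_suml -[X in _ - X * _]opprK -wi mulNr H !opprK.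
by rewrite subrr.
Qed.

Lemma left_kernel_of_tall m n (X : 'M[L]_(m, n)) :
  (n < m)%N -> exists2 w : 'rV_m, w != 0 & w *m X = 0.
Proof.
elim: n m X => [|n IH] m X nm.
  exists (delta_mx 0 (Ordinal nm)); last by apply/matrixP => i [].
  by apply/eqP => /matrixP /(_ 0 (Ordinal nm)); rewrite !mxE !eqxx => /eqP; rewrite oner_eq0.
case: m X nm => [//|m] X nm.
have [X0|] := eqVneq (col 0 X) 0.
  have [w w0 wX] := IH m.+1 (col' 0 X) (ltnW nm).
  by exists w => //; apply: col_kernel X0 wX.
case/mx_neq0P => i [j]; rewrite ord1 mxE => Xi {j}.
have [w w0 /(eliminate_lift Xi) [w' w'X w'w]] := IH m (eliminate X i) nm.
exists w' => //; apply: contra_neq w0 => w'0.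
by rewrite -w'w w'0; apply/matrixP => a b; rewrite !mxE.
Qed.

Lemma factor_id_leq m n (A : 'M[L]_(m, n)) (B : 'M[L]_(n, m)) :
  A *m B = 1%:M -> (m <= n)%N.
Proof.
move=> AB; rewrite leqNgt; apply/negP => /(left_kernel_of_tall A) [w w0 wA].
by case/eqP: w0; rewrite -[w]mulmx1 -AB mulmxA wA mul0mx.
Qed.

(** A column where [y] is nonzero is a right combination of the others. This takes the place of
    rank-nullity. *)
Lemma right_kernel_factor m n (X : 'M[L]_(m, n.+1)) (y : 'cV_n.+1) :
  y != 0 -> X *m y = 0 -> exists (X1 : 'M_(m, n)) (Z : 'M_(n, n.+1)), X = X1 *m Z.
Proof.
case/mx_neq0P => i [j]; rewrite ord1 => yi Xy {j}.
exists (col' i X), (\matrix_(j, k) ((lift i j == k)%:R - (i == k)%:R * (y (lift i j) 0 / y i 0))).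
apply/matrixP => a k; rewrite !mxE.
have [b ->|->] := unliftP i k.
  rewrite (bigD1 b) //= !mxE eqxx (negPf (neq_lift i b)) mul0r subr0 mulr1 big1 ?addr0 //.
  move=> l /negPf lb; rewrite !mxE (inj_eq lift_inj) lb (negPf (neq_lift i b)).
  by rewrite mul0r subr0 mulr0.
have := congr1 (fun M : 'cV_m => M a 0) Xy; rewrite !mxE (bigD1_ord i) //= => H.
have -> : X a i = - (\sum_j X a (lift i j) * y (lift i j) 0) / y i 0.
  by rewrite -[LHS]mulr1 -(skew_mulrV yi) mulrA; congr (_ * _); move/eqP: H; rewrite addr_eq0 => /eqP.
rewrite mulNr mulr_suml -sumrN; apply: eq_bigr => l _.
by rewrite !mxE eqxx mul1r eq_sym (negPf (neq_lift i l)) sub0r mulrN mulrA.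
Qed.

(** A nonzero column of [1 - B A] lies in the kernel of [A], so [A], and with it the identity, would
    factor through one dimension less. *)
Lemma square_inverse n (A B : 'M[L]_n) : A *m B = 1%:M -> B *m A = 1%:M.
Proof.
move=> AB; apply/eqP; rewrite eq_sym -subr_eq0; apply/negPn/negP => /mx_neq0P [i [j ij]].
case: n => [|n] in A B AB i j ij *; first by case: i ij.
pose y := col j (1%:M - B *m A).
have y0 : y != 0 by apply/eqP => /matrixP /(_ i 0); rewrite !mxE => /eqP; apply/negP; move: ij; rewrite !mxE.
have Ay : A *m y = 0 by rewrite /y colE mulmxA mulmxBr mulmx1 mulmxA AB mul1mx subrr mul0mx.
have [X1 [Z AE]] := right_kernel_factor y0 Ay.
by have := @factor_id_leq n.+1 n X1 (Z *m B); rewrite mulmxA -AE AB ltnn => /(_ erefl).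
Qed.

Lemma no_left_kernel_inverse n (A : 'M[L]_n) :
  (forall w : 'rV_n, w *m A = 0 -> w = 0) ->
  exists B, A *m B = 1%:M /\ B *m A = 1%:M.
Proof.
move=> H; case: (left_kernel_or_right_inverse A) => [[w w0 /H wE]|[B AB]].
  by rewrite wE eqxx in w0.
by exists B; split=> //; apply: square_inverse.
Qed.

End SkewLinearAlgebra.

(** * Right-handed statements through the opposite field *)

Section Converse.
Variable L : unitRingType.
Hypothesis L_field : GRing.field_axiom L.

Lemma converse_field_axiom : GRing.field_axiom (L^c : unitRingType).
Proof. by move=> x /L_field. Qed.

Lemma trmx_converse m n p (A : 'M[L]_(m, n)) (B : 'M[L]_(n, p)) :
  (A *m B)^T = (B^T : 'M[L^c]_(p, n)) *m (A^T : 'M[L^c]_(n, m)).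
Proof. by apply/matrixP => i j; rewrite !mxE; apply: eq_bigr => k _; rewrite !mxE. Qed.

Lemma trmx_converse' m n p (A : 'M[L^c]_(m, n)) (B : 'M[L^c]_(n, p)) :
  (A *m B)^T = (B^T : 'M[L]_(p, n)) *m (A^T : 'M[L]_(n, m)).
Proof. by apply/matrixP => i j; rewrite !mxE; apply: eq_bigr => k _; rewrite !mxE. Qed.

Lemma right_kernel_or_left_inverse m n (X : 'M[L]_(m, n)) :
  (exists2 w : 'cV_n, w != 0 & X *m w = 0) \/ (exists X', X' *m X = 1%:M).
Proof.
case: (left_kernel_or_right_inverse converse_field_axiom (X^T : 'M[L^c]_(n, m))).
  move=> [w w0 wX]; left; exists w^T; first by rewrite trmx_eq0.
  by rewrite -[LHS](@trmxK L) trmx_converse trmxK; apply/matrixP => i j; move/matrixP: wX => /(_ j i); rewrite !mxE.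
move=> [X' XX']; right; exists X'^T; apply: (can_inj (@trmxK L _ _)).
rewrite trmx_converse trmxK trmx1; exact: XX'.
Qed.

Lemma no_right_kernel_inverse n (A : 'M[L]_n) :
  (forall w : 'cV_n, A *m w = 0 -> w = 0) ->
  exists B, A *m B = 1%:M /\ B *m A = 1%:M.
Proof.
move=> H; case: (right_kernel_or_left_inverse A) => [[w w0 /H wE]|[B BA]].
  by rewrite wE eqxx in w0.
by exists B; split=> //; apply: square_inverse.
Qed.

(** Correcting the left inverse [Y'] by [Y' X' X] makes it vanish on [X']. Stacked under [X] it
    inverts [row_mx X' Y], so an identity of size [i + j] factors through [m]. *)
Lemma rank_sum_bound i j m (X : 'M[L]_(i, m)) (Y : 'M[L]_(m, j)) :
  (forall w : 'rV_i, w *m X = 0 -> w = 0) ->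
  (forall w : 'cV_j, Y *m w = 0 -> w = 0) ->
  X *m Y = 0 -> (i + j <= m)%N.
Proof.
move=> HX HY XY.
case: (left_kernel_or_right_inverse L_field X) => [[w w0 /HX wE]|[X' XX']].
  by rewrite wE eqxx in w0.
case: (right_kernel_or_left_inverse Y) => [[w w0 /HY wE]|[Y' YY']].
  by rewrite wE eqxx in w0.
pose A := col_mx X (Y' - Y' *m X' *m X).
have : A *m row_mx X' Y = 1%:M.
  rewrite mul_col_row XX' XY !mulmxBl YY' -[Y' *m X' *m X *m X']mulmxA XX' mulmx1 subrr.
  by rewrite -[Y' *m X' *m X *m Y]mulmxA XY mulmx0 subr0 -scalar_mx_block.
exact: factor_id_leq.
Qed.

End Converse.

(** * Skew Laurent series *)

Section IntegerSums.
Variable V : zmodType.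
Implicit Types F G : int -> V.

Definition supported (a b : int) F := forall i, ~~ (a <= i <= b) -> F i = 0.

Definition window_sum (a : int) (n : nat) F := \sum_(k < n) F (a + k%:Z).

Lemma window_sum_extend a n b m F :
  (forall i, ~~ (a <= i < a + n%:Z) -> F i = 0) -> b <= a -> a + n%:Z <= b + m%:Z ->
  window_sum b m F = window_sum a n F.
Proof.
move=> HF ba anbm; rewrite /window_sum -!(big_mkord predT (fun k => F (_ + k%:Z))).
have [k kE] : exists k : nat, a = b + k%:Z by exists `|a - b|%N; lia.
subst a; rewrite (@big_cat_nat _ _ _ k) //=; last by lia.
rewrite (@big_cat_nat _ _ _ (k + n)%N k m) //=; try lia.
rewrite big_nat_cond big1 ?add0r; last first.
  by move=> i; rewrite andbT => ik; apply: HF; lia.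
rewrite [X in _ + X]big_nat_cond [X in _ + X]big1 ?addr0; last first.
  by move=> i; rewrite andbT => ik; apply: HF; lia.
rewrite -{1}[k]add0n big_addn addKn; apply: eq_bigr => i _; congr F; lia.
Qed.

(** Total, with value 0 off the finitely supported functions, so that convolutions can be formed
    before their support is bounded. By [isumE] the window picked by [cid] does not matter. *)
Definition isum F : V :=
  if pselect (exists p : int * int, supported p.1 p.2 F) is left H
  then let p := projT1 (cid H) in window_sum p.1 `|p.2 - p.1|.+1 F else 0.

Lemma isumE a b n F : supported a b F -> b < a + n%:Z -> isum F = window_sum a n F.
Proof.
move=> HF bn; rewrite /isum; case: pselect => [H|[]]; last by exists (a, b).
case: cid => - [a' b'] /= HF'.
set m := `|_|.+1.
pose a'' := Num.min a a'.
pose N := (`|a''| + `|a| + `|a'| + n + m)%N.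
rewrite -(@window_sum_extend a' m a'' N); first last.
- by rewrite /N; lia.
- by rewrite /a''; lia.
- by move=> i Hi; apply: HF'; rewrite /m in Hi; lia.
apply: window_sum_extend; rewrite /N /a''; try lia.
by move=> i Hi; apply: HF; lia.
Qed.

Lemma supportedW a b a' b' F : a' <= a -> b <= b' -> supported a b F -> supported a' b' F.
Proof. by move=> aa bb HF i Hi; apply: HF; lia. Qed.

Lemma eq_isum F G : F =1 G -> isum F = isum G.
Proof. by move=> /funext ->. Qed.

Lemma isum0 : isum (fun=> 0) = 0.
Proof.
rewrite (@isumE 0 0 1); [exact: big1 | | by []].
by move=> i.
Qed.

Lemma isumD a b F G : supported a b F -> supported a b G ->
  isum (fun i => F i + G i) = isum F + isum G.
Proof.
move=> HF HG; have bn : b < a + (`|b - a|.+1)%:Z by lia.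
rewrite (isumE HF bn) (isumE HG bn) (isumE _ bn) ?/window_sum ?big_split // => i Hi.
by rewrite HF ?HG ?addr0.
Qed.

Lemma isum_shift a b c F : supported a b F -> isum (fun i => F (i + c)) = isum F.
Proof.
move=> HF; have bn : b < a + (`|b - a|.+1)%:Z by lia.
rewrite (isumE HF bn) (@isumE (a - c) (b - c) `|b - a|.+1) //; try lia.
  by apply: eq_bigr => i _; congr F; lia.
by move=> i Hi; apply: HF; lia.
Qed.

Lemma isum_single c F : (forall i, i != c -> F i = 0) -> isum F = F c.
Proof.
move=> HF; rewrite (@isumE c c 1); [by rewrite /window_sum big_ord1 addr0 | | lia].
by move=> i Hi; apply: HF; lia.
Qed.

Lemma isum_exchange a b a' b' (F : int -> int -> V) :
  (forall i j, ~~ ((a <= i <= b) && (a' <= j <= b')) -> F i j = 0) ->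
  isum (fun i => isum (F i)) = isum (fun j => isum (F^~ j)).
Proof.
move=> HF; have bn : b < a + (`|b - a|.+1)%:Z by lia.
have bn' : b' < a' + (`|b' - a'|.+1)%:Z by lia.
have H1 i : supported a' b' (F i) by move=> j Hj; apply: HF; lia.
have H2 j : supported a b (F^~ j) by move=> i Hi; apply: HF; lia.
rewrite (eq_isum (fun i => isumE (H1 i) bn')) (eq_isum (fun i => isumE (H2 i) bn)).
rewrite (isumE _ bn) ?(isumE _ bn').
- exact: exchange_big.
- by move=> j Hj; apply: big1 => k _; apply: HF; lia.
- by move=> j Hj; apply: big1 => k _; apply: HF; lia.
Qed.

End IntegerSums.

Lemma raddf_isum (U V : zmodType) (h : {additive U -> V}) a b (F : int -> U) :
  supported a b F -> h (isum F) = isum (fun i => h (F i)).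
Proof.
move=> HF; have bn : b < a + (`|b - a|.+1)%:Z by lia.
rewrite (isumE HF bn) (isumE _ bn) ?/window_sum ?raddf_sum // => i Hi.
by rewrite HF ?raddf0.
Qed.

Lemma isum_mull (R : pzRingType) (c : R) a b (F : int -> R) :
  supported a b F -> c * isum F = isum (fun i => c * F i).
Proof.
move=> HF; have bn : b < a + (`|b - a|.+1)%:Z by lia.
rewrite (isumE HF bn) (isumE _ bn) ?/window_sum ?mulr_sumr // => i Hi.
by rewrite HF ?mulr0.
Qed.

Lemma isum_mulr (R : pzRingType) (c : R) a b (F : int -> R) :
  supported a b F -> isum F * c = isum (fun i => F i * c).
Proof.
move=> HF; have bn : b < a + (`|b - a|.+1)%:Z by lia.
rewrite (isumE HF bn) (isumE _ bn) ?/window_sum ?mulr_suml // => i Hi.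
by rewrite HF ?mul0r.
Qed.

(** An action of the integers instead of one automorphism: negative powers of the variable then need
    no inverse map. *)
Record int_action (E : nzRingType) := IntAction {
  act :> int -> {rmorphism E -> E};
  act0 : forall x, act 0 x = x;
  actD : forall i j x, act (i + j) x = act i (act j x)
}.

(** Boolean, so that a series is determined by its coefficients: [laurentP] rests on proof
    irrelevance in [bool]. *)
Definition bounded_below (E : nzRingType) (f : int -> E) : bool :=
  `[< exists a : int, forall i, i < a -> f i = 0 >].

(* Formal Laurent series sum_i f_i t^i over E with t^i c = s i c t^i. *)
Record laurent_over (E : nzRingType) (s : int_action E) :=
  Laurent { coefl :> int -> E; coefl_bounded : bounded_below coefl }.

Section LaurentDef.
Variables (E : nzRingType) (s : int_action E).
Local Notation laurent := (laurent_over s).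
Local Notation Laurent := (@Laurent E s _).

HB.instance Definition _ := gen_eqMixin laurent.
HB.instance Definition _ := gen_choiceMixin laurent.

Lemma laurentP (f g : laurent) : coefl f =1 coefl g -> f = g.
Proof.
case: f g => [f Hf] [g Hg] /= /funext fg; subst g.
by have -> : Hf = Hg by exact: bool_irrelevance.
Qed.

Lemma bounded_belowP (f : laurent) : exists a : int, forall i, i < a -> f i = 0.
Proof. exact/asboolP/coefl_bounded. Qed.

Fact laurent_zero_bounded : bounded_below (fun=> 0 : E).
Proof. by apply/asboolP; exists 0. Qed.
Definition laurent_zero := Laurent laurent_zero_bounded.

Fact laurent_opp_bounded (f : laurent) : bounded_below (fun i => - f i).
Proof.
by have [a Ha] := bounded_belowP f; apply/asboolP; exists a => i /Ha ->; rewrite oppr0.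
Qed.
Definition laurent_opp f := Laurent (laurent_opp_bounded f).

Fact laurent_add_bounded (f g : laurent) : bounded_below (fun i => f i + g i).
Proof.
have [a Ha] := bounded_belowP f; have [b Hb] := bounded_belowP g.
by apply/asboolP; exists (Num.min a b) => i Hi; rewrite Ha ?Hb ?addr0 //; lia.
Qed.
Definition laurent_add f g := Laurent (laurent_add_bounded f g).

Fact laurent_addA : associative laurent_add.
Proof. by move=> f g h; apply: laurentP => i /=; rewrite addrA. Qed.
Fact laurent_addC : commutative laurent_add.
Proof. by move=> f g; apply: laurentP => i /=; rewrite addrC. Qed.
Fact laurent_add0 : left_id laurent_zero laurent_add.
Proof. by move=> f; apply: laurentP => i /=; rewrite add0r. Qed.
Fact laurent_addN : left_inverse laurent_zero laurent_opp laurent_add.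
Proof. by move=> f; apply: laurentP => i /=; rewrite addNr. Qed.

HB.instance Definition _ :=
  GRing.isZmodule.Build laurent laurent_addA laurent_addC laurent_add0 laurent_addN.

Definition conv (f g : int -> E) (n : int) := isum (fun i => f i * s i (g (n - i))).

Lemma conv_supported (f g : int -> E) a b n :
  (forall i, i < a -> f i = 0) -> (forall i, i < b -> g i = 0) ->
  supported a (n - b) (fun i => f i * s i (g (n - i))).
Proof.
move=> Hf Hg i Hi; have [ia|ia] := ltP i a; first by rewrite Hf // mul0r.
by rewrite Hg ?rmorph0 ?mulr0 //; lia.
Qed.

Lemma conv_low (f g : int -> E) a b n :
  (forall i, i < a -> f i = 0) -> (forall i, i < b -> g i = 0) ->
  n < a + b -> conv f g n = 0.
Proof.
move=> Hf Hg nab; rewrite -[RHS](@isum0 E); apply: eq_isum => i.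
have [ia|ia] := ltP i a; first by rewrite Hf // mul0r.
by rewrite Hg ?rmorph0 ?mulr0 //; lia.
Qed.

Fact laurent_mul_bounded (f g : laurent) : bounded_below (conv f g).
Proof.
have [a Ha] := bounded_belowP f; have [b Hb] := bounded_belowP g.
by apply/asboolP; exists (a + b) => n; apply: conv_low.
Qed.
Definition laurent_mul f g := Laurent (laurent_mul_bounded f g).

Definition mono (n : int) (c : E) (i : int) : E := if i == n then c else 0.
Fact laurent_mono_bounded n c : bounded_below (mono n c).
Proof.
by apply/asboolP; exists n => i; rewrite /mono; case: eqP => // ->; rewrite ltxx.
Qed.
Definition laurent_mono n c := Laurent (laurent_mono_bounded n c).
Definition laurent_one := laurent_mono 0 1.

Lemma conv_monol n c (g : int -> E) m : conv (mono n c) g m = c * s n (g (m - n)).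
Proof.
rewrite /conv (@isum_single _ n) /mono ?eqxx // => i /negPf ->.
by rewrite mul0r.
Qed.

Lemma conv_monor n c (f : int -> E) m : conv f (mono n c) m = f (m - n) * s (m - n) c.
Proof.
rewrite /conv (@isum_single _ (m - n)) /mono.
  by have -> : m - (m - n) == n by lia.
by move=> i ni; case: eqP => [/eqP E0|_]; [move/negP: ni; case; lia | rewrite rmorph0 mulr0].
Qed.

Fact laurent_mulA : associative laurent_mul.
Proof.
move=> f g h; apply: laurentP => n /=; apply/esym.
have [a Ha] := bounded_belowP f; have [b Hb] := bounded_belowP g.
have [c Hc] := bounded_belowP h.
pose F i j := f j * s j (g (i - j)) * s i (h (n - i)).
transitivity (isum (fun i => isum (F i))).
  apply: eq_isum => i; rewrite /= (@isum_mulr _ _ a (i - b)) //.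
  exact: conv_supported.
rewrite (@isum_exchange _ (a + b) (n - c) a (n - c - b)); last first.
  move=> i j Hij; rewrite /F.
  have [ja|ja] := ltP j a; first by rewrite Ha // !mul0r.
  have [ijb|ijb] := ltP (i - j) b; first by rewrite Hb // rmorph0 mulr0 mul0r.
  by rewrite Hc ?rmorph0 ?mulr0 //; lia.
apply: eq_isum => j; rewrite {}/F.
have Hs : supported b (n - j - c) (fun k => g k * s k (h (n - j - k))).
  exact: conv_supported.
rewrite /= /conv (raddf_isum _ Hs) (@isum_mull _ _ b (n - j - c)); last first.
  by move=> i /Hs H; apply: etrans (rmorph0 (s j)); congr (s j _).
set G := (X in _ = isum X).
have HG : supported b (n - j - c) G.
  move=> i /Hs H; rewrite /G; apply: etrans (mulr0 (f j)); congr (_ * _).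
  by apply: etrans (rmorph0 (s j)); congr (s j _).
(* Re-indexing by the exponent of the product of the first two factors turns the iterated twist
   [s j (s (i - j) _)] into [s i] by [actD]. *)
rewrite -(isum_shift (- j) HG) /G.
apply: eq_isum => i; rewrite /= rmorphM mulrA -actD.
have -> : j + (i - j) = i by lia.
by have -> : n - j - (i - j) = n - i by lia.
Qed.

Fact laurent_mul1f : left_id laurent_one laurent_mul.
Proof. by move=> f; apply: laurentP => n /=; rewrite conv_monol mul1r act0 subr0. Qed.

Fact laurent_mulf1 : right_id laurent_one laurent_mul.
Proof. by move=> f; apply: laurentP => n /=; rewrite conv_monor rmorph1 mulr1 subr0. Qed.

Fact laurent_mulDl : left_distributive laurent_mul +%R.
Proof.
move=> f g h; apply: laurentP => n /=.
have [a Ha] := bounded_belowP f; have [b Hb] := bounded_belowP g.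
have [c Hc] := bounded_belowP h.
rewrite /conv -(@isumD _ (Num.min a b) (n - c)).
- by apply: eq_isum => i; rewrite mulrDl.
- by apply: supportedW (conv_supported Ha Hc) => //; lia.
- by apply: supportedW (conv_supported Hb Hc) => //; lia.
Qed.

Fact laurent_mulDr : right_distributive laurent_mul +%R.
Proof.
move=> h f g; apply: laurentP => n /=.
have [a Ha] := bounded_belowP f; have [b Hb] := bounded_belowP g.
have [c Hc] := bounded_belowP h.
rewrite /conv -(@isumD _ c (n - Num.min a b)).
- by apply: eq_isum => i; rewrite rmorphD mulrDr.
- by apply: supportedW (conv_supported Hc Ha) => //; lia.
- by apply: supportedW (conv_supported Hc Hb) => //; lia.
Qed.

Fact laurent_1neq0 : laurent_one != 0.
Proof.
apply/eqP => /(congr1 (fun f : laurent => f 0)) /= /eqP.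
by rewrite /mono eqxx oner_eq0.
Qed.

HB.instance Definition _ := GRing.Zmodule_isNzRing.Build laurent
  laurent_mulA laurent_mul1f laurent_mulf1 laurent_mulDl laurent_mulDr laurent_1neq0.

Definition laurent_unit : pred laurent := fun f => `[< exists g, g * f = 1 /\ f * g = 1 >].
Definition laurent_inv (f : laurent) : laurent :=
  if pselect (exists g, g * f = 1 /\ f * g = 1) is left H then projT1 (cid H) else f.

Fact laurent_mulVf : {in laurent_unit, left_inverse 1 laurent_inv *%R}.
Proof.
move=> f /asboolP H; rewrite /laurent_inv; case: pselect => // H'.
by case: cid => g [].
Qed.
Fact laurent_mulfV : {in laurent_unit, right_inverse 1 laurent_inv *%R}.
Proof.
move=> f /asboolP H; rewrite /laurent_inv; case: pselect => // H'.
by case: cid => g [].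
Qed.
Fact laurent_unitP f g : g * f = 1 /\ f * g = 1 -> laurent_unit f.
Proof. by move=> H; apply/asboolP; exists g. Qed.
Fact laurent_invN : {in [predC laurent_unit], laurent_inv =1 id}.
Proof.
move=> f; rewrite inE /= => /asboolP H; rewrite /laurent_inv; case: pselect => // H'.
Qed.

HB.instance Definition _ := GRing.NzRing_hasMulInverse.Build laurent
  laurent_mulVf laurent_mulfV laurent_unitP laurent_invN.

Lemma coeflD (f g : laurent) n : (f + g) n = f n + g n. Proof. by []. Qed.
Lemma coeflN (f : laurent) n : (- f) n = - f n. Proof. by []. Qed.
Lemma coefl0 n : (0 : laurent) n = 0. Proof. by []. Qed.
Lemma coefl1 n : (1 : laurent) n = if n == 0 then 1 else 0. Proof. by []. Qed.
Lemma coeflM (f g : laurent) n : (f * g) n = conv f g n. Proof. by []. Qed.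
Lemma coefl_sum I r (P : pred I) (F : I -> laurent) n :
  (\sum_(i <- r | P i) F i) n = \sum_(i <- r | P i) F i n.
Proof. by elim/big_rec2: _ => // i x y _ <-. Qed.

Lemma coefl_monoM k c (f : laurent) n : (laurent_mono k c * f) n = c * s k (f (n - k)).
Proof. exact: conv_monol. Qed.
Lemma coeflM_mono k c (f : laurent) n : (f * laurent_mono k c) n = f (n - k) * s (n - k) c.
Proof. exact: conv_monor. Qed.

Lemma leading_coef (f : laurent) : f != 0 ->
  exists v : int, f v != 0 /\ forall i, i < v -> f i = 0.
Proof.
move=> f0; have [a Ha] := bounded_belowP f.
have [n] : exists n : nat, f (a + n%:Z) != 0.
  apply: contrapT => H; case/eqP: f0; apply: laurentP => i; rewrite coefl0.
  have [/Ha//|ai] := ltP i a; apply/eqP/negPn/negP => fi; apply: H.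
  by exists `|i - a|%N; have -> : a + `|i - a|%N%:Z = i by lia.
move=> fn; have ex : exists n : nat, f (a + n%:Z) != 0 by exists n.
case: (ex_minnP ex) => m fm Hm; exists (a + m%:Z); split=> // i Hi.
have [/Ha//|ai] := ltP i a; apply/eqP/negPn/negP => fi.
have E0 : a + `|i - a|%N%:Z = i by lia.
by have := Hm `|i - a|%N; rewrite E0 => /(_ fi); lia.
Qed.

Lemma coefl_mul_low (f g : laurent) a b n :
  (forall i, i < a -> f i = 0) -> (forall i, i < b -> g i = 0) ->
  n < a + b -> (f * g) n = 0.
Proof. exact: conv_low. Qed.

Lemma coefl_exp_low (h : laurent) k n :
  (forall i, i < 1 -> h i = 0) -> n < k%:Z -> (h ^+ k) n = 0.
Proof.
move=> Hh; elim: k n => [|k IH] n Hn; first by rewrite expr0 coefl1; case: eqP => //; lia.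
rewrite exprS (@coefl_mul_low _ _ 1 k%:Z) //; lia.
Qed.

(* The coefficients of the geometric series of h stabilize: only h ^+ k with k <= n contributes to the n-th one. *)
Lemma one_sub_right_inverse (h : laurent) :
  (forall i, i < 1 -> h i = 0) -> exists g, (1 - h) * g = 1.
Proof.
move=> Hh.
pose P (m : nat) : laurent := \sum_(k < m) h ^+ k.
pose c (n : int) : E := if n < 0 then 0 else P `|n|.+1 n.
have cb : bounded_below c by apply/asboolP; exists 0 => i; rewrite /c => ->.
have Pc m n : n < m%:Z -> P m n = c n.
  move=> nm; rewrite /c; case: ltP => n0.
    by rewrite coefl_sum big1 // => i _; rewrite coefl_exp_low //; lia.
  have [l ->] : exists l, m = (`|n|.+1 + l)%N by exists (m - `|n|.+1)%N; lia.
  rewrite !coefl_sum big_split_ord /= [X in _ + X]big1 ?addr0 // => i _.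
  by rewrite coefl_exp_low //; lia.
have E1 m : (1 - h) * P m = 1 - h ^+ m.
  by rewrite -opprB mulNr -subrX1 opprB.
exists (Laurent cb); apply: laurentP => n.
have -> : ((1 - h) * Laurent cb) n = ((1 - h) * P `|n|.+1) n.
  rewrite !coeflM; apply: eq_isum => i.
  have [i0|i0] := ltP i 0; last by rewrite [Laurent cb _]/= Pc //; lia.
  have -> : (1 - h) i = 0.
    rewrite coeflD coeflN coefl1 Hh ?subr0; last by lia.
    by case: eqP => //; lia.
  by rewrite !mul0r.
by rewrite E1 coeflD coeflN coefl_exp_low ?subr0 //; lia.
Qed.

End LaurentDef.

Section LaurentField.
Variables (E : unitRingType) (s : int_action E).
Hypothesis E_field : GRing.field_axiom E.
Local Notation L := (laurent_over s).

Lemma laurent_right_inverse (f : L) : f != 0 -> exists g, f * g = 1.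
Proof.
move=> /leading_coef [v [fv Hv]].
(* The coefficient is twisted by [s (- v)] in advance because it has to cross the power [v] of the
   variable; [f m] then starts with 1 in degree 0. *)
pose m : L := laurent_mono s (- v) (s (- v) (f v)^-1).
have H1 : forall i, i < 1 -> (1 - f * m) i = 0.
  move=> i i1; rewrite coeflD coeflN coefl1 coeflM_mono opprK.
  case: eqP => [->|i0]; last by rewrite Hv ?mul0r ?subr0 //; lia.
  by rewrite add0r -actD subrr act0 (skew_mulrV E_field) // subrr.
have [g Hg] := one_sub_right_inverse H1.
by exists (m * g); rewrite mulrA -{1}[f * m](subKr 1).
Qed.

Lemma laurent_field : GRing.field_axiom L.
Proof.
move=> f /laurent_right_inverse [g fg]; apply/asboolP; exists g; split=> //.
have g0 : g != 0 by apply: contra_eq_neq fg => ->; rewrite mulr0 eq_sym oner_eq0.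
have [h gh] := laurent_right_inverse g0.
suff -> : f = h by [].
by rewrite -[f]mulr1 -gh mulrA fg mul1r.
Qed.

End LaurentField.

Section ConstantSeries.
Variables (E : nzRingType) (s : int_action E).

Definition cst (c : E) : laurent_over s := laurent_mono s 0 c.

Lemma coefl_cst c n : cst c n = if n == 0 then c else 0.
Proof. by []. Qed.

Lemma coefl_cstM c (f : laurent_over s) n : (cst c * f) n = c * f n.
Proof. by rewrite coefl_monoM act0 subr0. Qed.

Fact cst_is_additive : additive cst.
Proof.
move=> a b; apply: laurentP => n; rewrite coeflD coeflN !coefl_cst.
by case: ifP; rewrite ?subr0.
Qed.
HB.instance Definition _ := GRing.isAdditive.Build _ _ cst cst_is_additive.

Fact cst_is_multiplicative : multiplicative cst.
Proof.
split=> [a b|//]; apply: laurentP => n.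
by rewrite coefl_cstM !coefl_cst; case: ifP; rewrite ?mulr0.
Qed.
HB.instance Definition _ := GRing.isMultiplicative.Build _ _ cst cst_is_multiplicative.

Lemma cst_inj : injective cst.
Proof. by move=> a b /(congr1 (fun f : laurent_over s => f 0)). Qed.

End ConstantSeries.

(** * Series in a central variable *)

Section TrivialAction.
Variable E : nzRingType.

Definition trivial_action : int_action E :=
  @IntAction E (fun=> idfun) (fun=> erefl) (fun _ _ _ => erefl).

Local Notation L := (laurent_over trivial_action).
Implicit Types f g : L.

Definition low f (a : int) := forall i, i < a -> f i = 0.

Lemma coeflM_cst f c n : (f * cst _ c) n = f n * c.
Proof. by rewrite coeflM_mono subr0. Qed.

Definition tvar : L := laurent_mono trivial_action 1 1.

Lemma coefl_tM f n : (tvar * f) n = f (n - 1).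
Proof. by rewrite coefl_monoM mul1r. Qed.

Lemma coefl_Mt f n : (f * tvar) n = f (n - 1).
Proof. by rewrite coeflM_mono mulr1. Qed.

Lemma coeflM_low0 f g a b : low f a -> low g b -> (f * g) (a + b) = f a * g b.
Proof.
move=> Hf Hg; rewrite coeflM /conv (@isum_single _ a) /=.
  by congr (_ * g _); lia.
move=> i ia; have [/Hf->|ai] := ltP i a; first by rewrite mul0r.
by rewrite Hg ?mulr0 //; lia.
Qed.

Lemma coeflM_low1 f g : low f 0 -> low g 0 -> (f * g) 1 = f 0 * g 1 + f 1 * g 0.
Proof.
move=> Hf Hg; rewrite coeflM /conv (@isumE _ 0 1 2) //=; first by rewrite /window_sum big_ord_recl big_ord1.
move=> i Hi; have [/Hf->|i0] := ltP i 0; first by rewrite mul0r.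
by rewrite Hg ?mulr0 //; lia.
Qed.

Lemma laurent_commute f g : (forall a b, f a * g b = g b * f a) -> f * g = g * f.
Proof.
move=> fg; apply: laurentP => n; rewrite !coeflM /conv.
have [a Ha] := bounded_belowP f; have [b Hb] := bounded_belowP g.
set F := (X in isum X = _); set G := (X in _ = isum X).
have HF : supported a (n - b) F by exact: conv_supported.
have HG : supported b (n - a) G by exact: conv_supported.
have bn : n - b < a + `|(n - b - a)%R|.+1%:Z by lia.
(* The second window is the mirror image of the first under [i] to [n - i], so that [rev_ord]
   matches the two sums term by term. *)
rewrite (isumE HF bn) (@isumE _ (n - a - `|(n - b - a)%R|%:Z) (n - a) `|(n - b - a)%R|.+1); first last.
- lia.
- by apply: supportedW HG; lia.
rewrite /window_sum (reindex_inj rev_ord_inj) /=.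
apply: eq_bigr => i _; rewrite /F /G /= fg subSS.
by congr (g _ * f _); have := ltn_ord i; lia.
Qed.

Lemma low_common m n (A : 'M[L]_(m, n)) : exists a, forall i j, low (A i j) a.
Proof.
suff H (I : finType) (F : I -> L) : exists a, forall i, low (F i) a.
  by have [a Ha] := H _ (fun ij : 'I_m * 'I_n => A ij.1 ij.2); exists a => i j; apply: (Ha (i, j)).
have [b Hb] := choice (fun i => bounded_belowP (F i)).
exists (- \sum_i `|b i|) => i k ki; apply: Hb.
suff : `|b i| <= \sum_i `|b i| by lia.
by rewrite (bigD1 i) //= lerDl sumr_ge0.
Qed.

End TrivialAction.

(** A name of its own for commutative coefficients, to carry the field structure. *)
Definition field_laurent (k : fieldType) := laurent_over (trivial_action k).
HB.instance Definition _ k := GRing.UnitRing.on (field_laurent k).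

Section FieldLaurent.
Variable k : fieldType.

Fact field_laurent_mulC : @commutative (field_laurent k) _ *%R.
Proof. by move=> f g; apply: laurent_commute => a b; rewrite mulrC. Qed.

HB.instance Definition _ :=
  GRing.PzRing_hasCommutativeMul.Build (field_laurent k) field_laurent_mulC.

Fact field_laurent_field : GRing.field_axiom (field_laurent k).
Proof. by apply: laurent_field => x; rewrite unitfE. Qed.

HB.instance Definition _ :=
  GRing.ComUnitRing_isField.Build (field_laurent k) field_laurent_field.

End FieldLaurent.

Definition field_cst (k : fieldType) : k -> field_laurent k := cst (trivial_action k).
HB.instance Definition _ k := GRing.RMorphism.copy (@field_cst k) (cst (trivial_action k)).

Section MapSeries.
Variables (k : fieldType) (L : unitRingType) (j : {rmorphism k -> L}).

Fact map_laurent_bounded (f : field_laurent k) : bounded_below (fun n => j (f n)).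
Proof.
by have [a Ha] := bounded_belowP f; apply/asboolP; exists a => i /Ha ->; rewrite rmorph0.
Qed.
Definition map_laurent (f : field_laurent k) : laurent_over (trivial_action L) :=
  Laurent _ (map_laurent_bounded f).

Lemma coefl_map f n : map_laurent f n = j (f n). Proof. by []. Qed.

Fact map_laurent_is_additive : additive map_laurent.
Proof. by move=> f g; apply: laurentP => n; rewrite coefl_map rmorphB. Qed.
HB.instance Definition _ :=
  GRing.isAdditive.Build (field_laurent k) _ map_laurent map_laurent_is_additive.

Fact map_laurent_is_multiplicative : multiplicative map_laurent.
Proof.
split=> [f g|]; last first.
  by apply: laurentP => n; rewrite coefl_map !coefl1; case: eqP; rewrite ?rmorph1 ?rmorph0.
apply: laurentP => n; rewrite coefl_map !coeflM /conv.
have [a Ha] := bounded_belowP f; have [b Hb] := bounded_belowP g.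
rewrite (raddf_isum _ (conv_supported _ Ha Hb (n := n))).
by apply: eq_isum => i; rewrite /= rmorphM.
Qed.
HB.instance Definition _ :=
  GRing.isMultiplicative.Build (field_laurent k) _ map_laurent map_laurent_is_multiplicative.

Lemma map_laurent_cst c : map_laurent (cst _ c) = cst _ (j c).
Proof. by apply: laurentP => n; rewrite coefl_map !coefl_cst; case: eqP; rewrite ?rmorph0. Qed.

End MapSeries.

(** * Matrices of Laurent series and descent of hollowness *)

Section SeriesMatrices.
Variable E : nzRingType.
Local Notation L := (laurent_over (trivial_action E)).
Local Notation cst := (cst (trivial_action E)).
Local Notation tvar := (tvar E).

Definition mcoef n m p (A : 'M[L]_(m, p)) : 'M[E]_(m, p) := map_mx (fun f : L => f n) A.

Definition mlow m p (A : 'M[L]_(m, p)) a := forall i j, low (A i j) a.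

Lemma mcoefD n m p (A B : 'M[L]_(m, p)) : mcoef n (A + B) = mcoef n A + mcoef n B.
Proof. by apply/matrixP => i j; rewrite !mxE. Qed.

Lemma mcoefN n m p (A : 'M[L]_(m, p)) : mcoef n (- A) = - mcoef n A.
Proof. by apply/matrixP => i j; rewrite !mxE. Qed.

Lemma mcoef0 n m p : mcoef n (0 : 'M[L]_(m, p)) = 0.
Proof. by apply/matrixP => i j; rewrite !mxE. Qed.

Lemma mcoef_cst n m p (A : 'M[E]_(m, p)) : mcoef n (map_mx cst A) = if n == 0 then A else 0.
Proof. by apply/matrixP => i j; rewrite !mxE coefl_cst; case: eqP; rewrite ?mxE. Qed.

Lemma mcoef1 n m : mcoef n (1%:M : 'M[L]_m) = if n == 0 then 1%:M else 0.
Proof. by rewrite -(map_mx1 cst) mcoef_cst. Qed.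

Lemma mcoef_cstM n m p q (A : 'M[E]_(m, p)) (B : 'M[L]_(p, q)) :
  mcoef n (map_mx cst A *m B) = A *m mcoef n B.
Proof.
apply/matrixP => i j; rewrite !mxE coefl_sum; apply: eq_bigr => k _.
by rewrite !mxE coefl_cstM.
Qed.

Lemma mcoefM_cst n m p q (A : 'M[L]_(m, p)) (B : 'M[E]_(p, q)) :
  mcoef n (A *m map_mx cst B) = mcoef n A *m B.
Proof.
apply/matrixP => i j; rewrite !mxE coefl_sum; apply: eq_bigr => k _.
by rewrite !mxE coeflM_cst.
Qed.

Lemma mcoef_tM n m p (A : 'M[L]_(m, p)) : mcoef n (tvar%:M *m A) = mcoef (n - 1) A.
Proof. by apply/matrixP => i j; rewrite mul_scalar_mx !mxE coefl_tM. Qed.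

Lemma tvarC m p (A : 'M[L]_(m, p)) : A *m tvar%:M = tvar%:M *m A.
Proof.
rewrite mul_scalar_mx; apply/matrixP => i j; rewrite !mxE (bigD1 j) //= big1 ?addr0.
  by rewrite mxE eqxx mulr1n; apply: laurentP => n; rewrite coefl_tM coefl_Mt.
by move=> k /negPf kj; rewrite mxE kj mulr0n mulr0.
Qed.

Lemma mcoefM_low m p q (A : 'M[L]_(m, p)) (B : 'M[L]_(p, q)) a b n :
  mlow A a -> mlow B b -> n = a + b -> mcoef n (A *m B) = mcoef a A *m mcoef b B.
Proof.
move=> HA HB ->; apply/matrixP => i j; rewrite !mxE coefl_sum; apply: eq_bigr => k _.
by rewrite !mxE coeflM_low0.
Qed.

Lemma mlowM m p q (A : 'M[L]_(m, p)) (B : 'M[L]_(p, q)) a b :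
  mlow A a -> mlow B b -> mlow (A *m B) (a + b).
Proof.
move=> HA HB i j n Hn; rewrite mxE coefl_sum big1 // => k _.
exact: coefl_mul_low (HA i k) (HB k j) Hn.
Qed.

Lemma mlow_cst m p (A : 'M[E]_(m, p)) : mlow (map_mx cst A) 0.
Proof. by move=> i j n n0; rewrite mxE coefl_cst; case: eqP => // ?; lia. Qed.

Lemma mlowP m p (A : 'M[L]_(m, p)) a : (forall n, n < a -> mcoef n A = 0) <-> mlow A a.
Proof.
split=> H; first by move=> i j n /H /matrixP /(_ i j); rewrite !mxE.
by move=> n na; apply/matrixP => i j; rewrite !mxE H.
Qed.

Lemma mcoefP m p (A B : 'M[L]_(m, p)) : (forall n, mcoef n A = mcoef n B) -> A = B.
Proof.
move=> H; apply/matrixP => i j; apply: laurentP => n.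
by have /matrixP /(_ i j) := H n; rewrite !mxE.
Qed.

Lemma mlow_ex m p (A : 'M[L]_(m, p)) : exists a, mlow A a.
Proof. exact: low_common. Qed.

(** Some lower bound always exists, and the hypothesis pushes it up to [a]. This suits recursions
    that determine each coefficient from the preceding one. *)
Lemma mlow_ind m p (A : 'M[L]_(m, p)) a :
  (forall n, n < a -> mcoef (n - 1) A = 0 -> mcoef n A = 0) -> mlow A a.
Proof.
move=> H; have [b Hb] := mlow_ex A; apply/mlowP.
suff K (l : nat) : b + l%:Z - 1 < a -> mcoef (b + l%:Z - 1) A = 0.
  move=> n na; have [nb|bn] := ltP n b; first by move/mlowP: Hb; apply.
  have -> : n = b + (`|n - b|.+1)%:Z - 1 by lia.
  by apply: K; lia.
elim: l => [|l IH] la; first by move/mlowP: Hb; apply; lia.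
apply: H => //; have -> : b + l.+1%:Z - 1 - 1 = b + l%:Z - 1 by lia.
by apply: IH; lia.
Qed.

Lemma leading_mcoef m p (A : 'M[L]_(m, p)) : A != 0 -> exists v, mlow A v /\ mcoef v A != 0.
Proof.
move=> A0; have [b Hb] := mlow_ex A; apply: contrapT => H.
case/eqP: A0; apply: mcoefP => n; rewrite mcoef0.
suff K l : mlow A (b + l%:Z).
  by move/mlowP: (K (`|n - b|.+1)); apply; lia.
elim: l => [|l IH]; first by rewrite addr0.
apply/mlowP => i il; have [ib|ib] := ltP i (b + l%:Z); first by move/mlowP: IH; apply.
have -> : i = b + l%:Z by lia.
by apply/eqP; apply: contra_notT H => ?; exists (b + l%:Z).
Qed.

End SeriesMatrices.

(* Base changes P and C exhibit a zero block too large for any combination of the M_l to be invertible. *)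
Definition hollow (k : fieldType) (I : Type) N (M : I -> 'M[k]_N) :=
  exists p c (P : 'M[k]_(p, N)) (C : 'M[k]_(N, c)),
    (forall l, P *m M l *m C = 0) /\ (N < \rank P + \rank C)%N.

(** * Descent of hollowness from series to constants *)

Section Descent.
Variable k : fieldType.
Local Notation kt := (field_laurent k).
Local Notation cst := (cst (trivial_action k)).
Local Notation co := (@coefl k (trivial_action k)).

Lemma series_val_ex (f : kt) : exists v : int, f != 0 -> co f v != 0 /\ low f v.
Proof.
have [->|f0] := eqVneq f 0; first by exists 0.
by have [v Hv] := leading_coef f0; exists v.
Qed.
Definition series_val f := projT1 (cid (series_val_ex f)).
Lemma series_valP f : f != 0 -> co f (series_val f) != 0 /\ low f (series_val f).
Proof. exact: projT2 (cid (series_val_ex f)). Qed.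

(** The form of Cramer's rule that governs the exchange of one row of a minor. *)
Lemma det_row_replaced (F : fieldType) n (A : 'M[F]_n) i0 :
  (forall i, i != i0 -> row i A = delta_mx 0 i) -> \det A = A i0 i0.
Proof.
move=> H; rewrite (expand_det_row A i0).
have H1 (a b : 'I_n) : cofactor (1%:M : 'M[F]_n) a b = (a == b)%:R.
  have := mul_mx_adj (1%:M : 'M[F]_n); rewrite det1 mul1mx => /matrixP /(_ b a).
  by rewrite !mxE eq_sym.
have na a : lift i0 a != i0 by rewrite eq_sym neq_lift.
rewrite (bigD1 i0) //= big1 ?addr0.
  rewrite (_ : cofactor A i0 i0 = 1) ?mulr1 //.
  have <- : cofactor (1%:M : 'M[F]_n) i0 i0 = 1 by rewrite H1 eqxx.
  rewrite /cofactor; congr (_ * \det _); apply/matrixP => a b; rewrite !mxE.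
  have /rowP /(_ (lift i0 b)) := H _ (na a).
  by rewrite !mxE eqxx => ->; rewrite eq_sym.
move=> j ji; rewrite (_ : cofactor A i0 j = 0) ?mulr0 //.
have <- : cofactor (1%:M : 'M[F]_n) i0 j = 0 by rewrite H1 eq_sym (negPf ji).
rewrite /cofactor; congr (_ * \det _); apply/matrixP => a b; rewrite !mxE.
have /rowP /(_ (lift j b)) := H _ (na a).
by rewrite !mxE eqxx => ->; rewrite eq_sym.
Qed.

(* Dividing by an r x r minor of least valuation makes all entries integral, by Cramer's rule. *)
Lemma integral_column_basis N r (C : 'M[kt]_(N, r)) : \rank C = r ->
  exists Z : 'M_r, mlow (C *m Z) 0 /\ \rank (mcoef 0 (C *m Z)) = r.
Proof.
move=> rC.
pose good (f : {ffun 'I_r -> 'I_N}) := rowsub f C \in unitmx.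
have [f0 gf0] : exists f0, good f0.
  have Cfull : row_full C by rewrite /row_full rC.
  exists (finfun (fullrankfun Cfull)); rewrite /good.
  have -> : rowsub (finfun (fullrankfun Cfull)) C = rowsub (fullrankfun Cfull) C.
    by apply/matrixP => i j; rewrite !mxE ffunE.
  exact: fullrowsub_unit.
pose val f := series_val (\det (rowsub (f : {ffun 'I_r -> 'I_N}) C)).
have [f gf fmin] : exists2 f, good f & forall g, good g -> val f <= val g.
  by case: (arg_minP val gf0) => f gf fmin; exists f.
pose Z := invmx (rowsub f C); exists Z; set D := C *m Z.
have Df : rowsub f D = 1%:M by rewrite -mul_rowsub_mx mulmxV.
have detf0 : \det (rowsub f C) != 0 by rewrite -unitfE -unitmxE.
have Dlow : mlow D 0.
  move=> i j; have [->|Dij] := eqVneq (D i j) 0; first by move=> n _.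
  pose g : {ffun 'I_r -> 'I_N} := [ffun a => if a == j then i else f a].
  have detg : \det (rowsub g C) = D i j * \det (rowsub f C).
    have -> : rowsub g C = rowsub g D *m rowsub f C.
      by rewrite /D -!mul_rowsub_mx -mulmxA mulVmx ?mulmx1.
    rewrite det_mulmx (@det_row_replaced _ _ _ j) ?mxE ?ffunE ?eqxx // => a aj.
    apply/rowP => b; rewrite !mxE ffunE (negPf aj).
    by have /matrixP /(_ a b) := Df; rewrite !mxE => ->; rewrite eqxx eq_sym.
  have gg : good g by rewrite /good unitmxE unitfE detg mulf_neq0.
  have [Dv Dl] := series_valP Dij; have [fv fl] := series_valP detf0.
  have detg0 : \det (rowsub g C) != 0 by rewrite detg mulf_neq0.
  have [_ gl] := series_valP detg0.
  have := fmin g gg; rewrite /val.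
  set a := series_val (D i j) in Dv Dl *; set b := series_val (\det (rowsub f C)) in fv fl *.
  set c := series_val _ in gl *.
  move=> bc; have [a0|a0] := ltP a 0; last by move=> n n0; apply: Dl; lia.
  have : co (\det (rowsub g C)) (a + b) = 0 by apply: gl; lia.
  rewrite detg (coeflM_low0 Dl fl) => /eqP.
  by rewrite mulf_eq0 (negPf Dv) (negPf fv).
(* The rows of [D] selected by [f] form the identity matrix, and still do at [t = 0]; hence the rank
   does not drop. *)
split=> //; apply/eqP; rewrite -[_ == _]/(row_full (mcoef 0 D)) -sub1mx.
have <- : rowsub f (mcoef 0 D) = 1%:M.
  have -> : rowsub f (mcoef 0 D) = mcoef 0 (rowsub f D) by apply/matrixP => a b; rewrite !mxE.
  by rewrite Df mcoef1.
exact: rowsub_sub.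
Qed.

(** Bases of the row space of [P] and of the column space of [C] are made integral without loss of
    rank at [t = 0]; the constant coefficients of the vanishing products then exhibit the block over
    [k]. *)
Lemma hollow_descent (I : Type) N (M : I -> 'M[k]_N) :
  hollow (fun l => map_mx cst (M l) : 'M[kt]_N) -> hollow M.
Proof.
move=> [p [c [P [C [PMC rk]]]]].
have rP : \rank (row_base P)^T = \rank P by rewrite mxrank_tr (eqP (row_base_free P)).
have rC : \rank (col_base C) = \rank C by rewrite (eqP (col_base_full C)).
have [Z [Zl Zr]] := integral_column_basis rC.
have [Y [Yl Yr]] := integral_column_basis rP.
pose C' := col_base C *m Z; pose P' := ((row_base P)^T *m Y)^T.
exists _, _, (mcoef 0 P'), (mcoef 0 C'); split; last first.
  have -> : \rank (mcoef 0 P') = \rank (mcoef 0 ((row_base P)^T *m Y)).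
    rewrite -[RHS]mxrank_tr; congr (\rank _).
    by apply/matrixP => i j; rewrite !mxE.
  by rewrite Yr Zr.
move=> l.
have P'low : mlow P' 0 by move=> i j; rewrite mxE; apply: Yl.
have H0 : P' *m map_mx cst (M l) *m C' = 0.
  have [U UC] : exists U, C *m U = col_base C.
    exists (pinvmx (row_base C)).
    have H := mulmxKp (row_base_free C) (col_base C).
    by rewrite -[RHS]H; congr (_ *m _); rewrite mulmx_base.
  have /submxP [V VP] : (row_base P <= P)%MS by rewrite eq_row_base.
  rewrite /P' /C' -UC trmx_mul trmxK VP.
  have -> : Y^T *m (V *m P) *m map_mx cst (M l) *m (C *m U *m Z)
      = Y^T *m V *m (P *m map_mx cst (M l) *m C) *m (U *m Z) by rewrite !mulmxA.
  by rewrite PMC mulmx0 mul0mx.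
have := congr1 (@mcoef _ 0 _ _) H0; rewrite mcoef0.
rewrite (@mcoefM_low _ _ _ _ _ _ 0 0) //; last by rewrite -[0]addr0; apply: mlowM P'low (mlow_cst _).
by rewrite mcoefM_cst.
Qed.

End Descent.

(** * Evaluating pencils in skew fields *)

(* The skew fields L, infinite over their center k, in which pencils over K are evaluated. *)
Record test_field (K k : fieldType) (L : unitRingType)
    (i : {rmorphism K -> k}) (j : {rmorphism k -> L}) : Prop := TestField {
  test_field_axiom : GRing.field_axiom L;
  test_central : forall c x, j c * x = x * j c;
  test_center : forall x, (forall y, x * y = y * x) -> exists c, x = j c;
  test_infinite : forall n, exists e : 'I_n -> L, forall c : 'I_n -> k,
    \sum_a j (c a) * e a = 0 -> forall a, c a = 0;
  test_descent : forall (I : Type) N (M : I -> 'M[K]_N),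
    hollow (fun l => map_mx i (M l)) -> hollow M
}.

Lemma rmorph_eq0 (k : fieldType) (R : nzRingType) (j : {rmorphism k -> R}) c :
  j c = 0 -> c = 0.
Proof.
move=> jc; apply/eqP/negPn/negP => c0; have /eqP := oner_neq0 R; apply.
by rewrite -(rmorph1 j) -(mulVf c0) rmorphM jc mulr0.
Qed.

(** Perturbed points live in [L((t))], so the class of test fields has to be closed under this
    extension. Commuting with constants puts every coefficient of a central series into the center
    of [L], and independence over [k((t))] is tested coefficientwise. *)
Lemma test_field_laurent (K k : fieldType) (L : unitRingType)
    (i : {rmorphism K -> k}) (j : {rmorphism k -> L}) :
  test_field i j -> test_field (@field_cst k \o i) (map_laurent j).
Proof.
case=> Lf Lc Lz Li Ld; split.
- exact: laurent_field.
- by move=> c x; apply: laurent_commute => a b; rewrite coefl_map Lc.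
- move=> x Hx.
  have xc n : exists c, x n = j c.
    apply: Lz => y.
    by have := congr1 (fun f : laurent_over _ => f n) (Hx (cst _ y)); rewrite coefl_cstM coeflM_cst.
  have [c Hc] := choice xc.
  have cb : bounded_below c.
    have [a Ha] := bounded_belowP x; apply/asboolP; exists a => n na.
    by apply: (@rmorph_eq0 _ _ j); rewrite -Hc Ha.
  by exists (Laurent (trivial_action k) cb); apply: laurentP => n; rewrite coefl_map Hc.
- move=> n; have [e He] := Li n; exists (fun a => cst _ (e a)) => c Hc a.
  apply: (@laurentP _ (trivial_action k)) => m.
  apply: (He (fun a => coefl (c a) m)).
  have := congr1 (fun f : laurent_over _ => f m) Hc; rewrite coefl_sum coefl0 => H.
  by rewrite -[RHS]H; apply: eq_bigr => b _; rewrite coeflM_cst coefl_map.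
- move=> I N M H; apply: Ld; apply: hollow_descent.
  by congr hollow: H; apply/funext => l; apply/matrixP => a b; rewrite !mxE.
Qed.

(** * A skew field infinite over its center *)

Section QuantumTorus.
Variable K : fieldType.
Let k := field_laurent K.
Let E := field_laurent k.

Let q (n : int) : k := laurent_mono (trivial_action K) n 1.

Let qD m n : q (m + n) = q m * q n.
Proof.
apply: (@laurentP _ (trivial_action K)) => a; rewrite [RHS]coefl_monoM /= /mono.
by case: eqP; case: eqP; rewrite ?mulr1 ?mulr0 ?mul1r //; lia.
Qed.

Let q0 : q 0 = 1. Proof. by []. Qed.

Let q_neq1 n : n != 0 -> q n != 1.
Proof.
move=> n0; apply/eqP => /(congr1 (fun f : laurent_over (trivial_action K) => f 0)) /=.
by rewrite /mono eqxx eq_sym (negPf n0) => /eqP; rewrite eq_sym oner_eq0.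
Qed.

Fact dilation_bounded (n : int) (f : E) :
  bounded_below (fun m => @coefl _ (trivial_action k) f m * q (n * m)).
Proof.
have [a Ha] := bounded_belowP (f : laurent_over (trivial_action k)).
by apply/asboolP; exists a => m /Ha ->; rewrite mul0r.
Qed.
(** The substitution of [q^n x] for [x] in series in [x] over [k]. *)
Definition dilation (n : int) (f : E) : E :=
  Laurent (trivial_action k) (dilation_bounded n f).

Fact dilation_is_additive n : additive (dilation n).
Proof. by move=> f g; apply: laurentP => m; rewrite /= mulrDl mulNr. Qed.
HB.instance Definition _ n := GRing.isAdditive.Build E E (dilation n) (dilation_is_additive n).

Fact dilation_is_multiplicative n : multiplicative (dilation n).
Proof.
split=> [f g|]; apply: laurentP => m; last first.
  by rewrite /= /mono; case: eqP => [->|_]; rewrite ?mulr0 ?mul0r // mulr1.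
rewrite [RHS]coeflM /= /conv.
have [a Ha] := bounded_belowP (f : laurent_over (trivial_action k)).
have [b Hb] := bounded_belowP (g : laurent_over (trivial_action k)).
rewrite (isum_mulr _ (conv_supported _ Ha Hb (n := m))).
apply: eq_isum => l /=; rewrite mulrACA -qD; congr (_ * q _); lia.
Qed.
HB.instance Definition _ n :=
  GRing.isMultiplicative.Build E E (dilation n) (dilation_is_multiplicative n).

Fact dilation0 x : dilation 0 x = x.
Proof. by apply: laurentP => m; rewrite /= mul0r q0 mulr1. Qed.
Fact dilationD a b x : dilation (a + b) x = dilation a (dilation b x).
Proof. by apply: laurentP => m; rewrite /= -mulrA -qD addrC mulrDl. Qed.

Definition dilation_action : int_action E :=
  @IntAction E (fun n => dilation n) dilation0 dilationD.

(** Series in [y] over [k((x))] with [y x = q x y], where [k = K((q))]. Adjoining [q] as a variable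
    gives it infinite order whatever [K] is, finite fields included. *)
Definition quantum_torus : unitRingType := laurent_over dilation_action.

Definition quantum_cst : k -> quantum_torus := cst dilation_action \o @field_cst k.
HB.instance Definition _ := GRing.RMorphism.copy quantum_cst (cst dilation_action \o @field_cst k).

(* The center: commuting with x kills every power of y but the 0-th, then commuting with y kills every power of x. *)
Lemma quantum_torus_test_field : test_field (@field_cst K) quantum_cst.
Proof.
have dil_cst n c : dilation n (field_cst c) = field_cst c.
  apply: (@laurentP _ (trivial_action k)) => m; rewrite /= /mono.
  by case: eqP => [->|_]; rewrite ?mul0r // mulr0 mulr1.
have cst_mul (c : k) (x : quantum_torus) n : (quantum_cst c * x) n = field_cst c * x n.
  exact: coefl_cstM.
split.
- by apply: laurent_field => x; rewrite unitfE.
- move=> c x; apply: laurentP => n; rewrite cst_mul [RHS]coeflM_mono subr0 mulrC.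
  by congr (_ * _); apply/esym; apply: dil_cst.
- move=> x Hx.
  have xn n : n != 0 -> x n = 0.
    move=> n0; have := congr1 (fun f : laurent_over _ => f n) (Hx (cst _ (tvar k : E))).
    rewrite coeflM_mono coefl_cstM subr0 => H.
    have dt : dilation n (tvar k) = (tvar k : E) * field_cst (q n).
      apply: (@laurentP _ (trivial_action k)) => m; rewrite [RHS]coeflM_cst /= /mono.
      by case: eqP => [->|_]; rewrite ?mul0r // mulr1.
    have t0 : (tvar k : E) != 0.
      apply/eqP => /(congr1 (fun f : laurent_over (trivial_action k) => f 1)) /= /eqP.
      by rewrite /mono eqxx oner_eq0.
    (* Up to the variable of [E], the [n]-th coefficients of the two products differ by [x n] times
       [q^n - 1]. *)
    have : x n * ((tvar k : E) * (field_cst (q n) - 1)) = 0.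
      by rewrite mulrBr mulr1 mulrBr -dt [X in X - _]H [x n * _]mulrC subrr.
    move/eqP; rewrite mulf_eq0 mulf_eq0 (negPf t0) /= subr_eq0 => /orP [/eqP //|/eqP qn].
    by have /eqP [] := q_neq1 n0; apply: (@cst_inj _ (trivial_action k)).
  pose f : E := x 0.
  have xf : x = cst _ f.
    by apply: laurentP => n; rewrite coefl_cst; case: eqP => [->//|/eqP/xn].
  have df : dilation 1 f = f.
    have := congr1 (fun f : laurent_over _ => f 1) (Hx (laurent_mono dilation_action 1 1)).
    by rewrite coeflM_mono coefl_monoM subrr mul1r rmorph1 mulr1 => H; exact: esym.
  exists (@coefl _ (trivial_action k) f 0); rewrite xf; congr (cst _ _).
  apply: (@laurentP _ (trivial_action k)) => m; rewrite [RHS]coefl_cst; case: eqP => [->//|/eqP m0].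
  have := congr1 (fun f : laurent_over (trivial_action k) => f m) df.
  rewrite /= mul1r => /eqP; rewrite -subr_eq0 -[X in _ - X]mulr1 -mulrBr mulf_eq0 subr_eq0.
  by rewrite (negPf (q_neq1 m0)) orbF => /eqP.
- move=> n; exists (fun a => laurent_mono dilation_action (a : nat)%:Z 1) => c Hc a.
  have := congr1 (fun f : laurent_over _ => f (a : nat)%:Z) Hc; rewrite coefl_sum coefl0.
  rewrite (bigD1 a) //= big1 ?addr0; last first.
    move=> b ba; rewrite conv_monol act0 /mono; case: eqP => [E0|]; last by rewrite mulr0.
    by case/eqP: ba; apply: val_inj => /=; lia.
  rewrite conv_monol act0 /mono subr0 eqxx mulr1.
  exact: rmorph_eq0.
- by move=> I N M; apply: hollow_descent.
Qed.
End QuantumTorus.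

Lemma mul_mx_scalarE (R : nzRingType) m n (A : 'M[R]_(m, n)) z a b : (A *m z%:M) a b = A a b * z.
Proof.
rewrite mxE (bigD1 b) //= mxE eqxx mulr1n big1 ?addr0 // => c /negPf cb.
by rewrite mxE cb mulr0n mulr0.
Qed.

(** * Sums with finite-dimensional range over the center *)

Section CentralField.
Variables (k : fieldType) (L : unitRingType) (j : {rmorphism k -> L}).
Hypothesis L_field : GRing.field_axiom L.
Hypothesis central : forall c x, j c * x = x * j c.

Lemma central_scalar m n (C : 'M[k]_(m, n)) z :
  map_mx j C *m z%:M = z%:M *m map_mx j C.
Proof. by apply/matrixP => a b; rewrite mul_mx_scalarE mul_scalar_mx !mxE central. Qed.

Definition k_independent m N (b : 'M[L]_(m, N)) :=
  forall c : 'rV[k]_m, map_mx j c *m b = 0 -> c = 0.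

Hypothesis center : forall x, (forall y, x * y = y * x) -> exists c, x = j c.
Hypothesis infinite : forall n, exists e : 'I_n -> L, forall c : 'I_n -> k,
    \sum_a j (c a) * e a = 0 -> forall a, c a = 0.

Lemma not_finite_dimensional s (g : 'cV[L]_s) :
  (forall y, exists c : 'rV[k]_s, y%:M = map_mx j c *m g) -> False.
Proof.
move=> H; have [e He] := infinite s.+1.
have [C HC] := choice (fun a => H (e a)).
pose A : 'M[k]_(s.+1, s) := \matrix_(a, b) C a 0 b.
have kf : GRing.field_axiom k by move=> x; rewrite unitfE.
have [w w0 wA] := left_kernel_of_tall kf A (ltnSn s).
case/eqP: w0; apply/rowP => a; rewrite [RHS]mxE.
apply: (He (fun a => w 0 a)) => {a}.
have -> : \sum_a j (w 0 a) * e a = (map_mx j w *m (map_mx j A *m g)) 0 0.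
  rewrite [RHS]mxE; apply: eq_bigr => a _; rewrite [in RHS]mxE; congr (_ * _).
  have /matrixP /(_ 0 0) := HC a; rewrite mxE eqxx mulr1n => ->.
  by rewrite !mxE; apply: eq_bigr => b _; rewrite !mxE.
by rewrite mulmxA -map_mxM wA map_mx0 mul0mx mxE.
Qed.

(* A sum z |-> sum_i a_i z b_i with independent b_i and finite-dimensional range is shortened by
   commuting it with scalars, down to the case where all the a_i are central. *)
Lemma finite_range_zero m N (a : 'rV[L]_m) (b : 'M[L]_(m, N)) s (g : 'M[L]_(s, N)) :
  k_independent b ->
  (forall z, exists c : 'rV[k]_s, a *m z%:M *m b = map_mx j c *m g) -> a = 0.
Proof.
elim: m s a b g => [|m IH] s a b g bind H; first by apply/rowP => [] [].
apply/eqP/negPn/negP => /mx_neq0P [i0 [i]]; rewrite ord1 => {i0} ai.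
(* Multiplying on the left by a constant replaces [g] by a multiple of it, so the range stays
   finite-dimensional. *)
wlog ai1 : a g ai H / a 0 i = 1.
  move=> W; apply: (W ((a 0 i)^-1%:M *m a) ((a 0 i)^-1%:M *m g)).
  - by rewrite mul_scalar_mx mxE (skew_mulVr L_field ai) oner_neq0.
  - move=> z; have [c Hc] := H z; exists c.
    by rewrite -!mulmxA [a *m _]mulmxA Hc !mulmxA central_scalar.
  - by rewrite mul_scalar_mx mxE (skew_mulVr L_field ai).
have split_i (a' : 'rV[L]_m.+1) z : a' 0 i = 0 ->
    a' *m z%:M *m b = col' i a' *m z%:M *m row' i b.
  move=> a'i; apply/matrixP => x y; rewrite ord1 !mxE (bigD1_ord i) //= mul_mx_scalarE a'i !mul0r add0r.
  by apply: eq_bigr => l _; rewrite !mul_mx_scalarE !mxE.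
(* With [f z = a z b], the map [e f(z) - f(e z)] has coefficients [e a - a e], whose [i]-th entry is
   0, and its range is in the span of [e g] and [g]; by induction it has no coefficients left. *)
have acomm e : e%:M *m a = a *m e%:M.
  apply/eqP; rewrite -subr_eq0; apply/eqP; set a' := _ - _.
  have a'i : a' 0 i = 0.
    by rewrite mxE [X in _ + X]mxE mul_scalar_mx mul_mx_scalarE mxE ai1 mulr1 mul1r subrr.
  have : col' i a' = 0.
    apply: (IH (s + s)%N _ (row' i b) (col_mx (e%:M *m g) g)).
      move=> c Hc; pose c' : 'rV_m.+1 := \row_l (if unlift i l is Some l' then c 0 l' else 0).
      have c'0 : c' = 0.
        apply: bind; have := split_i (map_mx j c') 1; rewrite !mulmx1 => ->.
          rewrite -[RHS]Hc; congr (_ *m _).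
          by apply/rowP => l; rewrite !mxE liftK.
        by rewrite !mxE unlift_none rmorph0.
      apply/rowP => l; have /rowP /(_ (lift i l)) := c'0.
      by rewrite !mxE liftK.
    move=> z; have [c Hc] := H z; have [c' Hc'] := H (e * z).
    exists (row_mx c (- c')); rewrite -split_i // /a' mulmxBl mulmxBl.
    rewrite -[X in X - _ = _]mulmxA -[X in X - _ = _]mulmxA [a *m (_ *m _)]mulmxA Hc.
    rewrite -[X in _ - X *m b]mulmxA -scalar_mxM Hc'.
    by rewrite map_row_mx mul_row_col map_mxN mulNmx !mulmxA central_scalar.
  move=> a'0; apply/rowP => l; rewrite [RHS]mxE.
  have [l' ->|->//] := unliftP i l.
  by have /rowP /(_ l') := a'0; rewrite !mxE.
have acen l : exists c, a 0 l = j c.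
  apply: center => y; have /rowP /(_ l) := acomm y.
  by rewrite mul_scalar_mx mul_mx_scalarE mxE.
have [kap Hkap] := choice acen.
pose K := \row_l kap l; have aK : a = map_mx j K by apply/rowP => l; rewrite !mxE.
have K0 : K != 0.
  apply/eqP => /rowP /(_ i); rewrite !mxE => ki.
  by move: ai1; rewrite Hkap ki rmorph0 => /eqP; rewrite eq_sym oner_eq0.
have : map_mx j K *m b != 0 by apply: contra_neq K0; apply: bind.
(* For central [a] the sum is [z] times a fixed nonzero row, so [z] can be chosen to produce any [v]
   in one entry: [L] would be finite-dimensional over [k]. *)
case/mx_neq0P => x [y]; rewrite ord1 => {x} xy.
apply: (@not_finite_dimensional s (col y g)) => v.
have [c Hc] := H (v / (map_mx j K *m b) 0 y); exists c.
apply/matrixP => a1 b1; rewrite !ord1 mxE eqxx mulr1n.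
have := congr1 (fun A : 'rV_N => A 0 y) Hc; rewrite aK central_scalar -mulmxA mul_scalar_mx mxE.
rewrite -mulrA (skew_mulVr L_field xy) mulr1 => ->.
by rewrite !mxE; apply: eq_bigr => l _; rewrite !mxE.
Qed.

End CentralField.

(** A nonzero entry of the Schur complement [Y = M - M Q P M] is one more pivot. The new row and
    column are unit vectors projected by [1 - M Q P] and [1 - Q P M], so that they do not disturb
    the identity block. *)
Lemma extend_rank (L : unitRingType) N r (M : 'M[L]_N) (P : 'M_(r, N)) (Q : 'M_(N, r)) :
  GRing.field_axiom L -> P *m M *m Q = 1%:M -> M *m (Q *m P) *m M != M ->
  exists (P' : 'M_(r + 1, N)) (Q' : 'M_(N, r + 1)), P' *m M *m Q' = 1%:M.
Proof.
move=> Lf PMQ; rewrite eq_sym -subr_eq0.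
move YE : (M - _) => Y /mx_neq0P [a [b]]; set y := Y a b => y0.
have YGM : Y *m (Q *m P) *m M = 0.
  rewrite -YE !mulmxBl !mulmxA -[M *m Q *m P *m M *m Q]mulmxA -[M *m Q *m P *m _]mulmxA mulmxA.
  by rewrite -[M *m Q *m _ *m _]mulmxA [P *m (M *m Q)]mulmxA PMQ mulmx1 subrr.
pose ea : 'rV[L]_N := delta_mx 0 a; pose eb : 'cV[L]_N := delta_mx b 0.
pose p := ea - ea *m M *m Q *m P; pose q := eb - Q *m P *m M *m eb.
exists (col_mx P (y^-1%:M *m p)), (row_mx Q q).
rewrite mul_col_mx mul_col_row PMQ.
have -> : P *m M *m q = 0 by rewrite mulmxBr !mulmxA PMQ mul1mx subrr.
have pMQ : p *m M *m Q = 0.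
  by rewrite /p !mulmxBl -[_ *m P *m M]mulmxA -[_ *m (P *m M) *m Q]mulmxA PMQ mulmx1 subrr.
have -> : y^-1%:M *m p *m M *m Q = 0 by rewrite -!mulmxA [p *m _]mulmxA pMQ mulmx0.
have pM : p *m M = ea *m Y by rewrite /p -YE mulmxBl mulmxBr !mulmxA.
rewrite -[y^-1%:M *m p *m M]mulmxA pM -!mulmxA /q mulmxBr.
have -> : Y *m (Q *m P *m M *m eb) = 0 by rewrite !mulmxA -[Y *m Q *m P]mulmxA YGM mul0mx.
rewrite subr0.
have -> : ea *m (Y *m eb) = y%:M.
  rewrite mulmxA /ea -rowE -colE.
  by apply/matrixP => u v; rewrite !ord1 !mxE eqxx mulr1n.
by rewrite -scalar_mxM (skew_mulVr Lf y0) -scalar_mx_block.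
Qed.

(** * First-order perturbation of a matrix *)

Section Perturbation.
Variable L : unitRingType.
Hypothesis L_field : GRing.field_axiom L.
Local Notation Lt := (laurent_over (trivial_action L)).
Local Notation cst := (cst (trivial_action L)).
Local Notation tvar := (tvar L).
Variables (N r : nat) (M M' : 'M[L]_N) (P : 'M[L]_(r, N)) (Q : 'M[L]_(N, r)).
Hypothesis PMQ : P *m M *m Q = 1%:M.
Let G := Q *m P.

Definition perturb : 'M[Lt]_N := map_mx cst M + tvar%:M *m map_mx cst M'.

Lemma mcoefM_low1 m p q (A : 'M[Lt]_(m, p)) (B : 'M[Lt]_(p, q)) :
  mlow A 0 -> mlow B 0 ->
  mcoef 1 (A *m B) = mcoef 0 A *m mcoef 1 B + mcoef 1 A *m mcoef 0 B.
Proof.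
move=> HA HB; apply/matrixP => a b; rewrite !mxE coefl_sum -big_split; apply: eq_bigr => c _.
by rewrite !mxE coeflM_low1.
Qed.

Lemma mcoef_perturb n : mcoef n perturb = if n == 0 then M else if n == 1 then M' else 0.
Proof.
rewrite mcoefD mcoef_tM !mcoef_cst subr_eq0; case: (n =P 0) => [->|_]; first by rewrite addr0.
by rewrite add0r.
Qed.

Lemma mlow_perturb : mlow perturb 0.
Proof. by apply/mlowP => n n0; rewrite mcoef_perturb; case: eqP; [lia|]; case: eqP; [lia|]. Qed.

(** [P] is kept and only [Q] corrected: [P (M + t M') Q = 1 + t X], and the inverse of [1 + t X]
    begins with [1 - t X]. *)
Lemma perturb_inverse : exists Qt : 'M[Lt]_(N, r),
  [/\ map_mx cst P *m perturb *m Qt = 1%:M, mlow Qt 0, mcoef 0 Qt = Q &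
      mcoef 1 Qt = - (G *m M' *m Q)].
Proof.
pose X := P *m M' *m Q.
have AE : map_mx cst P *m perturb *m map_mx cst Q = 1%:M + tvar%:M *m map_mx cst X.
  rewrite mulmxDr mulmxDl -!map_mxM PMQ map_mx1; congr (_ + _).
  by rewrite !mulmxA tvarC -!mulmxA -!map_mxM mulmxA.
set A := 1%:M + _ in AE.
have mA n p (w : 'M[Lt]_(p, r)) : mcoef n (w *m A) = mcoef n w + mcoef (n - 1) w *m X.
  by rewrite mulmxDr mulmx1 mcoefD mulmxA tvarC -mulmxA mcoef_tM mcoefM_cst.
have Am n p (w : 'M[Lt]_(r, p)) : mcoef n (A *m w) = mcoef n w + X *m mcoef (n - 1) w.
  by rewrite mulmxDl mul1mx mcoefD -mulmxA mcoef_tM mcoef_cstM.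
have Ltf := @laurent_field _ (trivial_action L) L_field.
(* The inverse of [A] is taken in the skew field of series; the recursion for its coefficients then
   shows that it has no negative powers and yields its first two terms. *)
have [[w w0 wA]|[U AU]] := left_kernel_or_right_inverse Ltf A.
  have [v [wv wv0]] := leading_mcoef w0; have := mA v _ w; rewrite wA mcoef0.
  move/mlowP/(_ (v - 1)): wv => ->; last by lia.
  by rewrite mul0mx addr0 => /esym/eqP; rewrite (negPf wv0).
have Un n : mcoef n U = (if n == 0 then 1%:M else 0) - X *m mcoef (n - 1) U.
  by have := Am n _ U; rewrite AU mcoef1 => ->; rewrite addrK.
have Ul : mlow U 0.
  apply: mlow_ind => n n0 H; rewrite Un H mulmx0 subr0.
  by case: eqP => //; lia.
exists (map_mx cst Q *m U); split.
- by rewrite mulmxA AE.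
- by rewrite -[0]addr0; apply: mlowM Ul; apply: mlow_cst.
- rewrite mcoef_cstM Un eqxx; have /mlowP -> // := Ul.
  by rewrite mulmx0 subr0 mulmx1.
- rewrite mcoef_cstM Un /= subrr Un eqxx; have /mlowP -> // := Ul.
  by rewrite mulmx0 subr0 mulmx1 sub0r mulmxN /X /G !mulmxA.
Qed.

Variable Qt : 'M[Lt]_(N, r).
Hypotheses (Ql : mlow Qt 0) (Q0 : mcoef 0 Qt = Q) (Q1 : mcoef 1 Qt = - (G *m M' *m Q)).
Let Gt := Qt *m map_mx cst P.

Let Gl : mlow Gt 0.
Proof. by rewrite -[0]addr0; apply: mlowM Ql _; apply: mlow_cst. Qed.
Let G0 : mcoef 0 Gt = G. Proof. by rewrite mcoefM_cst Q0. Qed.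
Let G1 : mcoef 1 Gt = - (G *m M' *m G).
Proof. by rewrite mcoefM_cst Q1 mulNmx /G !mulmxA. Qed.

Let GMl : mlow (Gt *m perturb) 0.
Proof. by rewrite -[0]addr0; apply: mlowM Gl mlow_perturb. Qed.
Let GM0 : mcoef 0 (Gt *m perturb) = G *m M.
Proof. by rewrite (mcoefM_low Gl mlow_perturb) ?addr0 // G0 mcoef_perturb. Qed.
Let GM1 : mcoef 1 (Gt *m perturb) = G *m M' *m (1%:M - G *m M).
Proof.
rewrite mcoefM_low1 //; last exact: mlow_perturb.
by rewrite G0 G1 !mcoef_perturb /= mulmxBr mulmx1 mulNmx !mulmxA.
Qed.

(** Reads off the coefficient of [t]. For [M G M = M] the left side of the conclusion is the
    compression of [M'] from the kernel of [M] to its cokernel, the obstruction to keeping the rank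
    at first order. *)
Lemma perturb_regular : perturb *m Gt *m perturb = perturb ->
  (1%:M - M *m G) *m M' *m (1%:M - G *m M) = 0.
Proof.
rewrite -mulmxA => /(congr1 (@mcoef L 1 N N)).
rewrite mcoefM_low1 //; last exact: mlow_perturb.
rewrite GM0 GM1 !mcoef_perturb /= => H.
rewrite mulmxBl mul1mx mulmxBl [X in X - _]mulmxBr mulmx1 -[X in X - _ - _]H.
by rewrite !mulmxA addrK subrr.
Qed.

Lemma mlow_perturb_kernel : mlow (1%:M - Gt *m perturb) 0.
Proof.
apply/mlowP => n n0; rewrite mcoefD mcoefN mcoef1; case: eqP => [?|_]; first by lia.
by have /mlowP -> // := GMl; rewrite subr0.
Qed.
Lemma mcoef0_perturb_kernel : mcoef 0 (1%:M - Gt *m perturb) = 1%:M - G *m M.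
Proof. by rewrite mcoefD mcoefN mcoef1 eqxx GM0. Qed.
Lemma mcoef1_perturb_kernel :
  mcoef 1 (1%:M - Gt *m perturb) = - (G *m M' *m (1%:M - G *m M)).
Proof. by rewrite mcoefD mcoefN mcoef1 GM1 /= add0r. Qed.

End Perturbation.

(** [None] indexes the constant term: a single family lets [hollow] treat it like the coefficients
    of the letters. *)
Definition pencil_eval (K : nzRingType) (L : nzRingType) (f : K -> L) d (alpha : 'I_d -> L)
    N (M : option 'I_d -> 'M[K]_N) : 'M[L]_N :=
  map_mx f (M None) + \sum_l map_mx f (M (Some l)) *m (alpha l)%:M.

Lemma nat_max (P : nat -> Prop) b : (exists n, P n) -> (forall n, P n -> (n <= b)%N) ->
  exists2 n, P n & forall m, P m -> (m <= n)%N.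
Proof.
move=> [n0 Pn0] Pb; have ex : exists n, `[< P n >] by exists n0; apply/asboolP.
have ub n : `[< P n >] -> (n <= b)%N by move=> /asboolP /Pb.
case: (ex_maxnP ex ub) => n /asboolP Pn nmax; exists n => // m /asboolP; exact: nmax.
Qed.

(** Constant matrices on both sides turn [A] into an identity matrix of size its rank, and this
    survives in [L]. *)
Lemma rank_mx_factor (k : fieldType) (L : unitRingType) (j : {rmorphism k -> L})
    m n r (A : 'M[k]_(m, n)) (X : 'M[L]_(m, r)) (Z : 'M[L]_(r, n)) :
  GRing.field_axiom L -> map_mx j A = X *m Z -> (\rank A <= r)%N.
Proof.
move=> Lf AXZ.
have [B BA] : exists B, B *m col_base A = 1%:M by apply/row_fullP; rewrite col_base_full.
have [D AD] : exists D, row_base A *m D = 1%:M.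
  by exists (pinvmx (row_base A)); rewrite mulmxVp // row_base_free.
have H : B *m A *m D = 1%:M.
  transitivity (B *m (col_base A *m row_base A) *m D); first by rewrite mulmx_base.
  by rewrite mulmxA BA mul1mx AD.
apply: (@factor_id_leq _ Lf _ _ (map_mx j B *m X) (Z *m map_mx j D)).
by rewrite mulmxA -[map_mx j B *m X *m Z]mulmxA -AXZ -!map_mxM H map_mx1.
Qed.

Lemma right_kernel_drop (L : unitRingType) m n (X : 'M[L]_(m, n)) (y : 'cV_n) :
  GRing.field_axiom L -> y != 0 -> X *m y = 0 ->
  exists n' (X1 : 'M_(m, n')) (Z : 'M_(n', n)), (n' < n)%N /\ X = X1 *m Z.
Proof.
move=> Lf; case: n X y => [|n] X y y0 Xy.
  by case/eqP: y0; apply/matrixP => - [].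
by have [X1 [Z XZ]] := right_kernel_factor Lf y0 Xy; exists n, X1, Z.
Qed.

(** * Points of maximal rank *)

Section Singular.
Variables (K : fieldType) (d N : nat) (M : option 'I_d -> 'M[K]_N).

Definition rank_point r (k : fieldType) (L : unitRingType)
    (i : {rmorphism K -> k}) (j : {rmorphism k -> L}) alpha (P : 'M_(r, N)) (Q : 'M_(N, r)) :=
  test_field i j /\ P *m pencil_eval (j \o i) alpha M *m Q = 1%:M.

Definition direction (L : nzRingType) (f : K -> L) (z : 'I_d -> L) : 'M[L]_N :=
  \sum_l map_mx f (M (Some l)) *m (z l)%:M.

Lemma pencil_eval_perturb (k : fieldType) (L : unitRingType)
    (i : {rmorphism K -> k}) (j : {rmorphism k -> L}) (alpha z : 'I_d -> L) :
  pencil_eval (map_laurent j \o (@field_cst k \o i))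
    (fun l => cst _ (alpha l) + tvar L * cst _ (z l)) M
  = perturb (pencil_eval (j \o i) alpha M) (direction (j \o i) z).
Proof.
have cstE (A : 'M[K]_N) : map_mx (map_laurent j \o (@field_cst k \o i)) A
    = map_mx (cst (trivial_action L)) (map_mx (j \o i) A).
  by apply/matrixP => a b; rewrite !mxE /= map_laurent_cst.
rewrite /pencil_eval /perturb /direction cstE map_mxD -addrA; congr (_ + _).
rewrite !raddf_sum /= -big_split; apply: eq_bigr => l _ /=.
rewrite cstE raddfD /= mulmxDr !map_mxM !map_scalar_mx scalar_mxM mulmxA tvarC.
by rewrite mulmxA.
Qed.

Lemma direction_single (L : nzRingType) (f : K -> L) l x :
  direction f (fun m => if m == l then x else 0) = map_mx f (M (Some l)) *m x%:M.
Proof.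
rewrite /direction (bigD1 l) //= eqxx big1 ?addr0 // => m /negPf ->.
by rewrite raddf0 mulmx0.
Qed.

(* The point alpha maximizes first the rank r of the pencil A, then the number m of rows of the constant matrix R
   with R q independent over k, where q projects onto the kernel of A. As neither increases at
   alpha + t z over L((t)), the first-order terms in t vanish. *)
Section Maximal.
Variables (k : fieldType) (L : unitRingType) (i : {rmorphism K -> k}) (j : {rmorphism k -> L}).
Variables (alpha : 'I_d -> L) (r m : nat) (P : 'M[L]_(r, N)) (Q : 'M[L]_(N, r)) (R : 'M[k]_(m, N)).
Hypothesis test : test_field i j.
Variables (A G q : 'M[L]_N) (rho : 'M[L]_(m, N)).
Hypothesis AE : A = pencil_eval (j \o i) alpha M.
Hypothesis GE : G = Q *m P.
Hypothesis qE : q = 1%:M - G *m A.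
Hypothesis rhoE : rho = map_mx j R *m q.
Hypothesis PAQ : P *m A *m Q = 1%:M.
Hypothesis rank_max : forall (k' : fieldType) (L' : unitRingType)
  (i' : {rmorphism K -> k'}) (j' : {rmorphism k' -> L'}) alpha' P' Q',
  ~ @rank_point (r + 1) k' L' i' j' alpha' P' Q'.
Hypothesis Rind : k_independent j rho.
Hypothesis hull_max : forall (k' : fieldType) (L' : unitRingType)
  (i' : {rmorphism K -> k'}) (j' : {rmorphism k' -> L'}) alpha' P' Q' (R' : 'M[k']_(m + 1, N)),
  @rank_point r k' L' i' j' alpha' P' Q' ->
  ~ k_independent j' (map_mx j' R' *m (1%:M - Q' *m P' *m pencil_eval (j' \o i') alpha' M)).

Let L_field := test_field_axiom test.

Lemma independent_col_mx (h : 'rV[L]_N) :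
  (forall c : 'rV[k]_m, h <> map_mx j c *m rho) ->
  forall c g, map_mx j c *m rho + j g *: h = 0 -> c = 0 /\ g = 0.
Proof.
move=> Hh c g H.
have [g0|g0] := eqVneq g 0.
  split=> //; apply: Rind; rewrite -[RHS]H g0 rmorph0 scale0r addr0 //.
exfalso; apply: (Hh (- (g^-1 *: c))).
rewrite map_mxN map_mxZ mulNmx -scalemxAl; apply/eqP; rewrite -addr_eq0 addrC; apply/eqP.
have -> : h = j g^-1 *: (j g *: h) by rewrite scalerA -rmorphM mulVf // rmorph1 scale1r.
by rewrite -scalerDr H scaler0.
Qed.

(** A row of [q] outside the [k]-span of [rho] could be adjoined to [rho], through a unit row of
    [R], at the point [alpha] itself. *)
Lemma hull_factor : exists C : 'M[k]_(N, m), q = map_mx j C *m rho.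
Proof.
suff H a : exists c : 'rV[k]_m, row a q = map_mx j c *m rho.
  have [c Hc] := choice H; exists (\matrix_a c a).
  apply/row_matrixP => a; rewrite Hc row_mul; congr (_ *m _).
  by apply/rowP => b; rewrite !mxE.
apply: contrapT => H.
have Hh c : row a q <> map_mx j c *m rho by move=> E; apply: H; exists c.
apply: (@hull_max k L i j alpha P Q (col_mx R (delta_mx 0 a))); first by split; rewrite -?AE.
move=> c; rewrite -[c]hsubmxK map_col_mx mul_col_mx map_row_mx mul_row_col.
rewrite map_delta_mx -rowE -GE -AE -qE -rhoE => E.
have [-> E0] : lsubmx c = 0 /\ rsubmx c 0 0 = 0.
  apply: (independent_col_mx Hh).
  rewrite -[RHS]E; congr (_ + _); rewrite -mul_scalar_mx; congr (_ *m _).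
  by apply/rowP => b; rewrite !ord1 !mxE eqxx mulr1n.
have -> : rsubmx c = 0 by apply/rowP => b; rewrite ord1 E0 mxE.
by rewrite row_mx0.
Qed.

Lemma regular_at_max : A *m G *m A = A.
Proof.
apply/eqP/negPn/negP; rewrite GE => H.
have [P' [Q' PQ']] := extend_rank L_field PAQ H.
by apply: (@rank_max k L i j alpha P' Q'); rewrite /rank_point -AE.
Qed.

Section Direction.
Variable z : 'I_d -> L.
Let alpha' l := cst (trivial_action L) (alpha l) + tvar L * cst (trivial_action L) (z l).
Let D := direction (j \o i) z.

(** A nonzero first-order term would provide a further pivot, hence rank [r + 1], at the point
    [alpha + t z] over [L((t))]. *)
Lemma first_order_vanishing : (1%:M - A *m G) *m D *m q = 0.
Proof.
have [Qt [PQt Ql Q0 Q1]] := perturb_inverse L_field D PAQ.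
rewrite qE GE; apply: (perturb_regular Ql Q0 Q1); apply/eqP/negPn/negP => H.
have [P' [Q' PQ']] := extend_rank (@laurent_field _ (trivial_action L) L_field) PQt H.
apply: (@rank_max _ _ _ _ alpha' P' Q'); split; first exact: (test_field_laurent test).
by rewrite pencil_eval_perturb -AE.
Qed.

(** At [alpha + t z] the constant row [e], which kills [q], takes a value of order [t] with
    coefficient [- e G D q]. Were this independent of [rho], the rows of [R] and [e] together would
    contradict [hull_max]. *)
Lemma hull_direction (e : 'rV[k]_N) : map_mx j e *m q = 0 ->
  exists c : 'rV[k]_m, map_mx j e *m G *m D *m q = map_mx j c *m rho.
Proof.
move=> eq0; apply: contrapT => H.
have [Qt [PQt Ql Q0 Q1]] := perturb_inverse L_field D PAQ.
have test' := test_field_laurent test.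
set qt := 1%:M - Qt *m map_mx (cst _) P *m perturb A D.
have ql : mlow qt 0 by exact: mlow_perturb_kernel Ql.
have q0 : mcoef 0 qt = q by rewrite qE GE; exact: mcoef0_perturb_kernel Ql Q0.
have q1 : mcoef 1 qt = - (G *m D *m q) by rewrite qE GE; exact: mcoef1_perturb_kernel Ql Q0 Q1.
pose h := map_mx (cst (trivial_action L)) (map_mx j e) *m qt.
have hl : mlow h 1.
  apply/mlowP => n n1; rewrite mcoef_cstM.
  have [->|n0] := eqVneq n 0; first by rewrite q0.
  by move/mlowP: ql => ->; rewrite ?mulmx0 //; lia.
have h1 : mcoef 1 h = - (map_mx j e *m G *m D *m q).
  by rewrite mcoef_cstM q1 mulmxN !mulmxA.
have Hh c : mcoef 1 h <> map_mx j c *m rho.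
  move=> E; apply: H; exists (- c).
  by rewrite map_mxN mulNmx -E h1 opprK.
pose R' : 'M[field_laurent k]_(m + 1, N) :=
  col_mx (map_mx (@field_cst k) R) (map_mx (@field_cst k) e).
have rp : rank_point (@field_cst k \o i) (map_laurent j) alpha'
    (map_mx (cst (trivial_action L)) P) Qt.
  by split=> //; rewrite pencil_eval_perturb -AE.
apply: (@hull_max _ _ _ _ _ _ _ R' rp) => c; rewrite pencil_eval_perturb -AE -/D -/qt.
have cstE p (B : 'M[k]_(p, N)) : map_mx (map_laurent j) (map_mx (@field_cst k) B)
   = map_mx (cst (trivial_action L)) (map_mx j B).
  by apply/matrixP => a b; rewrite !mxE map_laurent_cst.
rewrite -[c]hsubmxK map_col_mx mul_col_mx !cstE map_row_mx mul_row_col -/h.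
move: (lsubmx c) (rsubmx c) => a g {c} E.
apply/eqP/negPn/negP => ag0.
(* Shift g by t so that both summands contribute at the same order. *)
pose c : 'rV[laurent_over (trivial_action k)]_(m + 1) := row_mx a (tvar k *: g).
have c0 : c != 0.
  apply: contra_neq ag0 => c0; have := congr1 (@lsubmx _ _ _ _) c0.
  have := congr1 (@rsubmx _ _ _ _) c0.
  rewrite row_mxKl row_mxKr => /rowP g0 ->; rewrite [X in row_mx X _]raddf0.
  suff -> : g = 0 by rewrite row_mx0.
  apply/rowP => b; rewrite [RHS]mxE; apply: (@laurentP _ (trivial_action k)) => n.
  have := congr1 (fun f : laurent_over (trivial_action k) => f (n + 1)) (g0 b).
  by rewrite !mxE coefl_tM addrK.
have [v [cl cv]] := leading_mcoef c0.
have al : mlow (a : 'M[laurent_over (trivial_action k)]_(1, m)) v.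
  by move=> x y n nv; have := cl x (lshift 1 y) n nv; rewrite row_mxEl.
have gl : mlow (g : 'M[laurent_over (trivial_action k)]_(1, 1)) (v - 1).
  move=> x y n nv; have := cl x (rshift m y) (n + 1); rewrite row_mxEr mxE coefl_tM addrK.
  by apply; lia.
have mapl p q' (B : 'M[field_laurent k]_(p, q')) u : 
    mlow (B : 'M[laurent_over (trivial_action k)]_(p, q')) u -> mlow (map_mx (map_laurent j) B) u.
  by move=> Bl x y n nu; rewrite mxE coefl_map Bl ?rmorph0.
have mcmap p q' (B : 'M[field_laurent k]_(p, q')) n :
    mcoef n (map_mx (map_laurent j) B)
    = map_mx j (mcoef n (B : 'M[laurent_over (trivial_action k)]_(p, q'))).
  by apply/matrixP => x y; rewrite !mxE coefl_map.
have cstq : mlow (map_mx (cst (trivial_action L)) (map_mx j R) *m qt) 0.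
  by rewrite -[0]addr0; apply: mlowM ql; apply: mlow_cst.
have := congr1 (@mcoef _ v _ _) E; rewrite mcoef0 mcoefD.
rewrite (mcoefM_low (mapl _ _ _ _ al) cstq) ?addr0 // (mcoefM_low (mapl _ _ _ _ gl) hl) ?subrK //.
rewrite mcoef_cstM q0 !mcmap -rhoE.
set av := mcoef v _; set gv := mcoef (v - 1) _ => Ev.
have [av0 gv0] : av = 0 /\ gv 0 0 = 0.
  apply: (independent_col_mx Hh).
  rewrite -[RHS]Ev; congr (_ + _); rewrite -mul_scalar_mx; congr (_ *m _).
  by apply/rowP => x; rewrite ord1 [RHS]mxE [LHS]mxE eqxx mulr1n.
case/eqP: cv; apply/rowP => x; rewrite [LHS]mxE [RHS]mxE.
case: (split_ordP x) => y ->; rewrite ?row_mxEl ?row_mxEr.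
  by have /rowP /(_ y) := av0; rewrite !mxE.
by rewrite mxE coefl_tM ord1; move: gv0; rewrite mxE.
Qed.

End Direction.

Lemma maximal_hollow (w : 'rV[L]_N) : w != 0 -> w *m A = 0 -> hollow M.
Proof.
move=> w0 wA; have [C qC] := hull_factor.
have Lc := test_central test.
have finite0 := @finite_range_zero _ _ j L_field Lc (test_center test) (test_infinite test).
(* [rho = R q] and [q = C rho] give [(R C - 1) rho = 0], with [rho] independent. *)
have RC : R *m C = 1%:M.
  apply/eqP; rewrite -subr_eq0; apply/eqP/row_matrixP => a; rewrite row0; apply: Rind.
  rewrite map_row -row_mul map_mxB map_mx1 map_mxM mulmxBl mul1mx -mulmxA {2}rhoE -qC -rhoE.
  by rewrite subrr row0.
have AGA := regular_at_max.
have [p pE] : exists p, p = 1%:M - A *m G by exists (1%:M - A *m G).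
pose ML l := map_mx (j \o i) (M (Some l)).
(* [z] enters between [C] and [rho]; as the sum vanishes for every [z], the independent [rho] can be
   cancelled. *)
have pMC l : p *m ML l *m map_mx j C = 0.
  apply/row_matrixP => a; rewrite row0; apply: (finite0 _ _ _ rho 0%N 0 Rind) => z.
  exists 0; rewrite mulmx0 -!row_mul -[p *m ML l *m _ *m _]mulmxA (central_scalar Lc) mulmxA.
  rewrite -[_ *m rho]mulmxA -qC.
  have := first_order_vanishing (fun m' => if m' == l then z else 0).
  by rewrite direction_single -pE -/(ML l) !mulmxA => ->; rewrite row0.
pose Y l := map_mx j R *m G *m ML l *m map_mx j C.
(* The rows of [1 - C R] kill [q], so by [hull_direction] the map in [z] takes values in the span of
   [rho] only. Hence it is zero, and [C R] acts as the identity on [G M_l C]. *)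
have GMC l : G *m ML l *m map_mx j C = map_mx j C *m Y l.
  apply/eqP; rewrite /Y !mulmxA -map_mxM -!mulmxA -subr_eq0 -[X in X - _]mul1mx -mulmxBl.
  rewrite -(map_mx1 j) -map_mxB; apply/eqP/row_matrixP => a; rewrite row0.
  apply: (finite0 _ _ _ rho _ rho Rind) => z.
  set e := row a (1%:M - C *m R).
  have eC : e *m C = 0 by rewrite /e -row_mul mulmxBl mul1mx -mulmxA RC mulmx1 subrr row0.
  have eq0 : map_mx j e *m q = 0 by rewrite qC mulmxA -map_mxM eC map_mx0 mul0mx.
  have [c Hc] := hull_direction (fun m' => if m' == l then z else 0) eq0.
  exists c; rewrite -Hc direction_single -/(ML l) row_mul -map_row -/e.
  rewrite -!mulmxA; congr (_ *m _); rewrite qC !mulmxA; congr (_ *m _).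
  by rewrite -!mulmxA; congr (_ *m (_ *m _)); rewrite central_scalar.
have MCY l : ML l *m map_mx j C = A *m map_mx j C *m Y l.
  have /eqP := pMC l; rewrite -mulmxA pE mulmxBl mul1mx subr_eq0 => /eqP ->.
  by rewrite -!mulmxA; congr (_ *m _); rewrite mulmxA -mulmxA mulmxA GMC mulmxA.
(* The constant term is what remains of [A] after the letters, so it too maps [C] into the range of
   [A C]. *)
have M0 : map_mx (j \o i) (M None) *m map_mx j C
    = A *m map_mx j C *m (1%:M - \sum_l Y l *m (alpha l)%:M).
  have -> : map_mx (j \o i) (M None) = A - \sum_l ML l *m (alpha l)%:M.
    by rewrite AE /pencil_eval addrK.
  rewrite mulmxBl mulmxBr mulmx1 mulmx_suml mulmx_sumr; congr (_ - _).
  apply: eq_bigr => l _; rewrite -mulmxA -(central_scalar Lc) [LHS]mulmxA MCY.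
  exact/esym/mulmxA.
(* Otherwise [G A = 1], and [A] would have no left kernel vector [w]. *)
have q0 : q != 0.
  apply: contra_neq w0 => /eqP; rewrite qE subr_eq0 => /eqP GA.
  have AG := square_inverse L_field (esym GA).
  by rewrite -[w]mulmx1 -AG mulmxA wA mul0mx.
have Aq : A *m q = 0 by rewrite qE mulmxBr mulmx1 mulmxA AGA subrr.
have [a [b qab]] := mx_neq0P q0.
pose y := col b rho.
have y0 : y != 0.
  apply: contra_neq qab => y0; rewrite qC.
  have := congr1 (fun B : 'cV_N => B a 0) (congr1 (mulmx (map_mx j C)) y0).
  by rewrite mulmx0 /y colE mulmxA -colE !mxE.
have ACy : A *m map_mx j C *m y = 0.
  by rewrite /y colE mulmxA -[_ *m rho]mulmxA -qC Aq mul0mx.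
have [n' [X [Z [nm XZ]]]] := right_kernel_drop L_field y0 ACy.
pose Mk l := map_mx i (M l) *m C.
have [W MW] : exists W, forall l, map_mx j (Mk l) = X *m W l.
  exists (fun l => if l is Some l then Z *m Y l else Z *m (1%:M - \sum_l Y l *m (alpha l)%:M)).
  by case=> [l|]; rewrite map_mxM -map_mx_comp mulmxA -XZ; [apply: MCY | apply: M0].
apply: (test_descent test).
(* [S] spans the transposed columns of all the [M_l C]. They factor through [A C], whose kernel
   vector [y] leaves less than [m] dimensions. *)
pose S := (\sum_l <<(Mk l)^T>>)%MS.
have rS : (\rank S <= n')%N.
  have /sub_sumsmxP [u uS] : (S <= \sum_l <<(Mk l)^T>>)%MS by [].
  have [D DE] : exists D : option 'I_d -> 'M_(N, m), forall l, <<(Mk l)^T>>%MS = D l *m (Mk l)^T.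
    suff H l : exists D : 'M_(N, m), <<(Mk l)^T>>%MS = D *m (Mk l)^T.
      by have [D HD] := choice H; exists D.
    by apply/submxP; rewrite genmxE.
  rewrite -mxrank_tr.
  apply: (@rank_mx_factor _ _ j _ _ _ _ X (\sum_l W l *m map_mx j (u l *m D l)^T)) => //.
  rewrite uS !raddf_sum; apply: eq_bigr => l _ /=.
  by rewrite DE mulmxA trmx_mul trmxK map_mxM MW mulmxA.
(* The annihilator of [S] has rank at least [N - n'], and [C] has rank [m > n']. *)
exists _, _, (kermx S^T), C; split.
  move=> l; rewrite -mulmxA -/(Mk l).
  have /submxP [D DE] : ((Mk l)^T <= S)%MS.
    by apply: (submx_trans _ (sumsmx_sup l _ (submx_refl _))); rewrite ?genmxE.
  by rewrite -[Mk l]trmxK DE trmx_mul mulmxA mulmx_ker mul0mx.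
rewrite mxrank_ker mxrank_tr.
have -> : \rank C = m.
  apply/eqP; rewrite eqn_leq rank_leq_col /=.
  by rewrite -{1}(mxrank1 k m) -RC mxrankM_maxr.
have := rank_leq_row S; lia.
Qed.

End Maximal.

(** The two maxima exist because both quantities are at most [N]; the quantum torus with an empty
    block of pivots shows that there is something to maximize. *)
Lemma singular_pencil_hollow :
  (forall (k : fieldType) (L : unitRingType) (i : {rmorphism K -> k}) (j : {rmorphism k -> L})
      (alpha : 'I_d -> L), test_field i j ->
    exists2 w : 'rV[L]_N, w != 0 & w *m pencil_eval (j \o i) alpha M = 0) ->
  hollow M.
Proof.
move=> sing.
pose has_rank r := exists k L i j alpha P Q, @rank_point r k L i j alpha P Q.
have [r [k0 [L0 [i0 [j0 [alpha0 [P0 [Q0 [test0 rk0]]]]]]]] rmax] :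
    exists2 r, has_rank r & forall s, has_rank s -> (s <= r)%N.
  apply: (@nat_max _ N).
    exists 0%N, (field_laurent K), (quantum_torus K), (@field_cst K), (@quantum_cst K).
    exists (fun=> 0), 0, 0; split; first exact: quantum_torus_test_field.
    by apply/matrixP => - [].
  move=> r [k [L [i [j [alpha [P [Q [test rk]]]]]]]].
  by apply: (factor_id_leq (test_field_axiom test)); rewrite -mulmxA in rk; exact: rk.
pose has_hull m := exists (k : fieldType) (L : unitRingType) (i : {rmorphism K -> k})
  (j : {rmorphism k -> L}) alpha (P : 'M[L]_(r, N)) (Q : 'M[L]_(N, r)) (R : 'M[k]_(m, N)),
  @rank_point r k L i j alpha P Q /\
  k_independent j (map_mx j R *m (1%:M - Q *m P *m pencil_eval (j \o i) alpha M)).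
have [m [k [L [i [j [alpha [P [Q [R [[test rk] Rind]]]]]]]]] mmax] :
    exists2 m, has_hull m & forall s, has_hull s -> (s <= m)%N.
  apply: (@nat_max _ N).
    exists 0%N, k0, L0, i0, j0, alpha0, P0, Q0, 0; split; first by split.
    by move=> c _; apply/rowP => - [].
  move=> m [k [L [i [j [alpha [P [Q [R [_ Rind]]]]]]]]].
  have kf : GRing.field_axiom k by move=> x; rewrite unitfE.
  rewrite leqNgt; apply/negP => /(left_kernel_of_tall kf R) [c c0 cR].
  by case/eqP: c0; apply: Rind; rewrite mulmxA -map_mxM cR map_mx0 mul0mx.
have [w w0 wA] := sing k L i j alpha test.
apply: (maximal_hollow test erefl erefl erefl erefl rk _ Rind _ w0 wA).
  move=> k' L' i' j' alpha' P' Q' H; suff : (r + 1 <= r)%N by rewrite addn1 ltnn.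
  by apply: rmax; exists k', L', i', j', alpha', P', Q'.
move=> k' L' i' j' alpha' P' Q' R' H1 H2; suff : (m + 1 <= m)%N by rewrite addn1 ltnn.
by apply: mmax; exists k', L', i', j', alpha', P', Q', R'.
Qed.

End Singular.

(** * Singular pencils over the free field *)

Definition full_criterion (K : fieldType) (F : unitRingType) (kap : K -> F) d (y : 'I_d -> F) :=
  forall N (M : option 'I_d -> 'M[K]_N) (w : 'rV[F]_N),
    w != 0 -> w *m pencil_eval kap y M = 0 -> hollow M.

(** * Kernels under specialization *)

Section Specialization.
Variables (F L : unitRingType) (S : {pred F}) (psi : F -> L).
Hypotheses (F_field : GRing.field_axiom F) (L_field : GRing.field_axiom L).
Hypothesis S_ring : subring_closed S.
Hypothesis psi1 : psi 1 = 1.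
Hypothesis psiD : {in S &, {morph psi : x y / x + y}}.
Hypothesis psiM : {in S &, {morph psi : x y / x * y}}.
Hypothesis S_local : forall x, x \in S -> psi x != 0 -> x^-1 \in S.

Let S1 : 1 \in S. Proof. by case: S_ring. Qed.
Let SB x y : x \in S -> y \in S -> x - y \in S. Proof. by case: S_ring => _ + _; apply. Qed.
Let SM x y : x \in S -> y \in S -> x * y \in S. Proof. by case: S_ring => _ _; apply. Qed.
Let S0 : 0 \in S. Proof. by rewrite -(subrr 1); apply: SB. Qed.
Let SN x : x \in S -> - x \in S. Proof. by move=> xS; rewrite -sub0r; apply: SB. Qed.
Let psi0 : psi 0 = 0. Proof. by apply: (addIr (psi 0)); rewrite -psiD // !add0r. Qed.
Let psiB x y : x \in S -> y \in S -> psi (x - y) = psi x - psi y.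
Proof. by move=> xS yS; apply: (addIr (psi y)); rewrite -psiD ?subrK // SB. Qed.
Let psiV x : x \in S -> psi x != 0 -> psi x^-1 = (psi x)^-1.
Proof.
move=> xS px; have x0 : x != 0 by apply: contra_neq px => ->.
rewrite -[LHS]mulr1 -(skew_mulrV L_field px) mulrA -psiM ?S_local //.
by rewrite (skew_mulVr F_field x0) psi1 mul1r.
Qed.

Lemma specialize_sum I (r : seq I) (f : I -> F) : (forall i, f i \in S) ->
  \sum_(i <- r) f i \in S /\ psi (\sum_(i <- r) f i) = \sum_(i <- r) psi (f i).
Proof.
move=> fS; elim: r => [|i r [sS IH]]; first by rewrite !big_nil psi0.
rewrite !big_cons; split; last by rewrite psiD // IH.
by rewrite -[X in _ + X]opprK SB // SN.
Qed.

(** A pivot with nonzero image is invertible inside [S], so elimination stays in [S] and commutes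
    with [psi]. A first column with image 0 is dropped: it imposes no condition over [L]. *)
Lemma specialize_kernel m n (X : 'M[F]_(m, n)) (w : 'rV_m) :
  (forall i j, X i j \in S) -> w != 0 -> w *m X = 0 ->
  exists2 w' : 'rV[L]_m, w' != 0 & w' *m map_mx psi X = 0.
Proof.
elim: n m X w => [|n IH] m X w XS w0 wX.
  case: m X w XS w0 wX => [|m] X w XS w0 wX.
    by case/eqP: w0; apply/rowP => - [].
  exists (delta_mx 0 0); last by apply/matrixP => i [].
  by apply/eqP => /rowP /(_ 0); rewrite !mxE eqxx => /eqP; rewrite oner_eq0.
have [X0|] := eqVneq (col 0 (map_mx psi X)) 0.
  have [||w' w'0 w'X] := IH m (col' 0 X) w _ w0.
  - by move=> i j; rewrite mxE.
  - apply/matrixP => i j; have /matrixP /(_ i (lift 0 j)) := wX; rewrite !mxE => H.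
    by rewrite -[RHS]H; apply: eq_bigr => l _; rewrite !mxE.
  exists w' => //; apply: col_kernel => //.
  by rewrite -[RHS]w'X; congr (_ *m _); apply/matrixP => i j; rewrite !mxE.
case: m X w XS w0 wX => [|m] X w XS w0 wX; first by case/mx_neq0P => - [].
case/mx_neq0P => i [j]; rewrite ord1 !mxE => pXi {j}.
have Xi : X i 0 != 0 by apply: contra_neq pXi => ->.
have [wY wYw] := eliminate_kernel F_field Xi wX.
have cS j : X (lift i j) 0 / X i 0 \in S by rewrite SM // S_local.
have YS a b : eliminate X i a b \in S by rewrite mxE SB // SM.
have [|w' w'0 w'Y] := IH m (eliminate X i) (col' i w) YS _ wY.
  by apply: contra_neq w0.
have psiE : map_mx psi (eliminate X i) = eliminate (map_mx psi X) i.
  by apply/matrixP => a b; rewrite !mxE psiB ?psiM ?psiV // ?S_local // SM.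
rewrite psiE in w'Y; have [|v vX vw] := eliminate_lift L_field _ w'Y; first by rewrite mxE.
exists v => //; apply: contra_neq w'0 => v0.
by rewrite -vw v0; apply/matrixP => a b; rewrite !mxE.
Qed.

End Specialization.

Section Evaluation.
Variables (K : fieldType) (d : nat) (L : unitRingType) (f : {rmorphism K -> L}).
Variable alpha : 'I_d -> L.
Hypothesis central : forall c x, f c * x = x * f c.

Definition word_eval (m : {fmonom 'I_d}) : L := \prod_(l <- (m : seq 'I_d)) alpha l.

Fact word_eval_mmorphism : mmorphism word_eval.
Proof.
split=> [m1 m2|]; rewrite /word_eval; first by rewrite fmM big_cat.
by rewrite fm1 big_nil.
Qed.
HB.instance Definition _ := monalg.isMultiplicative.Build _ L word_eval word_eval_mmorphism.

Definition poly_eval : free_algebra K d -> L := mmap f word_eval.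

Fact poly_eval_multiplicative : multiplicative poly_eval.
Proof. by apply: commr_mmap_is_multiplicative => g m m'; apply: central. Qed.

HB.instance Definition _ := GRing.Additive.copy poly_eval (mmap f word_eval).
End Evaluation.

Lemma poly_evalC (K : fieldType) d (L : unitRingType) (f : {rmorphism K -> L}) (alpha : 'I_d -> L) c :
  poly_eval f alpha c%:MP = f c.
Proof. exact: mmapC. Qed.

Lemma poly_eval_letter (K : fieldType) d (L : unitRingType) (f : {rmorphism K -> L}) (alpha : 'I_d -> L) l :
  poly_eval f alpha (letter K l) = alpha l.
Proof.
rewrite /poly_eval mmapU /word_eval fmU big_seq1 -[RHS]mul1r; congr (_ * _).
exact: rmorph1.
Qed.

Lemma malgC_central (K : fieldType) d (c : K) (a : free_algebra K d) : c%:MP * a = a * c%:MP.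
Proof.
rewrite !malgM_def fgmulgU fgmulUg; apply: eq_bigr => m _.
by rewrite mulrC mulm1 mul1m.
Qed.

Section FreeField.
Variables (K : fieldType) (d : nat) (F : unitRingType) (iota : {rmorphism free_algebra K d -> F}).

Definition kappa : K -> F := iota \o @mkmalgU {fmonom 'I_d} K mone.
HB.instance Definition _ := GRing.RMorphism.copy kappa (iota \o @mkmalgU {fmonom 'I_d} K mone).

Definition gen (l : 'I_d) : F := iota (letter K l).

Definition pencil_family N (A0 : 'M[K]_N) (A : 'I_d -> 'M[K]_N) (o : option 'I_d) :=
  if o is Some l then A l else A0.

Lemma map_pencil N (A0 : 'M[K]_N) (A : 'I_d -> 'M[K]_N) :
  map_mx iota (linear_pencil A0 A) = pencil_eval kappa gen (pencil_family A0 A).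
Proof.
apply/matrixP => a b; rewrite /pencil_eval /linear_pencil !mxE rmorphD /=; congr (_ + _).
rewrite !summxE rmorph_sum; apply: eq_bigr => l _.
by rewrite mul_mx_scalarE !mxE -mul_malgC rmorphM.
Qed.

Hypothesis univ : universal_field_of_fractions iota.

Let F_field : GRing.field_axiom F. Proof. by case: univ. Qed.

(** The centralizer of a constant is a division ring containing the image of the free algebra. *)
Lemma kappa_central c x : kappa c * x = x * kappa c.
Proof.
case: univ => _ _ gen_F _; apply/eqP.
apply: (gen_F [pred x | kappa c * x == x * kappa c]) => /= [|a]; last first.
  apply/eqP; apply: etrans (esym (rmorphM iota _ _)) _.
  exact: etrans (congr1 iota (malgC_central c a)) (rmorphM iota _ _).
split=> [|a b|a b]; rewrite !inE ?mulr1 ?mul1r // => /eqP ca /eqP cb.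
  by rewrite mulrBr mulrBl ca cb.
have [->|b0] := eqVneq b 0; first by rewrite invr0 !mulr0 mul0r.
rewrite mulrA ca -!mulrA; apply/eqP; congr (_ * _).
rewrite -[LHS]mul1r -(skew_mulVr F_field b0) -!mulrA; congr (_ * _).
by rewrite [b * (_ * _)]mulrA -cb -!mulrA (skew_mulrV F_field b0) mulr1.
Qed.

Lemma free_field_criterion : full_criterion kappa gen.
Proof.
move=> N M w w0 wM; apply: singular_pencil_hollow => k L i j alpha test.
have L_field := test_field_axiom test.
have central c x : (j \o i) c * x = x * (j \o i) c by exact: (test_central test (i c) x).
pose phi0 := poly_eval (j \o i) alpha.
have phi_mult : multiplicative phi0 by apply: poly_eval_multiplicative.
pose phiM := GRing.isMultiplicative.Build _ _ phi0 phi_mult.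
pose phi : {rmorphism free_algebra K d -> L} := HB.pack phi0 phiM.
case: univ => _ _ _ /(_ L phi L_field) [S [psi [S_ring Siota psiD psiM S_local]]].
have psi1 : psi 1 = 1 by have [_] := Siota 1; rewrite !rmorph1.
have kS c : kappa c \in S by have [] := Siota c%:MP.
have psik c : psi (kappa c) = j (i c).
  by have [_] := Siota c%:MP; rewrite /= => ->; apply: poly_evalC.
have gS l : gen l \in S by have [] := Siota (letter K l).
have psig l : psi (gen l) = alpha l.
  by have [_] := Siota (letter K l); rewrite /= => ->; apply: poly_eval_letter.
have SD a b : a \in S -> b \in S -> a + b \in S.
  case: S_ring => S1 SB _ aS bS; rewrite -[b]opprK SB // -sub0r SB //.
  by rewrite -(subrr 1) SB.
have SM a b : a \in S -> b \in S -> a * b \in S by case: S_ring => _ _; apply.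
pose X := pencil_eval kappa gen M.
have XS a b : X a b \in S /\ psi (X a b) = pencil_eval (j \o i) alpha M a b.
  have lS l : (map_mx kappa (M (Some l)) *m (gen l)%:M) a b \in S.
    by rewrite mul_mx_scalarE mxE SM.
  have [sS sE] := specialize_sum S_ring psiD (index_enum _) lS.
  rewrite /X /pencil_eval !mxE !summxE; split; first by rewrite SD.
  rewrite psiD // sE psik; congr (_ + _); apply: eq_bigr => l _.
  by rewrite !mul_mx_scalarE !mxE psiM // psik psig.
have XM : map_mx psi X = pencil_eval (j \o i) alpha M.
  by apply/matrixP => a b; rewrite mxE; case: (XS a b).
have [|w' w'0 w'X] := specialize_kernel F_field L_field S_ring psi1 psiD psiM S_local _ w0 wM.
  by move=> a b; case: (XS a b).
by exists w' => //; rewrite -XM.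
Qed.

End FreeField.

Section Annihilators.
Variable K : fieldType.

Lemma factor_left m n c (A : 'M[K]_(m, n)) (B : 'M[K]_(c, n)) :
  (forall x : 'cV_n, A *m x = 0 -> B *m x = 0) -> exists D, B = D *m A.
Proof.
move=> H; apply/submxP; rewrite submxE; apply/eqP/matrixP => a b; rewrite [RHS]mxE.
have Ac : A *m col b (cokermx A) = 0 by rewrite colE mulmxA mulmx_coker mul0mx.
have := H _ Ac; rewrite colE [B *m _]mulmxA -colE.
by move=> /matrixP /(_ a 0); rewrite !mxE.
Qed.

Lemma factor_right m n c (A : 'M[K]_(m, n)) (B : 'M[K]_(m, c)) :
  (forall e : 'rV_m, e *m A = 0 -> e *m B = 0) -> exists D, B = A *m D.
Proof.
move=> H; have [x Ax|D BD] := @factor_left _ _ _ A^T B^T.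
  apply: trmx_inj; rewrite trmx_mul trmxK trmx0; apply: H.
  by apply: trmx_inj; rewrite trmx_mul trmxK trmx0.
by exists D^T; apply: trmx_inj; rewrite trmx_mul trmxK.
Qed.

End Annihilators.

(** * Comparing linear representations *)

Section Systems.
Variables (K : fieldType) (F : unitRingType) (kap : {rmorphism K -> F}) (d : nat) (y : 'I_d -> F).
Local Notation "A ^k" := (map_mx kap A) (at level 2, format "A ^k").
Local Notation pev := (pencil_eval kap y).

(* The represented element is u s = t v. *)
Definition linear_system n (M : option 'I_d -> 'M[K]_n) (u : 'rV[K]_n) (v : 'cV[K]_n)
    (t : 'rV[F]_n) (s : 'cV[F]_n) :=
  [/\ t *m pev M = u^k, pev M *m s = v^k &
      exists B, pev M *m B = 1%:M /\ B *m pev M = 1%:M].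

Definition col_independent n (s : 'cV[F]_n) := forall e : 'rV[K]_n, e^k *m s = 0 -> e = 0.
Definition row_independent n (t : 'rV[F]_n) := forall x : 'cV[K]_n, t *m x^k = 0 -> x = 0.

Lemma linear_systemM n M u v t s : @linear_system n M u v t s -> u^k *m s = t *m v^k.
Proof. by case=> <- <- _; rewrite mulmxA. Qed.

Hypothesis F_field : GRing.field_axiom F.
Hypothesis central : forall c x, kap c * x = x * kap c.
Hypothesis crit : full_criterion kap y.

Lemma map_injective_col m n (C : 'M[K]_(m, n)) (w : 'cV[F]_n) :
  \rank C = n -> C^k *m w = 0 -> w = 0.
Proof.
move=> rC Cw; have [B BC] : exists B, B *m C = 1%:M by apply/row_fullP; rewrite /row_full rC.
by rewrite -[w]mul1mx -(map_mx1 kap) -BC map_mxM -mulmxA Cw mulmx0.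
Qed.

Lemma map_injective_row m n (P : 'M[K]_(m, n)) (w : 'rV[F]_m) :
  \rank P = m -> w *m P^k = 0 -> w = 0.
Proof.
move=> rP wP; have [B PB] : exists B, P *m B = 1%:M by apply/row_freeP; rewrite /row_free rP.
by rewrite -[w]mulmx1 -(map_mx1 kap) -PB map_mxM mulmxA wP mul0mx.
Qed.

(** Its Schur complement with respect to [pev M] is the negative of the represented element: it is
    singular for representations of 0, and otherwise it serves to represent the inverse. *)
Definition bordered n (M : option 'I_d -> 'M[K]_n) (u : 'rV[K]_n) (v : 'cV[K]_n) o :=
  if o is Some l then block_mx (M (Some l)) 0 0 0 else block_mx (M None) v u 0 : 'M[K]_(n + 1).

Lemma pev_bordered n (M : option 'I_d -> 'M[K]_n) u v :
  pev (bordered M u v) = block_mx (pev M) v^k u^k 0.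
Proof.
rewrite /pencil_eval /= map_block_mx map_mx0.
have -> : \sum_l (block_mx (M (Some l)) 0 0 0 : 'M_(n + 1))^k *m (y l)%:M
   = block_mx (\sum_l (M (Some l))^k *m (y l)%:M) 0 0 0.
  elim/big_rec2: _ => [|l x z _ ->]; first exact/esym/block_mx0.
  rewrite map_block_mx !map_mx0 (scalar_mx_block n 1 (y l)) mulmx_block add_block_mx.
  by rewrite !mul0mx !mulmx0 !addr0.
by rewrite add_block_mx !addr0.
Qed.

(** [X] and [Y] are the base changes [P] and [C] reduced modulo the left kernel vector [(- t, 1)]
    and the right kernel vector [(- s, 1)] of the bordered pencil. The zero block is too large for
    either to be injective; a kernel vector of [Y] expresses [s] through [C1], and one of [X]
    expresses [t] through [P1]. *)
Lemma system_hull n M u v t s : @linear_system n M u v t s -> u^k *m s = 0 ->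
  exists c (C : 'M[K]_(n, c)) w, s = C^k *m w /\
    forall l, t *m (M (Some l))^k *m C^k = 0.
Proof.
move=> [tA As [B [AB BA]]] us0.
have tv0 : t *m v^k = 0 by rewrite -As mulmxA tA.
pose w : 'rV[F]_(n + 1) := row_mx (- t) 1%:M.
have w0 : w != 0.
  apply/eqP => /(congr1 (@rsubmx F 1 n 1)); rewrite row_mxKr => /matrixP /(_ 0 0).
  by rewrite !mxE eqxx => /eqP; rewrite oner_eq0.
have wM : w *m pev (bordered M u v) = 0.
  rewrite pev_bordered mul_row_block mul1mx !mulNmx tA tv0 mul1mx addNr oppr0 addr0.
  by rewrite row_mx0.
have [p0 [c0 [P0 [C0 [PMC0 rk]]]]] := crit w0 wM.
have [p [c [P [C [[rP rC] [PMC pc]]]]]] : exists p c (P : 'M[K]_(p, n + 1)) (C : 'M[K]_(n + 1, c)),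
    (\rank P = p /\ \rank C = c) /\
    ((forall o, P *m bordered M u v o *m C = 0) /\ (n + 1 < p + c)%N).
  exists _, _, (row_base P0), (col_base C0); split.
    by rewrite (eqP (row_base_free P0)) (eqP (col_base_full C0)).
  split=> // o; have /submxP [D ->] : (row_base P0 <= P0)%MS by rewrite eq_row_base.
  have [U <-] : exists U, C0 *m U = col_base C0.
    exists (pinvmx (row_base C0)).
    by rewrite -[RHS](mulmxKp (row_base_free C0) (col_base C0)); congr (_ *m _); rewrite mulmx_base.
  by rewrite -!mulmxA [P0 *m _]mulmxA [P0 *m _ *m _]mulmxA PMC0 mul0mx mulmx0.
pose P1 := lsubmx P; pose P2 := rsubmx P; pose C1 := usubmx C; pose C2 := dsubmx C.
have PE : P = row_mx P1 P2 by rewrite hsubmxK.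
have CE : C = col_mx C1 C2 by rewrite vsubmxK.
pose X := P1^k + P2^k *m t; pose Y := C1^k + s *m C2^k.
have XAY : X *m pev M *m Y = 0.
  have : P^k *m pev (bordered M u v) *m C^k = 0.
    rewrite mulmxDr mulmxDl -!map_mxM PMC map_mx0 add0r mulmx_sumr mulmx_suml big1 // => l _.
    rewrite mulmxA -mulmxA -(central_scalar central) mulmxA -!map_mxM PMC map_mx0 mul0mx //.
  rewrite pev_bordered PE CE map_row_mx map_col_mx mul_row_block mul_row_col mulmx0 addr0 => H.
  rewrite /X /Y mulmxDl -[P2^k *m t *m _]mulmxA tA mulmxDr -[RHS]H; congr (_ + _).
  by rewrite mulmxA mulmxDl -[P1^k *m _ *m s]mulmxA As -[P2^k *m u^k *m s]mulmxA us0 mulmx0 addr0.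
(* Otherwise [row_mx X P2] and [col_mx (A Y) 0] are injective with product 0, and their [p + c]
   dimensions fit into [n + 1]. *)
have [w1 w1_0 Yw1] : exists2 w1 : 'cV[F]_c, w1 != 0 & Y *m w1 = 0.
  apply: contrapT => H; suff : (p + c <= n + 1)%N by lia.
  apply: (@rank_sum_bound F F_field _ _ _ (row_mx X P2^k) (col_mx (pev M *m Y) 0)).
  - move=> x; rewrite mul_mx_row -row_mx0 => /eq_row_mx [xX xP2].
    apply: (map_injective_row rP); rewrite PE map_row_mx mul_mx_row xP2.
    by move: xX; rewrite mulmxDr mulmxA xP2 mul0mx addr0 => ->; rewrite row_mx0.
  - move=> x; rewrite mul_col_mx -col_mx0 => /eq_col_mx [AYx _].
    have Yx : Y *m x = 0 by rewrite -[Y]mul1mx -BA -!mulmxA [pev M *m (Y *m x)]mulmxA AYx mulmx0.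
    by apply: contrapT => /eqP x0; apply: H; exists x.
  - by rewrite mul_row_col mulmx0 addr0 mulmxA.
have [w2 w2_0 w2X] : exists2 w2 : 'rV[F]_p, w2 != 0 & w2 *m X = 0.
  apply: contrapT => H; suff : (p + c <= n + 1)%N by lia.
  apply: (@rank_sum_bound F F_field _ _ _ (row_mx (X *m pev M) 0) (col_mx Y C2^k)).
  - move=> x; rewrite mul_mx_row -row_mx0 => /eq_row_mx [XAx _].
    have Xx : x *m X = 0 by rewrite -[X]mulmx1 -AB !mulmxA -[x *m X *m _]mulmxA XAx mul0mx.
    by apply: contrapT => /eqP x0; apply: H; exists x.
  - move=> x; rewrite mul_col_mx -col_mx0 => /eq_col_mx [Yx C2x].
    apply: (map_injective_col rC); rewrite CE map_col_mx mul_col_mx C2x.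
    by move: Yx; rewrite mulmxDl -mulmxA C2x mulmx0 addr0 => ->; rewrite col_mx0.
  - by rewrite mul_row_col mul0mx addr0.
exists c, C1, (- w1 *m ((C2^k *m w1) 0 0)^-1%:M); split.
  have E1 : C1^k *m w1 = - (s *m (C2^k *m w1)).
    by apply/eqP; rewrite -addr_eq0 -Yw1 mulmxDl mulmxA.
  (* The full rank of [C] keeps the last coordinate of [C w1] nonzero, so that [w1] can be divided
     by it. *)
  have k0 : (C2^k *m w1) 0 0 != 0.
    apply: contra_neq w1_0 => k0.
    have C2w : C2^k *m w1 = 0 by apply/matrixP => a b; rewrite !ord1 k0 mxE.
    by apply: (map_injective_col rC); rewrite CE map_col_mx mul_col_mx E1 C2w mulmx0 oppr0 col_mx0.
  rewrite mulNmx mulmxN mulmxA E1 mulNmx opprK -mulmxA; apply/matrixP => a b.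
  rewrite !ord1 [RHS]mxE big_ord1; rewrite [X in _ * X]mul_mx_scalarE.
  by rewrite (skew_mulrV F_field k0) mulr1.
move=> l.
have E2 : w2 *m P1^k = - ((w2 *m P2^k) *m t).
  by apply/eqP; rewrite -addr_eq0 -w2X mulmxDr mulmxA.
have k0 : (w2 *m P2^k) 0 0 != 0.
  apply: contra_neq w2_0 => k0.
  have P2w : w2 *m P2^k = 0 by apply/matrixP => a b; rewrite !ord1 k0 mxE.
  by apply: (map_injective_row rP); rewrite PE map_row_mx mul_mx_row E2 P2w mul0mx oppr0 row_mx0.
have H : P1 *m M (Some l) *m C1 = 0.
  have := PMC (Some l); rewrite PE CE mul_row_block mul_row_col !mulmx0 !addr0 mul0mx addr0.
  by [].
have /eqP : w2 *m P2^k *m (t *m (M (Some l))^k *m C1^k) = 0.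
  by rewrite !mulmxA -[w2 *m P2^k *m t]opprK -E2 !mulNmx -!mulmxA -!map_mxM mulmxA H map_mx0 mulmx0 oppr0.
rewrite (_ : w2 *m P2^k = ((w2 *m P2^k) 0 0)%:M); last first.
  by apply/matrixP => a b; rewrite !ord1 [RHS]mxE eqxx mulr1n.
rewrite mul_scalar_mx => /eqP H2; apply/matrixP => a b.
have /matrixP /(_ a b) := H2; rewrite mxE [RHS]mxE => /(skew_mul_eq0 F_field) [/eqP|->].
  by rewrite (negPf k0).
by rewrite mxE.
Qed.

End Systems.

Lemma rank_one_complement (K : fieldType) n (e : 'rV[K]_n) : e != 0 ->
  exists f : 'cV_n, e *m f = 1%:M.
Proof.
have Kf : GRing.field_axiom K by move=> x; rewrite unitfE.
case/mx_neq0P => i [j]; rewrite ord1 => ej.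
exists (delta_mx j 0 *m (e 0 j)^-1%:M); rewrite mulmxA -colE.
by apply/matrixP => a b; rewrite !ord1 mul_mx_scalarE !mxE eqxx mulfV.
Qed.

Section Comparison.
Variables (K : fieldType) (F : unitRingType) (kap : {rmorphism K -> F}) (d : nat) (y : 'I_d -> F).
Local Notation "A ^k" := (map_mx kap A) (at level 2, format "A ^k").
Local Notation pev := (pencil_eval kap y).
Hypothesis F_field : GRing.field_axiom F.
Hypothesis central : forall c x, kap c * x = x * kap c.
Hypothesis crit : full_criterion kap y.

(** For the least possible [c] the entries of [w] form a basis of the [K]-space spanned by those of
    [s]: a relation [e w = 0] would project [w] into a smaller dimension. *)
Lemma hull_representation m (s : 'cV[F]_m) :
  exists c (C : 'M[K]_(m, c)) w, s = C^k *m w /\ col_independent kap w.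
Proof.
have [c [C [w sC]] cmin] : exists2 c, exists (C : 'M[K]_(m, c)) w, s = C^k *m w &
    forall c', (exists (C : 'M[K]_(m, c')) w, s = C^k *m w) -> (c <= c')%N.
  have ex : exists c, `[< exists (C : 'M[K]_(m, c)) w, s = C^k *m w >].
    by exists m; apply/asboolP; exists 1%:M, s; rewrite map_mx1 mul1mx.
  case: (ex_minnP ex) => c /asboolP Hc cmin; exists c => // c' Hc'.
  by apply: cmin; apply/asboolP.
exists c, C, w; split=> // e ew; apply/eqP/negPn/negP => e0.
have [f ef] := rank_one_complement e0.
pose E := 1%:M - f *m e.
have wE : w = E^k *m w.
  by rewrite /E map_mxB map_mx1 map_mxM mulmxBl mul1mx -mulmxA ew mulmx0 subr0.
have : (c <= \rank E)%N.
  apply: cmin; exists (C *m col_base E), ((row_base E)^k *m w).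
  by rewrite mulmxA -map_mxM -mulmxA mulmx_base map_mxM -mulmxA -wE.
rewrite leqNgt => /negP; apply; rewrite ltn_neqAle rank_leq_row andbT.
apply/negP => /row_freeP [D ED]; case/eqP: e0.
rewrite -[e]mulmx1 -ED mulmxA mulmxBr mulmx1 mulmxA ef mul1mx subrr mul0mx //.
Qed.

Definition direct_sum N n (M : option 'I_d -> 'M[K]_N) (M' : option 'I_d -> 'M[K]_n) o :=
  block_mx (M o) 0 0 (M' o).

Lemma pev_direct_sum N n (M : option 'I_d -> 'M[K]_N) (M' : option 'I_d -> 'M[K]_n) :
  pev (direct_sum M M') = block_mx (pev M) 0 0 (pev M').
Proof.
rewrite /pencil_eval /= map_block_mx !map_mx0.
have -> : \sum_l (direct_sum M M' (Some l))^k *m (y l)%:M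
   = block_mx (\sum_l (M (Some l))^k *m (y l)%:M) 0 0 (\sum_l (M' (Some l))^k *m (y l)%:M).
  elim/big_rec3: _ => [|l x1 x2 x3 _ ->]; first exact/esym/block_mx0.
  rewrite map_block_mx !map_mx0 (scalar_mx_block N n (y l)) mulmx_block add_block_mx.
  by rewrite !mul0mx !mulmx0 !addr0 !add0r.
by rewrite add_block_mx !addr0.
Qed.

Lemma linear_system_difference N n M u v t s M' u' v' t' s' :
  @linear_system K F kap d y N M u v t s -> @linear_system K F kap d y n M' u' v' t' s' ->
  linear_system kap y (direct_sum M M') (row_mx u (- u')) (col_mx v v') (row_mx t (- t')) (col_mx s s').
Proof.
move=> [tA As [B [AB BA]]] [tA' As' [B' [AB' BA']]]; split.
- by rewrite pev_direct_sum mul_row_block !mulmx0 addr0 add0r mulNmx tA tA' map_row_mx map_mxN.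
- by rewrite pev_direct_sum mul_block_col !mul0mx addr0 add0r As As' map_col_mx.
exists (block_mx B 0 0 B'); rewrite pev_direct_sum !mulmx_block.
by rewrite !mul0mx !mulmx0 !addr0 !add0r AB BA AB' BA' -scalar_mx_block.
Qed.

(* The hull of (s; s') projects injectively to its first component: a constant vector x in the kernel of the
   projection satisfies A' x = 0 because t' is independent. *)
Lemma compare_systems N n M u v t s M' u' v' t' s' :
  @linear_system K F kap d y N M u v t s -> @linear_system K F kap d y n M' u' v' t' s' ->
  u^k *m s = u'^k *m s' -> row_independent kap t' -> col_independent kap s' ->
  exists c (C : 'M[K]_(N, c)) w, [/\ s = C^k *m w, col_independent kap w, (n <= \rank C)%N &
    (\rank C <= n)%N -> exists Phi : 'M[K]_(N, n), s = Phi^k *m s'].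
Proof.
move=> sys sys' us t'ind s'ind.
have sysD := linear_system_difference sys sys'.
have u0 : (row_mx u (- u'))^k *m col_mx s s' = 0.
  by rewrite map_row_mx mul_row_col map_mxN mulNmx us subrr.
have [c1 [C1 [w1 [sC1 tC1]]]] := system_hull F_field central crit sysD u0.
have [c [C [w [sC wind]]]] := hull_representation (col_mx s s').
(* The hull lies in every constant range through which the vector factors, so [C] inherits the
   vanishing known for [C1]. *)
have [D CD] : exists D, C = C1 *m D.
  apply: factor_right => e eC1; apply: wind.
  by rewrite map_mxM -mulmxA -sC sC1 mulmxA -map_mxM eC1 map_mx0 mul0mx.
pose Ca := usubmx C; pose Cb := dsubmx C.
have CE : C = col_mx Ca Cb by rewrite vsubmxK.
have [sCa sCb] : s = Ca^k *m w /\ s' = Cb^k *m w.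
  by apply: eq_col_mx; rewrite sC {1}CE map_col_mx mul_col_mx.
have uC : u *m Ca = u' *m Cb.
  apply/eqP; rewrite -subr_eq0; apply/eqP; apply: wind.
  by rewrite map_mxB !map_mxM mulmxBl -!mulmxA -sCa -sCb us subrr.
have tC l : t *m (M (Some l))^k *m Ca^k = t' *m (M' (Some l))^k *m Cb^k.
  have := tC1 l; rewrite /direct_sum => H; apply/eqP; rewrite -subr_eq0; apply/eqP.
  have : row_mx t (- t') *m (block_mx (M (Some l)) 0 0 (M' (Some l)))^k *m C^k = 0.
    by rewrite CD map_mxM mulmxA H mul0mx.
  rewrite CE map_block_mx map_col_mx !map_mx0 mul_row_block mul_row_col !mulmx0 addr0 add0r.
  by rewrite !mulNmx.
have [_ _ [B' [_ BA']]] := sys'; have [tA' _ _] := sys'.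
have kerC (x : 'cV_c) : Ca *m x = 0 -> Cb *m x = 0.
  move=> Cax.
  have tl l : t' *m (M' (Some l))^k *m (Cb *m x)^k = 0.
    by rewrite map_mxM mulmxA -tC -mulmxA -map_mxM Cax map_mx0 mulmx0.
  have Ml l : M' (Some l) *m (Cb *m x) = 0 by apply: t'ind; rewrite map_mxM mulmxA.
  have sum0 : (\sum_l (M' (Some l))^k *m (y l)%:M) *m (Cb *m x)^k = 0.
    rewrite mulmx_suml big1 // => l _.
    by rewrite -mulmxA -(central_scalar central) mulmxA -map_mxM Ml map_mx0 mul0mx.
  have M0 : M' None *m (Cb *m x) = 0.
    apply: t'ind; rewrite map_mxM.
    have -> : (M' None)^k *m (Cb *m x)^k = pev M' *m (Cb *m x)^k by rewrite mulmxDl sum0 addr0.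
    by rewrite mulmxA tA' -map_mxM mulmxA -uC -mulmxA Cax mulmx0 map_mx0.
  have Ax : pev M' *m (Cb *m x)^k = 0 by rewrite mulmxDl sum0 addr0 -map_mxM M0 map_mx0.
  have : (Cb *m x)^k = 0 by rewrite -[LHS]mul1mx -BA' -mulmxA Ax mulmx0.
  by move=> x0; apply: t'ind; rewrite x0 mulmx0.
have [Psi CbE] := factor_left kerC.
have rCb : \rank Cb = n.
  apply/eqP; rewrite -[_ == _]/(row_free Cb) -kermx_eq0; apply/eqP/row_matrixP => a.
  rewrite row0; apply: s'ind; rewrite sCb mulmxA -map_mxM -row_mul mulmx_ker row0.
  by rewrite map_mx0 mul0mx.
have CbCa : (Cb <= Ca)%MS by apply/submxP; exists Psi.
exists c, Ca, w; split=> //; first by rewrite -rCb mxrankS.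
(* The row space of [Cb] lies in that of [Ca]; equal ranks make them equal, and [Ca = Phi Cb]
   carries [s'] to [s]. *)
move=> rCa; have /eqP : \rank Cb = \rank Ca.
  by apply/eqP; rewrite eqn_leq (mxrankS CbCa) rCb.
rewrite (mxrank_leqif_sup CbCa) => /submxP [Phi CaE].
by exists Phi; rewrite sCa CaE map_mxM -mulmxA -sCb.
Qed.

End Comparison.

(** * The mirror image of the comparison *)

Section Mirror.
Variables (K : fieldType) (F : unitRingType) (kap : {rmorphism K -> F}) (d : nat) (y : 'I_d -> F).
Local Notation "A ^k" := (map_mx kap A) (at level 2, format "A ^k").
Local Notation pev := (pencil_eval kap y).
Hypothesis F_field : GRing.field_axiom F.
Hypothesis central : forall c x, kap c * x = x * kap c.
Hypothesis crit : full_criterion kap y.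

Definition conv_map : K -> F^c := kap.
Fact conv_map_additive : additive conv_map. Proof. by move=> a b; exact: (rmorphB kap). Qed.
Fact conv_map_multiplicative : multiplicative conv_map.
Proof. by split=> [a b|]; [rewrite mulrC; exact: (rmorphM kap) | exact: (rmorph1 kap)]. Qed.
HB.instance Definition _ := GRing.isAdditive.Build K F^c conv_map conv_map_additive.
HB.instance Definition _ := GRing.isMultiplicative.Build K F^c conv_map conv_map_multiplicative.

Definition tr_family n (M : option 'I_d -> 'M[K]_n) o := (M o)^T.

Lemma pev_converse n (M : option 'I_d -> 'M[K]_n) :
  @pencil_eval K F^c conv_map d y n (tr_family M) = (pev M)^T.
Proof.
apply/matrixP => a b; rewrite /pencil_eval !mxE !summxE; congr (_ + _).
apply: eq_bigr => l _; rewrite (@mul_mx_scalarE (F^c : nzRingType)) mul_mx_scalarE !mxE.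
exact: esym (central _ _).
Qed.

(** A square matrix singular on one side is singular on the other, and transposition exchanges the
    two base changes of a hollow family. *)
Lemma converse_criterion : @full_criterion K F^c conv_map d y.
Proof.
move=> N M w w0 wM.
have H : pev (tr_family M) *m w^T = 0.
  have := congr1 trmx wM; rewrite trmx_converse' trmx0 => <-; congr (_ *m _).
  have E : tr_family (tr_family M) = M by apply/funext => o; rewrite /tr_family trmxK.
  by rewrite -[LHS]trmxK -pev_converse E.
have [w' w'0 w'M] : exists2 w' : 'rV[F]_N, w' != 0 & w' *m pev (tr_family M) = 0.
  apply: contrapT => H'.
  have [|B [_ BA]] := @no_left_kernel_inverse F F_field _ (pev (tr_family M)).
    by move=> x xM; apply: contrapT => /eqP x0; apply: H'; exists x.
  case/eqP: w0; apply: trmx_inj; rewrite trmx0 -[LHS](@mul1mx F) -BA -mulmxA H.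
  exact: (@mulmx0 F _ _ _ B).
have [p [c [P [C [PMC rk]]]]] := crit w'0 w'M.
exists c, p, C^T, P^T; split; last by rewrite !mxrank_tr addnC.
move=> o; apply: trmx_inj; rewrite !trmx_mul !trmxK trmx0 mulmxA; exact: PMC.
Qed.

Lemma converse_system n M u v t s : @linear_system K F kap d y n M u v t s ->
  @linear_system K F^c conv_map d y n (tr_family M) v^T u^T s^T t^T.
Proof.
move=> [tA As [B [AB BA]]]; split.
- by rewrite pev_converse -trmx_converse As map_trmx.
- by rewrite pev_converse -trmx_converse tA map_trmx.
exists B^T; rewrite pev_converse -!trmx_converse AB BA; split; exact: trmx1.
Qed.

Lemma compare_systems_row N n M u v t s M' u' v' t' s' :
  @linear_system K F kap d y N M u v t s -> @linear_system K F kap d y n M' u' v' t' s' ->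
  u^k *m s = u'^k *m s' -> row_independent kap t' -> col_independent kap s' ->
  exists c (C : 'M[K]_(c, N)) w, [/\ t = w *m C^k, row_independent kap w, (n <= \rank C)%N &
    (\rank C <= n)%N -> exists Phi : 'M[K]_(n, N), t = t' *m Phi^k].
Proof.
move=> sys sys' us t'ind s'ind.
have cF := @converse_field_axiom F F_field.
have [||||c [C [w [sC wind nC Phi]]]] := compare_systems cF _ converse_criterion
  (converse_system sys) (converse_system sys').
- by move=> c x; exact: esym (central _ _).
- move: us; rewrite (linear_systemM sys) (linear_systemM sys') => /(congr1 trmx).
  by rewrite !trmx_converse !map_trmx.
- move=> x Hx; apply: trmx_inj; rewrite trmx0; apply: s'ind.
  have := congr1 trmx Hx; rewrite trmx_converse' trmxK -map_trmx => H.
  by rewrite H; apply: trmx0.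
- move=> e He; apply: trmx_inj; rewrite trmx0; apply: t'ind.
  have := congr1 trmx He; rewrite trmx_converse' trmxK -map_trmx => H.
  by rewrite H; apply: trmx0.
exists c, C^T, w^T; rewrite mxrank_tr; split=> //.
- by rewrite -[LHS]trmxK sC trmx_converse' map_trmx.
- move=> x wx; apply: trmx_inj; rewrite trmx0; apply: wind.
  have := congr1 trmx wx; rewrite trmx_converse trmxK -map_trmx => H.
  by rewrite H; apply: trmx0.
move=> /Phi [Ph tE]; exists Ph^T.
by rewrite -[LHS]trmxK tE trmx_converse' trmxK map_trmx.
Qed.

End Mirror.

(** * Minimal automata of polynomials *)

Section Automata.
Variables (K : fieldType) (d : nat).
Implicit Types (w : seq 'I_d) (phi : seq 'I_d -> K).

Definition word_mx n (C : 'I_d -> 'M[K]_n) w := foldr (fun l A => C l *m A) 1%:M w.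

Lemma word_mx_cat n (C : 'I_d -> 'M[K]_n) w1 w2 :
  word_mx C (w1 ++ w2) = word_mx C w1 *m word_mx C w2.
Proof. by elim: w1 => [|l w1 IH] /=; rewrite ?mul1mx // IH mulmxA. Qed.

Lemma word_mx_rev n (C : 'I_d -> 'M[K]_n) w :
  word_mx (fun l => (C l)^T) (rev w) = (word_mx C w)^T.
Proof.
elim: w => [|l w IH]; first by rewrite /= trmx1.
by rewrite rev_cons -cats1 word_mx_cat IH /= mulmx1 trmx_mul.
Qed.

Definition recognizes phi n (u : 'rV[K]_n) (C : 'I_d -> 'M[K]_n) (v : 'cV[K]_n) :=
  forall w, u *m word_mx C w *m v = (phi w)%:M.

Definition recognizable phi n := exists u C v, @recognizes phi n u C v.

Lemma recognizes_rev phi n u C v : @recognizes phi n u C v ->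
  recognizes (phi \o rev) v^T (fun l => (C l)^T) u^T.
Proof.
move=> H w; rewrite -[w in word_mx _ w]revK word_mx_rev -!trmx_mul mulmxA H.
by rewrite tr_scalar_mx.
Qed.

(** [U] is the double annihilator of the rows [u C_w]. It contains [u] and is stable under every
    [C_l], so the automaton restricts to it, and minimality makes it the whole space. *)
Lemma minimal_reachable phi n u C v :
  @recognizes phi n u C v -> (forall m, recognizable phi m -> (n <= m)%N) ->
  forall x : 'cV_n, (forall w, u *m word_mx C w *m x = 0) -> x = 0.
Proof.
move=> rec nmin x ux.
pose inhull m (B : 'M[K]_(m, n)) :=
  forall x : 'cV_n, (forall w, u *m word_mx C w *m x = 0) -> B *m x = 0.
have [r [U [hU rU]] rmax] :
    exists2 r, (exists U : 'M_n, inhull n U /\ \rank U = r) &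
      forall r', (exists U : 'M_n, inhull n U /\ \rank U = r') -> (r' <= r)%N.
  apply: (@nat_max _ n); first by exists 0%N, 0; split; [move=> z _; rewrite mul0mx | rewrite mxrank0].
  by move=> r [U [_ <-]]; apply: rank_leq_row.
have subU m (B : 'M[K]_(m, n)) : inhull m B -> (B <= U)%MS.
  move=> hB; have hUB : inhull n (U + B)%MS.
    move=> z uz; have /sub_addsmxP [[D1 D2] ->] : (U + B <= U + B)%MS by [].
    by rewrite /= mulmxDl -!mulmxA hU // hB // !mulmx0 addr0.
  have rk : (\rank (U + B)%MS <= \rank U)%N by rewrite rU; apply: rmax; exists (U + B)%MS.
  have : \rank U == \rank (U + B)%MS by rewrite eqn_leq rk mxrankS ?addsmxSl.
  rewrite (mxrank_leqif_sup (addsmxSl U B)); apply: submx_trans; exact: addsmxSr.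
have hUb : inhull _ (row_base U).
  move=> z uz; have /submxP [D ->] : (row_base U <= U)%MS by rewrite eq_row_base.
  by rewrite -mulmxA hU // mulmx0.
have subUb m (B : 'M[K]_(m, n)) : inhull m B -> exists D, B = D *m row_base U.
  by move=> /subU BU; apply/submxP; rewrite eq_row_base.
have [u1 u1E] : exists u1, u = u1 *m row_base U.
  by apply: subUb => z /(_ [::]); rewrite /= mulmx1.
have UC l : exists D, row_base U *m C l = D *m row_base U.
  apply: subUb => z uz; rewrite -mulmxA hUb // => w.
  by have := uz (w ++ [:: l]); rewrite word_mx_cat /= mulmx1 !mulmxA.
have [C1 C1E] := choice UC.
have C1w w : word_mx C1 w *m row_base U = row_base U *m word_mx C w.
  elim: w => [|l w IH]; first by rewrite /= mul1mx mulmx1.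
  by rewrite /= -mulmxA IH mulmxA -C1E mulmxA.
have : (n <= \rank U)%N.
  apply: nmin; exists u1, C1, (row_base U *m v) => w.
  by rewrite mulmxA -[u1 *m _ *m _]mulmxA C1w mulmxA -u1E rec.
move=> nU; have /row_fullP [D DU] : row_full U by rewrite /row_full eqn_leq nU rank_leq_col.
by rewrite -[x]mul1mx -DU -mulmxA hU // mulmx0.
Qed.

(** Reachability for the transposed automaton, which reads words backwards. *)
Lemma minimal_observable phi n u C v :
  @recognizes phi n u C v -> (forall m, recognizable phi m -> (n <= m)%N) ->
  forall e : 'rV_n, (forall w, e *m word_mx C w *m v = 0) -> e = 0.
Proof.
move=> rec nmin e ev; apply: trmx_inj; rewrite trmx0.
apply: (minimal_reachable (recognizes_rev rec)).
  move=> m [u' [C' [v' /recognizes_rev rec']]]; apply: nmin.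
  exists v'^T, (fun l => (C' l)^T), u'^T => w.
  by rewrite rec' /= revK.
move=> w; rewrite -[w]revK word_mx_rev -!trmx_mul mulmxA ev trmx0 //.
Qed.

End Automata.

(** * Coefficients of noncommutative polynomials *)

Section Words.
Variables (K : fieldType) (d : nat).
Local Notation R := (free_algebra K d).
Implicit Types (p : R) (w : seq 'I_d).

Definition wcoef p w : K := p@_(FMonom w).

Lemma wcoefD p1 p2 w : wcoef (p1 + p2) w = wcoef p1 w + wcoef p2 w.
Proof. exact: mcoeffD. Qed.
Lemma wcoefN p w : wcoef (- p) w = - wcoef p w.
Proof. exact: mcoeffN. Qed.
Lemma wcoef0 w : wcoef 0 w = 0.
Proof. exact: mcoeff0. Qed.
Lemma wcoef_sum I (r : seq I) (f : I -> R) w :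
  wcoef (\sum_(i <- r) f i) w = \sum_(i <- r) wcoef (f i) w.
Proof. by elim/big_rec2: _ => [|i a b _ <-]; [apply: wcoef0 | apply: wcoefD]. Qed.
Lemma wcoefCM c p w : wcoef (c%:MP * p) w = c * wcoef p w.
Proof. exact: mcoeffCM. Qed.
Lemma wcoefMC p c w : wcoef (p * c%:MP) w = wcoef p w * c.
Proof. by rewrite -malgC_central wcoefCM [RHS]mulrC. Qed.
Lemma wcoefC c w : wcoef c%:MP w = if w is [::] then c else 0.
Proof.
rewrite /wcoef mcoeffC; have -> : (FMonom w == mone) = (w == [::]) by rewrite fmP fm1.
by case: w.
Qed.

Lemma wcoefP p1 p2 : wcoef p1 =1 wcoef p2 -> p1 = p2.
Proof. by move=> H; apply/malgP => m; have := H m; rewrite /wcoef fmK. Qed.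

Lemma wcoef_letterM l p w :
  wcoef (letter K l * p) w = if w is l' :: w' then (if l == l' then wcoef p w' else 0) else 0.
Proof.
rewrite /wcoef /letter malgM_def fgmulUg raddf_sum /=.
rewrite (eq_bigr (fun k => p@_k *+ (fmmul (fmu l) k == FMonom w))); last first.
  by move=> k _; rewrite mcoeffU mul1r.
have fE (k : {fmonom 'I_d}) : (fmmul (fmu l) k == FMonom w) = (l :: k == w).
  by rewrite fmP fmmulE fmuE.
case: w fE => [|l' w] fE; first by rewrite big1 // => k _; rewrite fE.
case: eqP => [ll|ll]; last first.
  rewrite big1 // => k _; rewrite fE eqseq_cons.
  by case: eqP => // /ll.
rewrite (eq_bigr (fun k => p@_k *+ (k == FMonom w))); last first.
  by move=> k _; rewrite fE eqseq_cons ll eqxx /= fmP.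
have [win|wout] := boolP (FMonom w \in msupp p); last first.
  rewrite (mcoeff_outdom wout) big1_seq // => k /andP [_ kp]; case: eqP => // kw.
  by rewrite -kw kp in wout.
rewrite (big_rem _ win) /= eqxx mulr1n big1_seq ?addr0 // => k /andP [_].
rewrite mem_rem_uniq ?fset_uniq // inE => /andP [/negPf -> _].
by rewrite mulr0n.
Qed.

Lemma poly_of_coefs D (c : seq 'I_d -> K) : (forall w, (D <= size w)%N -> c w = 0) ->
  exists p, forall w, wcoef p w = c w.
Proof.
elim: D c => [|D IH] c Hc; first by exists 0 => w; rewrite wcoef0 Hc.
have Pl l : exists p, forall w, wcoef p w = c (l :: w).
  by apply: IH => w Dw; apply: Hc.
have [P HP] := choice Pl.
exists ((c [::])%:MP + \sum_l letter K l * P l) => w.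
rewrite wcoefD wcoefC wcoef_sum; case: w => [|l w].
  by rewrite big1 ?addr0 // => l _; rewrite wcoef_letterM.
rewrite add0r (eq_bigr (fun l' => if l' == l then wcoef (P l') w else 0)).
  by rewrite -big_mkcond big_pred1_eq HP.
by move=> l' _; rewrite wcoef_letterM.
Qed.

(** Direct sums of automata add coefficients, which leaves single words; these are built letter by
    letter. *)
Lemma wcoef_recognizable p : exists n, recognizable (wcoef p) n.
Proof.
rewrite [p]monalgE; apply: (big_ind (fun p : R => exists n, recognizable (wcoef p) n)).
- by exists 0%N, 0, (fun=> 0), 0 => w; apply/matrixP => i j; rewrite !ord1 wcoef0 mulmx0 !mxE eqxx.
- move=> p1 p2 [n1 [u1 [C1 [v1 H1]]]] [n2 [u2 [C2 [v2 H2]]]].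
  exists (n1 + n2)%N, (row_mx u1 u2), (fun l => block_mx (C1 l) 0 0 (C2 l)), (col_mx v1 v2) => w.
  have -> : word_mx (fun l => block_mx (C1 l) 0 0 (C2 l)) w
      = block_mx (word_mx C1 w) 0 0 (word_mx C2 w).
    elim: w => [|l w IH]; first by rewrite /= -scalar_mx_block.
    by rewrite /= IH mulmx_block !mul0mx !mulmx0 !addr0 add0r.
  by rewrite mul_row_block !mulmx0 addr0 add0r mul_row_col H1 H2 wcoefD raddfD.
move=> m _; move: (p@_m) => c; rewrite -[m]fmK; move: (fmonom_val m) => w0 {m}.
suff [n [u [C [v H]]]] : exists n u C v, @recognizes K d (fun w => (w == w0)%:R) n u C v.
  exists n, (c%:M *m u), C, v => w; rewrite -!mulmxA [u *m _]mulmxA H -scalar_mxM.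
  by rewrite /wcoef mcoeffU fmP /= mulr_natr eq_sym.
elim: w0 => [|l w0 [n [u [C [v H]]]]].
  exists 1%N, 1%:M, (fun=> 0), 1%:M => [] [|l w]; rewrite /= ?mulmx1 ?mul1mx ?mul0mx //.
  by rewrite raddf0.
(* A new initial state in front, which only the letter [l] leaves, into the initial vector [u] of
   the automaton of [w0]. *)
exists (1 + n)%N, (row_mx 1%:M 0), (fun m => block_mx 0 (if m == l then u else 0) 0 (C m)), (col_mx 0 v).
case=> [|m w]; first by rewrite /= mulmx1 mul_row_col mulmx0 mul0mx addr0 raddf0.
set Cb := (fun m => block_mx _ _ _ _).
have wE : exists x y z, word_mx Cb w = block_mx x y z (word_mx C w) /\ z = 0.
  elim: w => [|m' w [x [y [z [IH z0]]]]].
    by exists 1%:M, 0, 0; rewrite /= -scalar_mx_block.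
  exists (0 *m x + (if m' == l then u else 0) *m z), (0 *m y + (if m' == l then u else 0) *m word_mx C w), 0.
  by rewrite /= IH z0 mulmx_block !mul0mx !mulmx0 !addr0 !add0r.
rewrite [word_mx Cb (m :: w)]/=; have [x [y [z [-> ->]]]] := wE.
rewrite /Cb mulmx_block !mul0mx !mulmx0 !addr0 !add0r mul_row_block !mul1mx !mul0mx !addr0.
rewrite mul_row_col mulmx0 add0r eqseq_cons; case: eqP => _ /=; first exact: H.
by rewrite !mul0mx raddf0.
Qed.

(** Since both lengths are maximal, words of the two supports can only be concatenated to [wa ++ wb]
    with the cut after [wa]. *)
Lemma wcoefM_top (a b : R) wa wb :
  (forall w, wcoef a w != 0 -> (size w <= size wa)%N) ->
  (forall w, wcoef b w != 0 -> (size w <= size wb)%N) ->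
  wcoef (a * b) (wa ++ wb) = wcoef a wa * wcoef b wb.
Proof.
move=> Ha Hb.
have H (k1 k2 : {fmonom 'I_d}) : k1 \in msupp a -> k2 \in msupp b ->
    (fmmul k1 k2 == FMonom (wa ++ wb)) = (k1 == FMonom wa) && (k2 == FMonom wb).
  rewrite -!mcoeff_neq0 => k1a k2b.
  have s1 : (size k1 <= size wa)%N by apply: Ha; rewrite /wcoef fmK.
  have s2 : (size k2 <= size wb)%N by apply: Hb; rewrite /wcoef fmK.
  rewrite !fmP fmmulE; apply/idP/idP => [/eqP E|/andP [/eqP /= -> /eqP /= ->] //].
  have E' : k1 ++ k2 = wa ++ wb :> seq 'I_d := E.
  have E2 : (size k1 + size k2 = size wa + size wb)%N by rewrite -!size_cat E'.
  have s3 : size k1 = size wa.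
    by apply/eqP; rewrite eqn_leq s1 /= -(leq_add2r (size wb)) -E2 leq_add2l s2.
  by rewrite -eqseq_cat //= E'.
rewrite /wcoef mcoeffMl.
have S (p : R) (k0 : {fmonom 'I_d}) (G : {fmonom 'I_d} -> K) : (p@_k0 = 0 -> G k0 = 0) ->
    \sum_(k <- msupp p) G k *+ (k == k0) = G k0.
  move=> G0; have [kin|kout] := boolP (k0 \in msupp p).
    rewrite (big_rem _ kin) /= eqxx mulr1n big1_seq ?addr0 // => k /andP [_].
    by rewrite mem_rem_uniq ?fset_uniq // inE => /andP [/negPf -> _].
  rewrite G0 ?(mcoeff_outdom kout) // big1_seq // => k /andP [_ kp].
  by case: eqP => // kk; rewrite -kk kp in kout.
rewrite big_seq (eq_bigr (fun k1 => (a@_k1 * b@_(FMonom wb)) *+ (k1 == FMonom wa))).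
  by rewrite -big_seq (S a _ (fun k => a@_k * b@_(FMonom wb))) // => ->; rewrite mul0r.
move=> k1 k1a; rewrite big_seq.
rewrite (eq_bigr (fun k2 => (a@_k1 * b@_k2 *+ (k1 == FMonom wa)) *+ (k2 == FMonom wb))).
  by rewrite -big_seq (S b _ (fun k => a@_k1 * b@_k *+ (k1 == FMonom wa))) // => ->; rewrite mulr0 mul0rn.
by move=> k2 k2b; rewrite H // -mulrnA mulnb.
Qed.

Lemma top_word p : p != 0 ->
  exists2 w0, wcoef p w0 != 0 & forall w, wcoef p w != 0 -> (size w <= size w0)%N.
Proof.
move=> p0; have [w Hw] : exists w, wcoef p w != 0.
  apply: contrapT => H; case/eqP: p0; apply: wcoefP => w; rewrite wcoef0.
  by apply/eqP/negPn/negP => Hw; apply: H; exists w.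
have [n [w0 pw0 <-] nmax] : exists2 n, (exists2 w, wcoef p w != 0 & size w = n) &
    forall m, (exists2 w, wcoef p w != 0 & size w = m) -> (m <= n)%N.
  apply: (@nat_max _ (\sum_(k <- msupp p) size (k : seq 'I_d))).
    by exists (size w), w.
  move=> m [v pv <-]; rewrite /wcoef mcoeff_neq0 in pv.
  by rewrite (big_rem _ pv) /= leq_addr.
by exists w0 => // v pv; apply: nmax; exists v.
Qed.

End Words.

Section PolynomialSystems.
Variables (K : fieldType) (d : nat) (F : unitRingType) (iota : {rmorphism free_algebra K d -> F}).
Local Notation R := (free_algebra K d).
Hypothesis univ : universal_field_of_fractions iota.
Local Notation kap := (kappa iota).
Local Notation y := (gen iota).
Local Notation "A ^k" := (map_mx kap A) (at level 2, format "A ^k").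
Local Notation "A ^i" := (map_mx iota A) (at level 2, format "A ^i").
Local Notation pev := (pencil_eval kap y).
Local Notation system := (linear_system kap y).

Let F_field : GRing.field_axiom F. Proof. by case: univ. Qed.
Let iota_inj : injective iota. Proof. by case: univ. Qed.
Let central := kappa_central univ.

Definition bounded_degree p D := forall w, wcoef (p : R) w != 0 -> (size w <= D)%N.

Definition automaton_family n (C : 'I_d -> 'M[K]_n) o := if o is Some l then - C l else 1%:M.

Lemma kappaE c : kap c = iota c%:MP. Proof. by []. Qed.

Lemma map_kappa m n (A : 'M[K]_(m, n)) : A ^k = (map_mx (fun c => c%:MP) A)^i.
Proof. by apply/matrixP => i j; rewrite !mxE. Qed.

Lemma fixed_row n C (c : 'rV[K]_n) : (forall l, c *m C l = 0) ->
  c^k *m pev (automaton_family C) = c^k.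
Proof.
move=> cC; rewrite mulmxDr map_mx1 mulmx1 mulmx_sumr big1 ?addr0 // => l _.
by rewrite mulmxA -map_mxM /= mulmxN cC oppr0 map_mx0 mul0mx.
Qed.

Lemma fixed_col n C (x : 'cV[K]_n) : (forall l, C l *m x = 0) ->
  pev (automaton_family C) *m x^k = x^k.
Proof.
move=> Cx; rewrite mulmxDl map_mx1 mul1mx mulmx_suml big1 ?addr0 // => l _.
by rewrite -mulmxA -(central_scalar central) mulmxA -map_mxM /= mulNmx Cx oppr0 map_mx0 mul0mx.
Qed.

Lemma poly_mx m n (D : nat) (c : seq 'I_d -> 'M[K]_(m, n)) :
  (forall w, (D <= size w)%N -> c w = 0) ->
  exists A : 'M[R]_(m, n), forall i j w, wcoef (A i j) w = c w i j.
Proof.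
move=> Hc; have H (ij : 'I_m * 'I_n) : exists p : R, forall w, wcoef p w = c w ij.1 ij.2.
  by apply: (@poly_of_coefs _ _ D) => w /Hc ->; rewrite mxE.
have [P HP] := choice H; exists (\matrix_(i, j) P (i, j)) => i j w.
by rewrite mxE HP.
Qed.

(* Read off the minimal automaton of p: the coefficient of a word w is u C_w v and the pencil is 1 - sum_l C_l x_l.
   The fixed vectors c and x come from a word of maximal length. *)
Definition good_system p n (u : 'rV[K]_n) (C : 'I_d -> 'M[K]_n) (v : 'cV[K]_n)
    (t : 'rV[R]_n) (s : 'cV[R]_n) :=
  [/\ system (automaton_family C) u v t^i s^i, u^k *m s^i = (iota p)%:M,
      row_independent kap t^i, col_independent kap s^i &
  [/\ forall D, bounded_degree p D ->
        (forall i, bounded_degree (t 0 i) D) /\ (forall i, bounded_degree (s i 0) D) &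
      exists (c : 'rV_n) (x : 'cV_n),
        [/\ forall l, c *m C l = 0, c *m v = 1%:M, forall l, C l *m x = 0, u *m x = 1%:M &
            (exists2 w, w != [::] & wcoef p w != 0) -> c *m x = 0]]].

Lemma good_system_exists p : p != 0 -> exists n u C v t s, @good_system p n u C v t s.
Proof.
move=> p0; have [w0 pw0 w0max] := top_word p0.
have [n [u [C [v rec]]] nmin] :
    exists2 n, recognizable (wcoef p) n & forall m, recognizable (wcoef p) m -> (n <= m)%N.
  have ex : exists n, `[< recognizable (wcoef p) n >].
    by have [n Hn] := wcoef_recognizable p; exists n; apply/asboolP.
  case: (ex_minnP ex) => n /asboolP Hn nmin; exists n => // m Hm.
  by apply: nmin; apply/asboolP.
have reach := minimal_reachable rec nmin.
have observe := minimal_observable rec nmin.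
(* For a long word all coefficients [u C_w1 C_w C_w2 v] vanish; reachability and observability strip
   off both sides. *)
have Czero w : (size w0 < size w)%N -> word_mx C w = 0.
  move=> sw; have H (x : 'cV_n) : word_mx C w *m x = 0.
    apply: reach => w1; rewrite mulmxA.
    suff -> : u *m word_mx C w1 *m word_mx C w = 0 by rewrite mul0mx.
    apply: observe => w2.
    rewrite -[u *m _ *m _]mulmxA -word_mx_cat -[u *m _ *m _]mulmxA -word_mx_cat rec.
    rewrite (_ : wcoef p _ = 0) ?raddf0 //.
    by apply/eqP/negPn/negP => /w0max; rewrite !size_cat; lia.
  apply/matrixP => i j; have := H (delta_mx j 0); rewrite -colE => /matrixP /(_ i 0).
  by rewrite !mxE.
(* [B] is the sum of the [C_w w], a polynomial matrix by [Czero], and will be the inverse of the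
   pencil. *)
have [B BE] : exists B : 'M[R]_n, forall i j w, wcoef (B i j) w = word_mx C w i j.
  exact: (@poly_mx _ _ (size w0).+1).
pose mw m1 m2 (A : 'M[R]_(m1, m2)) w := map_mx (fun q : R => wcoef q w) A.
have mwM m1 m2 m3 (D : 'M[K]_(m1, m2)) (E : 'M[R]_(m2, m3)) w :
    mw _ _ (map_mx (fun c => c%:MP) D *m E) w = D *m mw _ _ E w.
  apply/matrixP => i j; rewrite !mxE wcoef_sum; apply: eq_bigr => k _.
  by rewrite !mxE wcoefCM.
pose A : 'M[R]_n := linear_pencil 1%:M (fun l => - C l).
have AB : A *m B = 1%:M.
  have -> : A *m B = B - \sum_l map_mx (fun c => c%:MP) (C l) *m (letter K l)%:M *m B.
    have -> : A = 1%:M - \sum_l map_mx (fun c => c%:MP) (C l) *m (letter K l)%:M.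
      apply/matrixP => i j; rewrite mxE [RHS]mxE; congr (_ + _).
        by rewrite !mxE; case: (i == j) => //; apply: malgC0E.
      rewrite mxE !summxE -sumrN; apply: eq_bigr => l _.
      by rewrite mul_mx_scalarE !mxE -mul_malgC monalgUN mulNr.
    by rewrite mulmxBl (mul1mx B) mulmx_suml.
  apply/matrixP => i j; apply: wcoefP => w; rewrite !mxE wcoefD wcoefN BE.
  rewrite summxE wcoef_sum.
  have lB l : wcoef ((map_mx (fun c => c%:MP) (C l) *m (letter K l)%:M *m B) i j) w
      = if w is l' :: w' then (if l == l' then (C l *m word_mx C w') i j else 0) else 0.
    rewrite -mulmxA; have := mwM _ _ _ (C l) ((letter K l)%:M *m B) w => /matrixP /(_ i j); rewrite mxE => ->.
    rewrite mxE; case: w => [|l' w].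
      by rewrite big1 // => k _; rewrite mul_scalar_mx !mxE wcoef_letterM mulr0.
    case: eqP => ll; last first.
      by rewrite big1 // => k _; rewrite mul_scalar_mx !mxE wcoef_letterM; case: eqP => // _; rewrite mulr0.
    by rewrite mxE; apply: eq_bigr => k _; rewrite mul_scalar_mx !mxE wcoef_letterM ll eqxx BE.
  rewrite (eq_bigr _ (fun l _ => lB l)); case: w lB => [|l w] lB.
    rewrite big1 // subr0 /= !mxE; case: eqP => _; last by rewrite wcoef0.
    by rewrite -mpolyC1E wcoefC.
  rewrite -big_mkcond big_pred1_eq /= subrr.
  by case: (i == j); [rewrite -mpolyC1E wcoefC | rewrite wcoef0].
have sysA : map_mx iota A = pev (automaton_family C).
  by rewrite map_pencil; congr pencil_eval; apply/funext => - [].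
have ABi : pev (automaton_family C) *m B^i = 1%:M by rewrite -sysA -map_mxM AB map_mx1.
have BAi : B^i *m pev (automaton_family C) = 1%:M by apply: square_inverse.
have [t tE] : exists t : 'rV[R]_n, t = map_mx (fun c => c%:MP) u *m B by exists (map_mx (fun c => c%:MP) u *m B).
have [s sE] : exists s : 'cV[R]_n, s = B *m map_mx (fun c => c%:MP) v by exists (B *m map_mx (fun c => c%:MP) v).
have ti : t^i = u^k *m B^i by rewrite tE map_mxM -map_kappa.
have si : s^i = B^i *m v^k by rewrite sE map_mxM -map_kappa.
(* The coefficients of [t] are the rows [u C_w], those of [s] the columns [C_w v]: independence of
   [t] and [s] is reachability and observability. *)
have tw i w : wcoef (t 0 i) w = (u *m word_mx C w) 0 i.
  rewrite tE; have := mwM _ _ _ u B w => /matrixP /(_ 0 i); rewrite mxE => ->.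
  by rewrite !mxE; apply: eq_bigr => k _; rewrite mxE BE.
have sw i w : wcoef (s i 0) w = (word_mx C w *m v) i 0.
  rewrite sE !mxE wcoef_sum; apply: eq_bigr => k _.
  by rewrite mxE wcoefMC BE.
exists n, u, C, v, t, s; split.
- split; first by rewrite ti -mulmxA BAi mulmx1.
    by rewrite si mulmxA ABi mul1mx.
  by exists B^i.
- rewrite si mulmxA -ti map_kappa -map_mxM; apply/matrixP => i j; rewrite !ord1 !mxE mulr1n.
  congr (iota _); apply: wcoefP => w; rewrite wcoef_sum.
  have := rec w => /matrixP /(_ 0 0); rewrite [RHS]mxE mulr1n => <-.
  by rewrite mxE; apply: eq_bigr => k _; rewrite mxE wcoefMC tw.
- move=> x; rewrite map_kappa -map_mxM => tx; apply: reach => w.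
  have : t *m map_mx (fun c => c%:MP) x = 0.
    by apply/matrixP => i j; apply: iota_inj; have /matrixP /(_ i j) := tx; rewrite !mxE rmorph0.
  move=> /matrixP /(_ 0 0) /(congr1 (fun q : R => wcoef q w)); rewrite !mxE wcoef_sum wcoef0 => H.
  apply/matrixP => i j; rewrite !ord1 [RHS]mxE -[RHS]H mxE; apply: eq_bigr => k _.
  by rewrite [in RHS]mxE wcoefMC tw.
- move=> e; rewrite map_kappa -map_mxM => es; apply: observe => w.
  have : map_mx (fun c => c%:MP) e *m s = 0.
    by apply/matrixP => i j; apply: iota_inj; have /matrixP /(_ i j) := es; rewrite !mxE rmorph0.
  move=> /matrixP /(_ 0 0) /(congr1 (fun q : R => wcoef q w)); rewrite !mxE wcoef_sum wcoef0 => H.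
  apply/matrixP => i j; rewrite !ord1 [RHS]mxE -[RHS]H -mulmxA mxE; apply: eq_bigr => k _.
  by rewrite [in RHS]mxE wcoefCM sw.
split.
  move=> D pD; split=> i w.
    rewrite tw => H; rewrite leqNgt; apply/negP => Dw; case/eqP: H.
    suff -> : u *m word_mx C w = 0 by rewrite mxE.
    apply: observe => w2; rewrite -[u *m _ *m _]mulmxA -word_mx_cat rec.
    rewrite (_ : wcoef p _ = 0) ?raddf0 //.
    by apply/eqP/negPn/negP => /pD; rewrite size_cat; lia.
  rewrite sw => H; rewrite leqNgt; apply/negP => Dw; case/eqP: H.
  suff -> : word_mx C w *m v = 0 by rewrite mxE.
  apply: reach => w2; rewrite mulmxA -[u *m _ *m _]mulmxA -word_mx_cat rec.
  rewrite (_ : wcoef p _ = 0) ?raddf0 //.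
  by apply/eqP/negPn/negP => /pD; rewrite size_cat; lia.
have top_cat w : w != [::] -> wcoef p (w0 ++ w) = 0 /\ wcoef p (w ++ w0) = 0.
  by case: w => // l w _; split; apply/eqP/negPn/negP => /w0max; rewrite size_cat /=; lia.
pose c := (wcoef p w0)^-1%:M *m (u *m word_mx C w0).
pose x := (word_mx C w0 *m v) *m (wcoef p w0)^-1%:M.
have cw w : c *m word_mx C w *m v = (if w is [::] then 1 else 0)%:M.
  rewrite /c -!mulmxA [word_mx C w0 *m _]mulmxA -word_mx_cat [u *m _]mulmxA rec -scalar_mxM.
  case: w => [|l w]; first by rewrite cats0 mulVf.
  by have [-> _] := top_cat (l :: w) isT; rewrite mulr0.
have xw w : u *m word_mx C w *m x = (if w is [::] then 1 else 0)%:M.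
  rewrite /x !mulmxA -[u *m _ *m _]mulmxA -word_mx_cat rec -scalar_mxM.
  case: w => [|l w]; first by rewrite mulfV.
  by have [_ ->] := top_cat (l :: w) isT; rewrite mul0r.
exists c, x; split.
- move=> l; apply: observe => w; have := cw (l :: w); rewrite /= mulmxA => ->.
  exact: raddf0.
- by have := cw [::]; rewrite /= mulmx1.
- move=> l; apply: reach => w; have := xw (w ++ [:: l]); rewrite word_mx_cat /= mulmx1 !mulmxA => ->.
  by case: (w) => [|? ?]; apply: raddf0.
- by have := xw [::]; rewrite /= mulmx1.
(* For nonconstant [p] the word [w0] is not empty, and [c x] is a multiple of the coefficient of
   [w0 ++ w0], which is too long. *)
move=> [w wn pw]; have w0n : w0 != [::].
  by apply: contra_neq wn => w00; have := w0max _ pw; rewrite w00 leqn0 => /nilP.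
rewrite /x mulmxA mulmxA cw; case: (w0) w0n => // l w' _.
by rewrite raddf0 mul0mx.
Qed.

End PolynomialSystems.

(** * Ranks *)

Section Ranks.
Variables (K : fieldType) (d : nat) (F : unitRingType) (iota : {rmorphism free_algebra K d -> F}).
Local Notation R := (free_algebra K d).
Hypothesis univ : universal_field_of_fractions iota.
Local Notation kap := (kappa iota).
Local Notation y := (gen iota).
Local Notation "A ^k" := (map_mx kap A) (at level 2, format "A ^k").
Local Notation "A ^i" := (map_mx iota A) (at level 2, format "A ^i").
Local Notation pev := (pencil_eval kap y).
Local Notation system := (linear_system kap y).
Local Notation has_rep := (has_linear_representation iota).
Local Notation rank := (rank iota).

Let F_field : GRing.field_axiom F. Proof. by case: univ. Qed.
Let central := kappa_central univ.
Let crit := free_field_criterion univ.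

Lemma has_repP f n : has_rep f n <->
  exists (M : option 'I_d -> 'M[K]_n) u v t s, system M u v t s /\ u^k *m s = f%:M.
Proof.
split=> [[u [A0 [A [v [B [AB BA fE]]]]]]|[M [u [v [t [s [[tA As [B [AB BA]]] fE]]]]]]].
  exists (pencil_family A0 A), u, v, (u^k *m B), (B *m v^k).
  rewrite map_pencil in AB BA; split; last by rewrite mulmxA fE.
  split; first by rewrite -mulmxA BA mulmx1.
    by rewrite mulmxA AB mul1mx.
  by exists B.
exists u, (M None), (fun l => M (Some l)), v, B.
have ME : pencil_family (M None) (fun l => M (Some l)) = M by apply/funext => - [].
rewrite map_pencil ME; split=> //; rewrite -fE -mulmxA; congr (_ *m _).
by rewrite -[s]mul1mx -BA -mulmxA As.
Qed.

Lemma has_rep_solution f n (M : option 'I_d -> 'M[K]_n) (u : 'rV_n) (v : 'cV_n) (s : 'cV_n) :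
  (forall z : 'cV_n, pev M *m z = 0 -> z = 0) -> pev M *m s = v^k -> u^k *m s = f%:M -> has_rep f n.
Proof.
move=> inj As us; have [B [AB BA]] := no_right_kernel_inverse F_field inj.
apply/has_repP; exists M, u, v, (u^k *m B), s; split=> //; split=> //.
  by rewrite -mulmxA BA mulmx1.
by exists B.
Qed.

Lemma system_inj n M u v t s : @linear_system _ _ kap _ y n M u v t s ->
  forall z : 'cV_n, pev M *m z = 0 -> z = 0.
Proof. by move=> [_ _ [B [_ BA]]] z Az; rewrite -[z]mul1mx -BA -mulmxA Az mulmx0. Qed.

(** The solution of the second system enters the first through [v u'], which puts [v (u' s')] on its
    right-hand side. *)
Definition product_family N n (M : option 'I_d -> 'M[K]_N) (M' : option 'I_d -> 'M[K]_n)
    (v : 'cV_N) (u' : 'rV_n) o :=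
  direct_sum M M' o + (if o is Some _ then 0 else block_mx 0 (- (v *m u')) 0 0).

Lemma pev_product N n (M : option 'I_d -> 'M[K]_N) (M' : option 'I_d -> 'M[K]_n)
    (v : 'cV_N) (u' : 'rV_n) :
  pev (product_family M M' v u') = block_mx (pev M) (- (v^k *m u'^k)) 0 (pev M').
Proof.
have -> : pev (product_family M M' v u') = pev (direct_sum M M') + (block_mx 0 (- (v *m u')) 0 0)^k.
  rewrite {1}/pencil_eval {1}/product_family (map_mxD kap).
  rewrite (eq_bigr (fun l => (direct_sum M M' (Some l))^k *m (y l)%:M)).
    by rewrite addrAC.
  by move=> l _; rewrite /product_family addr0.
by rewrite pev_direct_sum map_block_mx !map_mx0 map_mxN map_mxM add_block_mx !addr0 add0r.
Qed.

Lemma product_system N n M u v t s M' u' v' t' s' :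
  @linear_system _ _ kap _ y N M u v t s -> @linear_system _ _ kap _ y n M' u' v' t' s' ->
  system (product_family M M' v u') (row_mx u 0) (col_mx 0 v')
    (row_mx t ((t *m v^k) *m t')) (col_mx (s *m (u'^k *m s')) s').
Proof.
move=> sys sys'; have [tA As [B [AB BA]]] := sys; have [tA' As' [B' [AB' BA']]] := sys'.
split; rewrite pev_product.
- rewrite mul_row_block mulmx0 addr0 tA -[_ *m t' *m _]mulmxA tA' mulmxN mulmxA addNr.
  by rewrite map_row_mx map_mx0.
- rewrite mul_block_col mul0mx add0r As' [pev M *m _]mulmxA As mulNmx mulmxA addrN.
  by rewrite map_col_mx map_mx0.
exists (block_mx B (B *m (v^k *m u'^k) *m B') 0 B'); split.
  rewrite mulmx_block !mul0mx !mulmx0 !addr0 add0r AB AB' !mulmxA AB mul1mx mulNmx.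
  by rewrite subrr -scalar_mx_block.
rewrite mulmx_block !mul0mx !mulmx0 !addr0 add0r BA BA' -[_ *m B' *m _]mulmxA BA' mulmx1.
by rewrite mulmxN addNr -scalar_mx_block.
Qed.

Lemma has_rep_mul f g n m : has_rep f n -> has_rep g m -> has_rep (f * g) (n + m).
Proof.
move=> /has_repP [M [u [v [t [s [sys us]]]]]] /has_repP [M' [u' [v' [t' [s' [sys' us']]]]]].
apply/has_repP; do 5 eexists; split; first exact: product_system sys sys'.
by rewrite map_row_mx map_mx0 mul_row_col mul0mx addr0 mulmxA us us' -scalar_mxM.
Qed.

Lemma has_rep_sub f g n m : has_rep f n -> has_rep g m -> has_rep (f - g) (n + m).
Proof.
move=> /has_repP [M [u [v [t [s [sys us]]]]]] /has_repP [M' [u' [v' [t' [s' [sys' us']]]]]].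
apply/has_repP; do 5 eexists; split; first exact: linear_system_difference sys sys'.
by rewrite map_row_mx map_mxN mul_row_col mulNmx us us' raddfB.
Qed.

(** The bordered pencil with right-hand side [(0, 1)] has the solution [(s f^-1, - f^-1)]; the row
    [(0, -1)] undoes the sign. *)
Lemma has_rep_inv f n : f != 0 -> has_rep f n -> has_rep f^-1 (n + 1).
Proof.
move=> f0 /has_repP [M [u [v [t [s [sys us]]]]]]; have [tA As _] := sys.
have ff : f%:M *m f^-1%:M = 1%:M :> 'M_1 by rewrite -scalar_mxM (skew_mulrV F_field f0).
apply: (@has_rep_solution _ _ (bordered M u v) (row_mx 0 (- 1%:M)) (col_mx 0 1%:M)
  (col_mx (s *m f^-1%:M) (- f^-1%:M))).
- move=> z; rewrite pev_bordered -[z]vsubmxK; move: (usubmx z) (dsubmx z) => a b {z}.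
  rewrite mul_block_col mul0mx addr0 -col_mx0 => /eq_col_mx [Aa ua].
  have aE : a = - (s *m b).
    apply/eqP; rewrite -addr_eq0; apply/eqP; apply: (system_inj sys).
    by rewrite mulmxDr mulmxA As.
  have : f%:M *m b = 0 by rewrite -us -mulmxA -[s *m b]opprK -aE mulmxN ua oppr0.
  move=> fb; have b0 : b = 0.
    have ff' : f^-1%:M *m f%:M = 1%:M :> 'M_1 by rewrite -scalar_mxM (skew_mulVr F_field f0).
    by rewrite -[b]mul1mx -ff' -mulmxA fb mulmx0.
  by rewrite aE b0 mulmx0 oppr0 col_mx0.
- rewrite pev_bordered mul_block_col mul0mx addr0 mulmxA As mulmxN subrr mulmxA us ff.
  by rewrite map_col_mx map_mx0 map_mx1.
by rewrite map_row_mx map_mx0 map_mxN map_mx1 mul_row_col mul0mx add0r mulNmx mul1mx opprK.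
Qed.

Lemma has_rep_const c : has_rep (kap c) 1.
Proof.
apply: (@has_rep_solution _ _ (fun o => if o is None then 1%:M else 0) c%:M 1%:M 1%:M).
- move=> z; rewrite /pencil_eval map_mx1 big1 ?addr0 ?mul1mx // => l _.
  by rewrite map_mx0 mul0mx.
- rewrite /pencil_eval map_mx1 big1 ?addr0 ?mul1mx ?map_mx1 // => l _.
  by rewrite map_mx0 mul0mx.
by rewrite mulmx1 map_scalar_mx.
Qed.

Lemma good_has_rep p n u C v t s : @good_system _ _ _ iota p n u C v t s -> has_rep (iota p) n.
Proof.
by case=> sys us _ _ _; apply/has_repP; exists (automaton_family C), u, v, t^i, s^i.
Qed.

(** The represented elements form a division ring containing the image of the free algebra, and this
    image generates [F]. *)
Lemma has_rep_ex f : exists n, has_rep f n.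
Proof.
case: univ => _ _ gen_F _; apply/asboolP.
apply: (gen_F [pred f | `[< exists n, has_rep f n >]]) => /= [|p]; last first.
  rewrite inE; apply/asboolP; have [->|p0] := eqVneq p 0.
    by exists 1%N; have := has_rep_const 0; rewrite /kappa /= malgC0E.
  have [n [u [C [v [t [s /good_has_rep]]]]]] := good_system_exists univ p0.
  by exists n.
split=> [|a b /asboolP [n Hn] /asboolP [m Hm]|a b /asboolP [n Hn] /asboolP [m Hm]].
- by apply/asboolP; exists 1%N; rewrite -[1](rmorph1 kap); apply: has_rep_const.
- by apply/asboolP; exists (n + m)%N; apply: has_rep_sub.
apply/asboolP; have [->|b0] := eqVneq b 0.
  (* Here [a / b] is 0, represented as [a a - a a]. *)
  by rewrite invr0 mulr0 -(subrr (a * a)); eexists; apply: has_rep_sub; exact: (has_rep_mul Hn Hn).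
by exists (n + (m + 1))%N; apply: has_rep_mul => //; apply: has_rep_inv.
Qed.

Lemma rankP f : has_rep f (rank f) /\ forall n, has_rep f n -> (rank f <= n)%N.
Proof.
rewrite /Defs.rank; case: pselect => [ex|[]]; last first.
  by have [n Hn] := has_rep_ex f; exists n; apply/asboolP.
case: (ex_minnP ex) => n /asboolP Hn nmin; split=> // m Hm.
by apply: nmin; apply/asboolP.
Qed.

Lemma rank_inv f : f != 0 -> (rank f^-1 <= rank f + 1)%N.
Proof. by move=> f0; apply: (rankP _).2; apply: has_rep_inv => //; apply: (rankP f).1. Qed.

Lemma rank_gt0 f : f != 0 -> (0 < rank f)%N.
Proof.
move=> f0; case: (posnP (rank f)) => // r0; have [/has_repP] := rankP f.
rewrite r0 => - [M [u [v [t [s [_ us]]]]]] _; case/eqP: f0.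
have /matrixP /(_ 0 0) := us; rewrite mxE big_ord0 mxE eqxx mulr1n => <- //.
Qed.

(* By comparison with any other system, independence of t and s forces minimality. *)
Lemma rank_independent f n M u v t s : @linear_system _ _ kap _ y n M u v t s ->
  u^k *m s = f%:M -> row_independent kap t -> col_independent kap s -> rank f = n.
Proof.
move=> sys us tind sind; apply/eqP; rewrite eqn_leq; apply/andP; split.
  by apply: (rankP f).2; apply/has_repP; exists M, u, v, t, s.
have [/has_repP [M' [u' [v' [t' [s' [sys' us']]]]]] _] := rankP f.
have [|c [C [w [_ _ nC _]]]] := compare_systems F_field central crit sys' sys _ tind sind.
  by rewrite us us'.
exact: leq_trans nC (rank_leq_row C).
Qed.

Lemma good_rank p n u C v t s : @good_system _ _ _ iota p n u C v t s -> rank (iota p) = n.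
Proof. by case=> sys us tind sind _; apply: rank_independent sys us tind sind. Qed.

(** The space splits into the line of [v] and the kernel of [c]: [J] includes this kernel, and [P]
    projects onto it along [v]. *)
Lemma complement n (c : 'rV[K]_n.+1) (v : 'cV[K]_n.+1) : c *m v = 1%:M ->
  exists (J : 'M[K]_(n.+1, n)) (P : 'M[K]_(n, n.+1)),
    [/\ P *m J = 1%:M, J *m P = 1%:M - v *m c, c *m J = 0 & P *m v = 0].
Proof.
move=> cv; pose E := 1%:M - v *m c.
have cE : c *m E = 0 by rewrite mulmxBr mulmx1 mulmxA cv mul1mx subrr.
have Ev : E *m v = 0 by rewrite mulmxBl mul1mx -mulmxA cv mulmx1 subrr.
have EE : E *m E = E by rewrite {1}/E mulmxBl mul1mx -mulmxA cE mulmx0 subr0.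
have rE : \rank E = n.
  have rc : (\rank (v *m c) <= 1)%N by apply: leq_trans (mxrankM_maxr _ _) (rank_leq_row _).
  have : (\rank (1%:M : 'M[K]_n.+1) <= \rank E + \rank (v *m c))%N.
    by rewrite -[1%:M in X in (X <= _)%N](subrK (v *m c)); apply: mxrank_add.
  rewrite mxrank1; have : (\rank E < n.+1)%N; last by lia.
  rewrite ltn_neqAle rank_leq_row andbT; apply/negP => /row_fullP [D DE].
  have c0 : c = 0 by rewrite -[c]mulmx1 -(mulmx1C DE) mulmxA cE mul0mx.
  by move: cv; rewrite c0 mul0mx => /matrixP /(_ 0 0); rewrite !mxE eqxx => /eqP; rewrite eq_sym oner_eq0.
have [J [P [PJ JP]]] : exists (J : 'M[K]_(n.+1, n)) (P : 'M[K]_(n, n.+1)), P *m J = 1%:M /\ J *m P = E.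
  move: (col_base E) (row_base E) (mulmx_base E) (col_base_full E) (row_base_free E).
  rewrite rE => J P JP /row_fullP [D DJ] /row_freeP [D' PD']; exists J, P; split=> //.
  have H : J *m (P *m J) *m P = J *m P by rewrite mulmxA JP -mulmxA JP EE.
  have L : D *m (J *m (P *m J) *m P) *m D' = P *m J.
    by rewrite !mulmxA DJ mul1mx -!mulmxA PD' mulmx1.
  by rewrite -L H !mulmxA DJ mul1mx PD'.
exists J, P; split=> //.
  have : c *m J *m P *m J = 0 by rewrite -[c *m J *m P]mulmxA JP cE mul0mx.
  by rewrite -mulmxA PJ mulmx1.
have : P *m (J *m P *m v) = 0 by rewrite JP Ev mulmx0.
by rewrite !mulmxA PJ mul1mx.
Qed.

End Ranks.

(* The factors share the row (t v) u': eliminating the line spanned by v against c saves one dimension in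
   the product representation. *)
Lemma shared_line_product (T : nzRingType) m a b (A : 'M[T]_m) (A' : 'M[T]_b) (u t c : 'rV[T]_m)
    (v s : 'cV[T]_m) (u' t' : 'rV[T]_b) (v' s' : 'cV[T]_b) (J : 'M[T]_(m, a)) (P : 'M[T]_(a, m)) :
  t *m A = u -> A *m s = v -> c *m A = c -> c *m s = 1%:M -> c *m v = 1%:M ->
  t' *m A' = u' -> A' *m s' = v' ->
  J *m P = 1%:M - v *m c -> c *m J = 0 -> P *m v = 0 ->
  let N := block_mx (P *m A *m J) (P *m A *m (v *m u')) 0 A' in
  let S := col_mx (P *m s *m (u' *m s')) s' in
  [/\ row_mx (t *m J) ((t *m v) *m t') *m N = row_mx (u *m J) (u *m v *m u'),
      N *m S = col_mx 0 v' &
      row_mx (u *m J) (u *m v *m u') *m S = (u *m s) *m (u' *m s')].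
Proof.
move=> tA As cA cs cv tA' As' JP cJ Pv /=; split.
- have E : t *m J *m P *m A = u - (t *m v) *m c.
    by rewrite -(mulmxA t) JP mulmxBr mulmxBl mulmx1 tA mulmxA -[t *m v *m c *m A]mulmxA cA.
  rewrite mul_row_block mulmx0 addr0 !mulmxA E !mulmxBl -[t *m v *m c *m J]mulmxA cJ mulmx0 subr0.
  by rewrite -[t *m v *m c *m v]mulmxA cv mulmx1 -[t *m v *m t' *m A']mulmxA tA' subrK.
- rewrite mul_block_col mul0mx add0r As'; congr (col_mx _ _).
  have E : P *m A *m J *m P *m s = - (P *m A *m v).
    rewrite -[P *m A *m J *m P]mulmxA JP mulmxBr mulmxBl mulmx1 -[P *m A *m s]mulmxA As Pv sub0r.
    by rewrite -!mulmxA cs mulmx1.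
  by rewrite !mulmxA E !mulNmx addNr.
rewrite mul_row_col !mulmxA -[u *m J *m P]mulmxA JP mulmxBr mulmx1 !mulmxBl.
by rewrite -[u *m (v *m c) *m s]mulmxA -[v *m c *m s]mulmxA cs mulmx1 subrK.
Qed.

(** * Ranks of products and inverses of polynomials *)

Section Factors.
Variables (K : fieldType) (d : nat) (F : unitRingType) (iota : {rmorphism free_algebra K d -> F}).
Local Notation R := (free_algebra K d).
Hypothesis univ : universal_field_of_fractions iota.
Local Notation kap := (kappa iota).
Local Notation y := (gen iota).
Local Notation "A ^k" := (map_mx kap A) (at level 2, format "A ^k").
Local Notation "A ^i" := (map_mx iota A) (at level 2, format "A ^i").
Local Notation pev := (pencil_eval kap y).
Local Notation system := (linear_system kap y).
Local Notation rank := (rank iota).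
Local Notation good p n u C v t s := (@good_system K d F iota p n u C v t s).
Local Notation mc := (map_mx (fun c : K => c%:MP : R)).

Let F_field : GRing.field_axiom F. Proof. by case: univ. Qed.
Let iota_inj : injective iota. Proof. by case: univ. Qed.
Let central := kappa_central univ.

Lemma low_multiple_const_r (p a : R) w0 : wcoef p w0 != 0 -> bounded_degree p (size w0) ->
  bounded_degree (p * a) (size w0) -> a = (wcoef a [::])%:MP.
Proof.
move=> pw0 pD paD; have [->|/top_word [w1 aw1 w1max]] := eqVneq a 0.
  by rewrite wcoef0 malgC0E.
have : wcoef (p * a) (w0 ++ w1) != 0 by rewrite wcoefM_top // mulf_neq0.
move=> /paD; rewrite size_cat => s1; have {s1} /nilP w10 : nilp w1 by rewrite /nilp; lia.
apply: wcoefP => w; rewrite wcoefC; case: w => [//|l w].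
by apply/eqP/negPn/negP => /w1max; rewrite w10.
Qed.

Lemma low_multiple_const_l (p a : R) w0 : wcoef p w0 != 0 -> bounded_degree p (size w0) ->
  bounded_degree (a * p) (size w0) -> a = (wcoef a [::])%:MP.
Proof.
move=> pw0 pD paD; have [->|/top_word [w1 aw1 w1max]] := eqVneq a 0.
  by rewrite wcoef0 malgC0E.
have : wcoef (a * p) (w1 ++ w0) != 0 by rewrite wcoefM_top // mulf_neq0.
move=> /paD; rewrite size_cat => s1; have {s1} /nilP w10 : nilp w1 by rewrite /nilp; lia.
apply: wcoefP => w; rewrite wcoefC; case: w => [//|l w].
by apply/eqP/negPn/negP => /w1max; rewrite w10.
Qed.

Lemma bounded_degreeN (p : R) D : bounded_degree p D -> bounded_degree (- p) D.
Proof. by move=> pD w; rewrite wcoefN oppr_eq0; apply: pD. Qed.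

Lemma bounded_degree_sum I (r : seq I) (f : I -> R) D :
  (forall i, bounded_degree (f i) D) -> bounded_degree (\sum_(i <- r) f i) D.
Proof.
move=> fD; elim: r => [|i r IH] w; first by rewrite big_nil wcoef0 eqxx.
rewrite big_cons wcoefD; have [->|/fD //] := eqVneq (wcoef (f i) w) 0.
by rewrite add0r; apply: IH.
Qed.

Lemma bounded_degree_row n (t : 'rV[R]_n) (x : 'cV[K]_n) D :
  (forall i, bounded_degree (t 0 i) D) -> bounded_degree ((t *m mc x) 0 0) D.
Proof.
move=> tD; rewrite mxE; apply: bounded_degree_sum => i w; rewrite mxE.
by rewrite wcoefMC mulf_eq0 negb_or => /andP [+ _]; apply: tD.
Qed.

Lemma bounded_degree_col n (s : 'cV[R]_n) (e : 'rV[K]_n) D :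
  (forall i, bounded_degree (s i 0) D) -> bounded_degree ((mc e *m s) 0 0) D.
Proof.
move=> sD; rewrite mxE; apply: bounded_degree_sum => i w; rewrite mxE.
by rewrite wcoefCM mulf_eq0 negb_or => /andP [_]; apply: sD.
Qed.

Lemma iota_mx11 (A : 'M[R]_1) : A^i = (iota (A 0 0))%:M.
Proof. by apply/matrixP => i j; rewrite !ord1 !mxE mulr1n. Qed.

Lemma scalar_kappa m n c (A : 'M[K]_(m, n)) : A^k *m (kap c)%:M = (c *: A)^k.
Proof. by rewrite -(map_scalar_mx kap) -(map_mxM kap) mul_mx_scalar. Qed.

Lemma kappa_complement m n (J : 'M[K]_(m, n)) P (v : 'cV_m) c :
  J *m P = 1%:M - v *m c -> J^k *m P^k = 1%:M - v^k *m c^k.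
Proof. by move=> JP; rewrite -(map_mxM kap J) JP (map_mxB kap) (map_mx1 kap) (map_mxM kap v). Qed.

Lemma pev_sandwich N n (P : 'M[K]_(n, N)) (Q : 'M[K]_(N, n)) (M : option 'I_d -> 'M[K]_N) :
  pev (fun o => P *m M o *m Q) = P^k *m pev M *m Q^k.
Proof.
rewrite /pencil_eval mulmxDr mulmxDl !map_mxM; congr (_ + _).
rewrite mulmx_sumr mulmx_suml; apply: eq_bigr => l _.
by rewrite !map_mxM -!mulmxA (central_scalar central).
Qed.

Lemma good_facts p n u C v t s : good p n u C v t s -> exists c x,
  [/\ c *m v = 1%:M, c^k *m pev (automaton_family C) = c^k, c^k *m s^i = 1%:M &
  [/\ u *m x = 1%:M, pev (automaton_family C) *m x^k = x^k, t^i *m x^k = 1%:M &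
      (exists2 w, w != [::] & wcoef p w != 0) -> c *m x = 0]].
Proof.
move=> [[tA As _] us _ _ [_ [c [x [cC cv Cx ux cx]]]]]; exists c, x.
have cA := fixed_row iota cC; have Ax := fixed_col univ Cx.
split=> //; first by rewrite -cA -mulmxA As -map_mxM cv map_mx1.
by split=> //; rewrite -Ax mulmxA tA -map_mxM ux map_mx1.
Qed.

(** By [rank_independent] only the independence of the solutions is at stake. A relation for the row
    amounts to [p a1 = - a0] with [a0] of degree at most that of [p]; hence [a1] is constant, and
    the independence known for [p] and [h] applies. The column is treated symmetrically with [h]. *)
Lemma rank_product p h a b u C v t s u' C' v' t' s' :
  p != 0 -> h != 0 -> good p a.+1 u C v t s -> good h b u' C' v' t' s' ->
  rank (iota (p * h)) = (a + b)%N.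
Proof.
move=> p0 h0 gp gh.
have [c [_ [cv cA cs _]]] := good_facts gp.
have [sys us tind sind [deg _]] := gp; have [sys' us' tind' sind' [deg' _]] := gh.
have [tA As _] := sys; have [tA' As' _] := sys'.
have tv : t^i *m v^k = (iota p)%:M by rewrite -(linear_systemM sys).
have [J [P [PJ JP cJ Pv]]] := complement cv.
pose Lm : 'M[K]_(a + b, a.+1 + b) := block_mx P 0 0 1%:M.
pose Rm : 'M[K]_(a.+1 + b, a + b) := block_mx J (v *m u') 0 1%:M.
pose M o := Lm *m direct_sum (automaton_family C) (automaton_family C') o *m Rm.
set A := pev (automaton_family C) in tA As cA; set A' := pev (automaton_family C') in tA' As'.
have ME : pev M = block_mx (P^k *m A *m J^k) (P^k *m A *m (v^k *m u'^k)) 0 A'.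
  rewrite pev_sandwich pev_direct_sum /Lm /Rm !map_block_mx !map_mx0 !map_mx1 map_mxM.
  by rewrite !mulmx_block !mul0mx !mulmx0 !addr0 !add0r !mulmx1 mul1mx !mul0mx addr0 add0r.
have kJP : J^k *m P^k = 1%:M - v^k *m c^k.
  exact: kappa_complement JP.
have kcv : c^k *m v^k = 1%:M by rewrite -map_mxM cv map_mx1.
have kcJ : c^k *m J^k = 0 by rewrite -map_mxM cJ map_mx0.
have kPv : P^k *m v^k = 0 by rewrite -map_mxM Pv map_mx0.
have kPJ : P^k *m J^k = 1%:M by rewrite -map_mxM PJ map_mx1.
(* The block matrix is triangular; in its first block [c A = c] and [c J = 0] turn a kernel vector
   [z1] into the kernel vector [J z1] of [A]. *)
have inj : forall z : 'cV_(a + b), pev M *m z = 0 -> z = 0.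
  move=> z; rewrite ME -[z]vsubmxK; move: (usubmx z) (dsubmx z) => z1 z2 {z}.
  rewrite mul_block_col mul0mx add0r -col_mx0 => /eq_col_mx [E1 E2].
  have z20 := system_inj sys' E2; move: E1; rewrite z20 mulmx0 addr0 => E1.
  suff -> : z1 = 0 by rewrite !col_mx0.
  suff Jz : J^k *m z1 = 0 by rewrite -[z1]mul1mx -kPJ -mulmxA Jz mulmx0.
  apply: (system_inj sys); rewrite -/A.
  have : J^k *m (P^k *m A *m J^k *m z1) = 0 by rewrite E1 mulmx0.
  rewrite !mulmxA kJP !mulmxBl mul1mx -[v^k *m c^k *m A]mulmxA cA.
  by rewrite -[v^k *m c^k *m J^k]mulmxA kcJ mulmx0 mul0mx subr0.
have [B [AB BA]] := no_right_kernel_inverse F_field inj.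
pose ts := row_mx (t^i *m J^k) ((iota p)%:M *m t'^i).
pose ss := col_mx (P^k *m s^i *m (iota h)%:M) s'^i.
have [tM Ms uMs] := shared_line_product tA As cA cs kcv tA' As' kJP kcJ kPv.
have sysM : system M (row_mx (u *m J) (u *m v *m u')) (col_mx 0 v') ts ss.
  rewrite /ts /ss -tv -us'; split; last by exists B.
    by rewrite ME tM map_row_mx !map_mxM.
  by rewrite ME Ms map_col_mx map_mx0.
apply: (rank_independent univ sysM).
- by rewrite /ss -us' map_row_mx !map_mxM uMs us us' (rmorphM iota) scalar_mxM.
- move=> x; rewrite -[x]vsubmxK; move: (usubmx x) (dsubmx x) => al be {x}.
  rewrite map_col_mx mul_row_col => E.
  have [w0 pw0 w0max] := top_word p0.
  pose a0 := (t *m mc (J *m al)) 0 0; pose a1 := (t' *m mc be) 0 0.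
  have a0E : t^i *m J^k *m al^k = (iota a0)%:M.
    by rewrite /a0 -iota_mx11 (map_mxM iota) -map_kappa (map_mxM kap) mulmxA.
  have a1E : t'^i *m be^k = (iota a1)%:M by rewrite /a1 -iota_mx11 (map_mxM iota) -map_kappa.
  have pa : p * a1 = - a0.
    apply: iota_inj; rewrite rmorphM rmorphN; apply/eqP; rewrite -addr_eq0 addrC; apply/eqP.
    move: E; rewrite a0E -mulmxA a1E -scalar_mxM -raddfD => /matrixP /(_ 0 0).
    by rewrite !mxE mulr1n.
  have a0D : bounded_degree a0 (size w0).
    by apply: bounded_degree_row; case: (deg (size w0)).
  have a1c : a1 = (wcoef a1 [::])%:MP.
    by apply: (low_multiple_const_r pw0 w0max); rewrite pa; apply: bounded_degreeN.
  move: (wcoef a1 [::]) a1c => ka a1c.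
  (* With [a1] equal to the constant [ka], the relation becomes one among the entries of [t] alone;
     applying [c] then gives [ka = 0]. *)
  have Jv : J *m al + ka *: v = 0.
    apply: tind; rewrite map_mxD map_mxM -scalar_kappa mulmxDr !mulmxA tv -[RHS]E.
    by rewrite -[(iota p)%:M *m _ *m _]mulmxA a1E a1c.
  have ka0 : ka = 0.
    have := congr1 (mulmx c) Jv; rewrite mulmxDr mulmxA cJ mul0mx add0r -scalemxAr cv mulmx0.
    by move=> /matrixP /(_ 0 0); rewrite !mxE mulr1.
  have be0 : be = 0 by apply: tind'; rewrite a1E a1c ka0 malgC0E rmorph0 raddf0.
  have al0 : al = 0.
    by rewrite -[al]mul1mx -PJ -mulmxA; move: Jv; rewrite ka0 scale0r addr0 => ->; rewrite mulmx0.
  by rewrite al0 be0 col_mx0.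
move=> e; rewrite -[e]hsubmxK; move: (lsubmx e) (rsubmx e) => ga be {e}.
rewrite map_row_mx mul_row_col => E.
have [w0 hw0 w0max] := top_word h0.
pose a0 := (mc be *m s') 0 0; pose a1 := (mc (ga *m P) *m s) 0 0.
have a0E : be^k *m s'^i = (iota a0)%:M by rewrite /a0 -iota_mx11 (map_mxM iota) -map_kappa.
have a1E : (ga *m P)^k *m s^i = (iota a1)%:M by rewrite /a1 -iota_mx11 (map_mxM iota) -map_kappa.
have ah : a1 * h = - a0.
  apply: iota_inj; rewrite rmorphM rmorphN; apply/eqP; rewrite -addr_eq0; apply/eqP.
  move: E; rewrite a0E !mulmxA -map_mxM a1E -scalar_mxM -raddfD => /matrixP /(_ 0 0).
  by rewrite !mxE mulr1n.
have a0D : bounded_degree a0 (size w0).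
  by apply: bounded_degree_col; case: (deg' (size w0)).
have a1c : a1 = (wcoef a1 [::])%:MP.
  by apply: (low_multiple_const_l hw0 w0max); rewrite ah; apply: bounded_degreeN.
move: (wcoef a1 [::]) a1c => ka a1c.
have gP : ga *m P - ka *: c = 0.
  apply: sind; rewrite map_mxB -scalar_kappa mulmxBl a1E a1c (central_scalar central) -mulmxA cs.
  by rewrite mulmx1 subrr.
have ka0 : ka = 0.
  have := congr1 (mulmx^~ v) gP; rewrite mulmxBl -mulmxA Pv mulmx0 sub0r -scalemxAl cv mul0mx.
  by move=> /matrixP /(_ 0 0); rewrite !mxE mulr1 => /eqP; rewrite oppr_eq0 => /eqP.
have be0 : be = 0.
  apply: sind'; move: E; rewrite !mulmxA -map_mxM a1E a1c ka0 malgC0E rmorph0 raddf0 mul0mx add0r.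
  by [].
have ga0 : ga = 0.
  by rewrite -[ga]mulmx1 -PJ mulmxA; move: gP; rewrite ka0 scale0r subr0 => ->; rewrite mul0mx.
by rewrite ga0 be0 row_mx0.
Qed.

(* Deleting from the pencil of p the line v against c and the line x against u leaves a representation of p^-1,
   whose solution is s p^-1 - x. *)
Lemma rank_inverse p n u C v t s : good p n.+1 u C v t s ->
  (exists2 w, w != [::] & wcoef p w != 0) -> (rank (iota p)^-1 <= n)%N.
Proof.
move=> gp ncst; have [c [x [cv cA cs [ux Ax tx /(_ ncst) cx]]]] := good_facts gp.
have [sys us _ _ _] := gp; have [tA As _] := sys.
have p0 : iota p != 0.
  rewrite -(rmorph0 iota) (inj_eq iota_inj); case: ncst => w _.
  by apply: contra_neq => ->; rewrite wcoef0.
have [J [P [PJ JP cJ Pv]]] := complement cv.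
have [J' [P' [PJ' JP' P'x uJ']]] : exists (J' : 'M[K]_(n.+1, n)) (P' : 'M[K]_(n, n.+1)),
    [/\ P' *m J' = 1%:M, J' *m P' = 1%:M - x *m u, P' *m x = 0 & u *m J' = 0].
  by have [J' [P' [? ? ? ?]]] := complement ux; exists J', P'.
have [A AE] : exists A, A = pev (automaton_family C) by exists (pev (automaton_family C)).
rewrite -AE in tA As cA Ax.
have kJP : J^k *m P^k = 1%:M - v^k *m c^k.
  exact: kappa_complement JP.
have kJP' : J'^k *m P'^k = 1%:M - x^k *m u^k.
  exact: kappa_complement JP'.
pose z0 := s^i *m (iota p)^-1%:M - x^k.
have uz0 : u^k *m z0 = 0.
  rewrite mulmxBr mulmxA us -(scalar_mxM _ (iota p)) (skew_mulrV F_field p0).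
  by rewrite -(map_mxM kap) ux (map_mx1 kap) subrr.
have Jz0 : J'^k *m (P'^k *m z0) = z0.
  by rewrite mulmxA kJP' mulmxBl mul1mx -mulmxA uz0 mulmx0 subr0.
apply: (rankP univ _).2.
apply: (has_rep_solution univ (M := fun o => P *m automaton_family C o *m J')
  (u := c *m J') (v := - (P *m x)) (s := P'^k *m z0)).
- move=> z; rewrite pev_sandwich -AE -!mulmxA => E.
  have Jz : A *m (J'^k *m z) = v^k *m (c^k *m (J'^k *m z)).
    apply/eqP; rewrite -subr_eq0 -cA -(mulmxA c^k) (mulmxA v^k) -[X in X - _]mul1mx -mulmxBl.
    by rewrite -kJP -mulmxA E mulmx0.
  pose g := c^k *m (J'^k *m z).
  have Js : J'^k *m z = s^i *m g.
    apply/eqP; rewrite -subr_eq0; apply/eqP; apply: (system_inj sys); rewrite -AE.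
    by rewrite mulmxBr Jz (mulmxA A) As subrr.
  have pg : (iota p)%:M *m g = 0.
    by rewrite -us -mulmxA -Js mulmxA -map_mxM uJ' map_mx0 mul0mx.
  have g0 : g = 0.
    by rewrite -[g]mul1mx -(skew_mulVr F_field p0) (scalar_mxM _ (iota p)^-1) -mulmxA pg mulmx0.
  by rewrite -[z]mul1mx -(map_mx1 kap) -PJ' map_mxM -mulmxA Js g0 !mulmx0.
- rewrite pev_sandwich -AE -!mulmxA Jz0 mulmxBr Ax (mulmxA A) As mulmxBr (mulmxA P^k).
  by rewrite -!(map_mxM kap P) Pv (map_mx0 kap) mul0mx sub0r (map_mxN kap).
(* [c z0 = (iota p)^-1 - c x], and [c x = 0] because [p] is not constant. *)
rewrite map_mxM -mulmxA Jz0 mulmxBr mulmxA cs mul1mx -map_mxM cx map_mx0 subr0 //.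
Qed.

End Factors.

(** * Factors of polynomials *)

Section Divisibility.
Variables (K : fieldType) (d : nat) (F : unitRingType) (iota : {rmorphism free_algebra K d -> F}).
Local Notation R := (free_algebra K d).
Hypothesis univ : universal_field_of_fractions iota.
Local Notation kap := (kappa iota).
Local Notation y := (gen iota).
Local Notation "A ^k" := (map_mx kap A) (at level 2, format "A ^k").
Local Notation "A ^i" := (map_mx iota A) (at level 2, format "A ^i").
Local Notation system := (linear_system kap y).
Local Notation rank := (rank iota).
Local Notation mc := (map_mx (fun c : K => c%:MP : R)).

Let F_field : GRing.field_axiom F. Proof. by case: univ. Qed.
Let iota_inj : injective iota. Proof. by case: univ. Qed.
Let central := kappa_central univ.
Let crit := free_field_criterion univ.

Lemma iota_neq0 p : p != 0 -> iota p != 0.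
Proof. by rewrite -(rmorph0 iota) (inj_eq iota_inj). Qed.

Lemma skew_mul_neq0 (a b : F) : a != 0 -> b != 0 -> a * b != 0.
Proof.
move=> a0 b0; apply/eqP => ab; have [/eqP|/eqP] := skew_mul_eq0 F_field ab.
  by rewrite (negbTE a0).
by rewrite (negbTE b0).
Qed.

Lemma rank_product_leq p h : p != 0 -> h != 0 ->
  (rank (iota p) + rank (iota h) <= rank (iota (p * h)%R) + 1)%N.
Proof.
move=> p0 h0; have [n [u [C [v [t [s gp]]]]]] := good_system_exists univ p0.
have [m [u' [C' [v' [t' [s' gh]]]]]] := good_system_exists univ h0.
have n0 := rank_gt0 univ (iota_neq0 p0).
rewrite (good_rank univ gp) (good_rank univ gh) in n0 *.
case: n u C v t s gp n0 => // n u C v t s gp _.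
by rewrite (rank_product univ p0 h0 gp gh); lia.
Qed.

Lemma rank_inverse_const p : (forall w, w != [::] -> wcoef p w = 0) -> (rank (iota p)^-1 <= 1)%N.
Proof.
move=> pc; have -> : p = (wcoef p [::])%:MP.
  by apply: wcoefP => w; rewrite wcoefC; case: w => // l w; rewrite pc.
apply: (rankP univ _).2; rewrite -(kappaE iota) -(fmorphV kap).
exact: has_rep_const.
Qed.

Lemma rank_inverse_leq p : p != 0 ->
  (rank (iota p)^-1 + 1 <= rank (iota p))%N \/ (rank (iota p)^-1 <= 1)%N.
Proof.
move=> p0; have n0 := rank_gt0 univ (iota_neq0 p0).
have [[w wn pw]|pc] := pselect (exists2 w, w != [::] & wcoef p w != 0); [left|right].
  have [n [u [C [v [t [s gp]]]]]] := good_system_exists univ p0.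
  rewrite (good_rank univ gp) in n0 *; case: n u C v t s gp n0 => // n u C v t s gp _.
  by rewrite addn1 ltnS; apply: (rank_inverse univ gp); exists w.
apply: rank_inverse_const => w wn; apply/eqP/negPn/negP => pw.
by apply: pc; exists w.
Qed.

(** For nonconstant factors each inversion gains one: [rank p^-1 + rank h^-1] is at most
    [rank p + rank h - 2], hence at most [rank (p h) - 1], hence at most [rank (p h)^-1]. The
    inverse of a constant has rank at most 1, and positivity of the ranks makes up for the missing
    gain. *)
Lemma rank_inverse_product_leq p h : p != 0 -> h != 0 ->
  (rank (iota p)^-1 + rank (iota h)^-1 <= rank (iota (p * h)%R)^-1 + 1)%N.
Proof.
move=> p0 h0; have ph0 : iota (p * h) != 0.
  by rewrite (rmorphM iota); apply: skew_mul_neq0; apply: iota_neq0.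
have phV0 : (iota (p * h))^-1 != 0 by rewrite invr_eq0.
have := rank_product_leq p0 h0; have := rank_inv univ phV0; rewrite invrK.
have := rank_gt0 univ phV0.
have := rank_gt0 univ (iota_neq0 p0); have := rank_gt0 univ (iota_neq0 h0).
by have := rank_inverse_leq p0; have := rank_inverse_leq h0; lia.
Qed.

Lemma map_mc m n l (A : 'M[K]_(m, n)) (B : 'M[R]_(n, l)) : A^k *m B^i = (mc A *m B)^i.
Proof. by rewrite (map_mxM iota) -map_kappa. Qed.

Lemma map_mcr m n l (A : 'M[R]_(m, n)) (B : 'M[K]_(n, l)) : A^i *m B^k = (A *m mc B)^i.
Proof. by rewrite (map_mxM iota) -map_kappa. Qed.

Lemma scalar_image (g : F) (A : 'M[R]_1) : A^i = g%:M -> exists p, g = iota p.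
Proof. by move=> /matrixP /(_ 0 0); rewrite !mxE mulr1n => <-; exists (A 0 0). Qed.

(** The comparison with the automaton of [h] needs a hull of dimension at most [rank h]. The size
    exceeds this by at most 1, so a single constant relation [e s = 0] is enough. *)
Lemma poly_solution N M u v t s h : @linear_system _ _ kap _ y N M u v t s ->
  u^k *m s = (iota h)%:M -> h != 0 -> (N <= rank (iota h) + 1)%N ->
  (exists2 e : 'rV[K]_N, e != 0 & e^k *m s = 0) \/ (N <= rank (iota h))%N ->
  exists s0 : 'cV[R]_N, s = s0^i.
Proof.
move=> sys us h0 Nh small; have [n [uh [C [vh [th [sh gh]]]]]] := good_system_exists univ h0.
have nE := good_rank univ gh; have [sysh ush thind shind _] := gh.
have us2 : u^k *m s = uh^k *m sh^i by rewrite us ush.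
have [c [D [w [sE wind _ Phi]]]] := compare_systems F_field central crit sys sysh us2 thind shind.
have [|Ph ->] := Phi; last by exists (mc Ph *m sh); rewrite map_mc.
have DN := rank_leq_row D.
case: small => [[e e0 es]|]; last by rewrite nE; lia.
have : (\rank D < N)%N; last by rewrite nE in Nh; lia.
rewrite ltn_neqAle DN andbT; apply: contra e0 => /row_freeP [D' DD'].
have eD : e *m D = 0 by apply: wind; rewrite (map_mxM kap) -mulmxA -sE.
by rewrite -[e]mulmx1 -DD' mulmxA eD mul0mx.
Qed.

Lemma poly_cosolution N M u v t s h : @linear_system _ _ kap _ y N M u v t s ->
  u^k *m s = (iota h)%:M -> h != 0 -> (N <= rank (iota h) + 1)%N ->
  (exists2 x : 'cV[K]_N, x != 0 & t *m x^k = 0) ->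
  exists t0 : 'rV[R]_N, t = t0^i.
Proof.
move=> sys us h0 Nh [x x0 tx]; have [n [uh [C [vh [th [sh gh]]]]]] := good_system_exists univ h0.
have nE := good_rank univ gh; have [sysh ush thind shind _] := gh.
have us2 : u^k *m s = uh^k *m sh^i by rewrite us ush.
have [c [D [w [tE wind _ Phi]]]] := compare_systems_row F_field central crit sys sysh us2 thind shind.
have [|Ph ->] := Phi; last by exists (th *m mc Ph); rewrite map_mcr.
have DN := rank_leq_col D.
have : (\rank D < N)%N; last by rewrite nE in Nh; lia.
rewrite ltn_neqAle DN andbT; apply: contra x0 => /row_fullP [D' DD'].
have Dx : D *m x = 0 by apply: wind; rewrite (map_mxM kap) mulmxA -tE.
by rewrite -[x]mul1mx -DD' -mulmxA Dx mulmx0.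
Qed.

(** * Recovering a factor from the product representation *)

Section PolynomialProduct.
Variables (f g : F) (h : R) (n m : nat).
Hypotheses (h0 : h != 0) (fg : f * g = iota h) (nm : (n + m <= rank (iota h) + 1)%N).
Variables (M : option 'I_d -> 'M[K]_n) (u : 'rV[K]_n) (v : 'cV[K]_n) (t : 'rV[F]_n) (s : 'cV[F]_n).
Variables (M' : option 'I_d -> 'M[K]_m) (u' : 'rV[K]_m) (v' : 'cV[K]_m) (t' : 'rV[F]_m) (s' : 'cV[F]_m).
Hypotheses (sys : system M u v t s) (us : u^k *m s = f%:M).
Hypotheses (sys' : system M' u' v' t' s') (us' : u'^k *m s' = g%:M).

Let big_sys : system (product_family M M' v u') (row_mx u 0) (col_mx 0 v')
  (row_mx t (f%:M *m t')) (col_mx (s *m g%:M) s').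
Proof. by rewrite -us -us' (linear_systemM sys); apply: product_system. Qed.

Let big_us : (row_mx u 0)^k *m col_mx (s *m g%:M) s' = (iota h)%:M.
Proof.
by rewrite map_row_mx (map_mx0 kap) mul_row_col mul0mx addr0 mulmxA us -(scalar_mxM _ f) fg.
Qed.

(** The lower block of the solution is [s'], and [g = u' s']. *)
Lemma right_factor_poly :
  (exists2 e : 'rV[K]_(n + m), e != 0 & e^k *m col_mx (s *m g%:M) s' = 0) \/
  (n + m <= rank (iota h))%N -> exists p, g = iota p.
Proof.
move=> small; have [s0 s0E] := poly_solution big_sys big_us h0 nm small.
apply: (@scalar_image _ (mc u' *m dsubmx s0)); rewrite -map_mc -us'; congr (_ *m _).
by have := congr1 dsubmx s0E; rewrite col_mxKd -map_dsubmx.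
Qed.

Lemma left_factor_poly :
  (exists2 x : 'cV[K]_(n + m), x != 0 & row_mx t (f%:M *m t') *m x^k = 0) ->
  exists p, f = iota p.
Proof.
move=> small; have [t0 t0E] := poly_cosolution big_sys big_us h0 nm small.
apply: (@scalar_image _ (lsubmx t0 *m mc v)); rewrite -map_mcr -us (linear_systemM sys).
by congr (_ *m _); have := congr1 lsubmx t0E; rewrite row_mxKl -map_lsubmx.
Qed.

Lemma some_factor_poly : (exists p, f = iota p) \/ (exists p, g = iota p).
Proof.
have [?|sind] := pselect (exists2 e : 'rV[K]_(n + m), e != 0 & e^k *m col_mx (s *m g%:M) s' = 0).
  by right; apply: right_factor_poly; left.
have [?|tind] := pselect (exists2 x : 'cV[K]_(n + m), x != 0 & row_mx t (f%:M *m t') *m x^k = 0).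
  by left; apply: left_factor_poly.
right; apply: right_factor_poly; right.
rewrite (rank_independent univ big_sys big_us) // => z zE.
  by apply: contra_notP tind => /eqP z0; exists z.
by apply: contra_notP sind => /eqP z0; exists z.
Qed.
End PolynomialProduct.

Lemma poly_factors f g h : f != 0 -> g != 0 -> h != 0 -> f * g = iota h ->
  (rank f + rank g <= rank (iota h) + 1)%N ->
  (exists p, f = iota p) /\ (exists p, g = iota p).
Proof.
move=> f0 g0 h0 fg fgh; have [/has_repP [M [u [v [t [s [sys us]]]]]] _] := rankP univ f.
have [/has_repP [M' [u' [v' [t' [s' [sys' us']]]]]] _] := rankP univ g.
have [[p pE]|[p pE]] := some_factor_poly h0 fg fgh sys us sys' us'; split; try by exists p.
- have p0 : p != 0 by apply: contra_neq f0 => p0; rewrite pE p0 (rmorph0 iota).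
  (* A minimal automaton of [p] replaces the given system of [f]; as its size is [rank f], the bound
     on the sizes persists. *)
  have [n [up [C [vp [tp [sp gp]]]]]] := good_system_exists univ p0.
  have [c [_ [_ _ cs _]]] := good_facts univ gp; have [sysp usp _ _ _] := gp.
  rewrite -pE in usp; have nE := good_rank univ gp; rewrite -pE in nE.
  rewrite nE in fgh; apply: (right_factor_poly h0 fg fgh sysp usp sys' us').
  (* [c] takes the value 1 on the solution of the automaton, so the two blocks contribute [g] and
     [- g]. *)
  left; exists (row_mx c (- u')).
    apply/eqP; rewrite -row_mx0 => /eq_row_mx [c0 _].
    by move: cs; rewrite c0 (map_mx0 kap) mul0mx => /matrixP /(_ 0 0) /eqP; rewrite !mxE eqxx eq_sym oner_eq0.
  by rewrite map_row_mx (map_mxN kap) mul_row_col mulmxA cs mul1mx mulNmx us' subrr.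
have p0 : p != 0 by apply: contra_neq g0 => p0; rewrite pE p0 (rmorph0 iota).
have [n [up [C [vp [tp [sp gp]]]]]] := good_system_exists univ p0.
have [_ [x [_ _ _ [_ _ tx _]]]] := good_facts univ gp; have [sysp usp _ _ _] := gp.
rewrite -pE in usp; have nE := good_rank univ gp; rewrite -pE in nE.
rewrite nE in fgh; apply: (left_factor_poly h0 fg fgh sys us sysp usp).
(* [t v = f], while [x] takes the value 1 on the row solution of the automaton of [p], so the second
   block contributes [- f]. *)
exists (col_mx v (- x)).
  apply/eqP; rewrite -col_mx0 => /eq_col_mx [_ /eqP]; rewrite oppr_eq0 => /eqP x0.
  by move: tx; rewrite x0 (map_mx0 kap) mulmx0 => /matrixP /(_ 0 0) /eqP; rewrite !mxE eqxx eq_sym oner_eq0.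
by rewrite map_col_mx (map_mxN kap) mul_row_col mulmxN -mulmxA tx mulmx1 -(linear_systemM sys) us subrr.
Qed.

(** [poly_factors] passes polynomiality from a node to its two children. *)
Lemma poly_leaves (T : tree F) h : tree_prod T = iota h -> h != 0 ->
  (forall l r, subtree (Node l r) T -> [/\ tree_prod l != 0, tree_prod r != 0 &
     (rank (tree_prod l) + rank (tree_prod r) <= rank (tree_prod (Node l r)) + 1)%N]) ->
  exists ps, leaves T = map iota ps.
Proof.
elim: T h => [x|l IHl r IHr] h /= Th h0 sub; first by exists [:: h]; rewrite Th.
have [l0 r0 lr] := sub l r (subtree_refl _); rewrite /= Th in lr.
have [[p pE] [q qE]] := poly_factors l0 r0 h0 Th lr.
have [|l' r' lr'|ps ->] := IHl p pE.
- by apply: contra_neq l0 => p0; rewrite pE p0 (rmorph0 iota).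
- by apply: sub; apply: subtree_left.
have [|l' r' lr'|qs ->] := IHr q qE.
- by apply: contra_neq r0 => q0; rewrite qE q0 (rmorph0 iota).
- by apply: sub; apply: subtree_right.
by exists (ps ++ qs); rewrite map_cat.
Qed.

Lemma left_factor_product (f g : F) : left_factor iota f (f * g) ->
  [/\ f != 0, g != 0 & (rank f + rank g <= rank (f * g)%R + 1)%N].
Proof.
case=> f0 fg0; rewrite mulrA (skew_mulVr F_field f0) mul1r => H _; split=> //.
by apply: contra_neq fg0 => ->; rewrite mulr0.
Qed.

Lemma right_factor_product (f g : F) : right_factor iota g (f * g) ->
  [/\ f != 0, g != 0 & (rank f + rank g <= rank (f * g)%R + 1)%N].
Proof.
case=> g0 fg0; rewrite -mulrA (skew_mulrV F_field g0) mulr1 => H _; split=> //.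
by apply: contra_neq fg0 => ->; rewrite mul0r.
Qed.

Lemma poly_left_factor p h : p != 0 -> h != 0 -> left_factor iota (iota p) (iota (p * h)).
Proof.
move=> p0 h0; have ip := iota_neq0 p0; have ih := iota_neq0 h0.
have phE := rmorphM iota p h; have ph0 := skew_mul_neq0 ip ih.
have phV : (iota (p * h))^-1 * iota p = (iota h)^-1.
  by rewrite phE (invrM (F_field ip) (F_field ih)) -mulrA (skew_mulVr F_field ip) mulr1.
split=> //; first by rewrite phE.
  rewrite {1}phE mulrA (skew_mulVr F_field ip) mul1r; exact: rank_product_leq.
by rewrite phV addnC; apply: rank_inverse_product_leq.
Qed.

Lemma poly_right_factor p h : p != 0 -> h != 0 -> right_factor iota (iota p) (iota (h * p)).
Proof.
move=> p0 h0; have ip := iota_neq0 p0; have ih := iota_neq0 h0.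
have phE := rmorphM iota h p; have ph0 := skew_mul_neq0 ih ip.
have phV : iota p * (iota (h * p))^-1 = (iota h)^-1.
  by rewrite phE (invrM (F_field ih) (F_field ip)) mulrA (skew_mulrV F_field ip) mul1r.
split=> //; first by rewrite phE.
  rewrite {1}phE -mulrA (skew_mulrV F_field ip) mulr1; exact: rank_product_leq.
by rewrite phV addnC; apply: rank_inverse_product_leq.
Qed.

Lemma subtree_node_leaves (a b : F) l r : subtree (Node l r) (Node (Leaf a) (Leaf b)) ->
  l = Leaf a /\ r = Leaf b.
Proof. by move=> H; inversion H; subst=> //; match goal with H : subtree _ (Leaf _) |- _ => inversion H end. Qed.

Lemma left_dividesP p q : p != 0 -> q != 0 ->
  left_divides_in_H p q <-> left_divides_in_F iota (iota p) (iota q).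
Proof.
move=> p0 q0; split=> [[h h0 qE]|[_ [_ [m' [m [fs [T [[_ _ [lT pT]] [_ qE sub]]]]]]]]].
  split; first exact: iota_neq0.
  split; first exact: iota_neq0.
  exists 1%N, 2%N, [tuple iota p; iota h], (Node (Leaf (iota p)) (Leaf (iota h))).
  have ph : iota p * iota h = iota q by rewrite qE (rmorphM iota).
  split; first by split=> //=; rewrite !iota_neq0.
  split; rewrite ?big_seq1 //= => l r /subtree_node_leaves [-> ->] /=.
  by rewrite ph qE; apply: poly_left_factor.
have [|ps psE] := poly_leaves pT q0.
  by move=> l r /sub /left_factor_product.
have hE : \prod_(x <- drop m' fs) x = iota (\prod_(x <- drop m' ps) x).
  by rewrite -lT psE -map_drop big_map (rmorph_prod iota).
have qE' : q = p * \prod_(x <- drop m' ps) x.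
  by apply: iota_inj; rewrite qE hE (rmorphM iota).
exists (\prod_(x <- drop m' ps) x) => //.
by apply: contra_neq q0 => h0; rewrite qE' h0 mulr0.
Qed.

Lemma right_dividesP p q : p != 0 -> q != 0 ->
  right_divides_in_H p q <-> right_divides_in_F iota (iota p) (iota q).
Proof.
move=> p0 q0; split=> [[h h0 qE]|[_ [_ [m' [m [fs [T [[_ _ [lT pT]] [_ qE sub]]]]]]]]].
  split; first exact: iota_neq0.
  split; first exact: iota_neq0.
  exists 1%N, 2%N, [tuple iota h; iota p], (Node (Leaf (iota h)) (Leaf (iota p))).
  have ph : iota h * iota p = iota q by rewrite qE (rmorphM iota).
  split; first by split=> //=; rewrite !iota_neq0.
  split; rewrite ?big_seq1 //= => l r /subtree_node_leaves [-> ->] /=.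
  by rewrite ph qE; apply: poly_right_factor.
have [|ps psE] := poly_leaves pT q0.
  by move=> l r /sub /right_factor_product.
have hE : \prod_(x <- take m' fs) x = iota (\prod_(x <- take m' ps) x).
  by rewrite -lT psE -map_take big_map (rmorph_prod iota).
have qE' : q = (\prod_(x <- take m' ps) x) * p.
  by apply: iota_inj; rewrite qE hE (rmorphM iota).
exists (\prod_(x <- take m' ps) x) => //.
by apply: contra_neq q0 => h0; rewrite qE' h0 mul0r.
Qed.

End Divisibility.

Theorem theorem3p8 (K : fieldType) (d : nat) (F : unitRingType)
    (iota : {rmorphism free_algebra K d -> F}) (p q : free_algebra K d) :
  (0 < d)%N -> universal_field_of_fractions iota -> p != 0 -> q != 0 ->
  (left_divides_in_H p q <-> left_divides_in_F iota (iota p) (iota q)) /\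
  (right_divides_in_H p q <-> right_divides_in_F iota (iota p) (iota q)).
Proof.
by move=> _ univ p0 q0; split; [apply: left_dividesP | apply: right_dividesP].
Qed.
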